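(* Let $X$ be a convex polytope with $v$ vertices, and let $PX$ be the pyramid over $X$, whose vertices are those of $X$ followed by the apex $t$. Let $(\mathbf a_1,\dots,\mathbf a_v)$ be a CM monomial labelling of $X$ by monomials in a polynomial ring $S$ over a field $k$, and let $y$ be a new variable. a. Then $(\mathbf a_1,\dots,\mathbf a_v,y)$ (the vertices of $X$ labelled as before and the apex labelled by $y$) is a CM monomial labelling of $PX$, with monomials in $S[y]$. b. The labelling of $X$ is maximal if and only if the associated labelling of $PX$ is maximal. c. Every maximal CM monomial labelling of $PX$ is, up to isomorphism, of this form.
   Context: The pyramid $PX$ over $X$ is the convex hull of $X$ and a point $t$ outside the affine span of $X$. A polytope is regarded as a regular cell complex consisting of all its faces, including itself. Fix a field $k$; $\mathbb N$ contains $0$. Identify $k[x_1,\dots,x_r]$ with the semigroup ring $k[\mathbb N^r]$, and let $Z$ be a regular cell complex (here $Z=X$ or $Z=PX$) with vertices ordered $1,\dots,n$. An object of $\mathrm{CM}(Z)$, also called a CM monomial labelling of $Z$, is a pair $(\mathbb N^r,\mathbf a)$ with $\mathbf a=(\mathbf a_1,\dots,\mathbf a_n)$ a tuple of elements of $\mathbb N^r$, i.e. monomials $m_i=\mathbf x^{\mathbf a_i}$ in $S=k[x_1,\dots,x_r]$, none dividing another, such that $S/(m_1,\dots,m_n)$ is Cohen-Macaulay of codimension $\dim Z+1$ and the cellular complex of $Z$ labelled by the $m_i$ is a minimal free resolution of $S/(m_1,\dots,m_n)$. Here each face $F$ (including the empty face) is labelled by the least common multiple $m_F$ of the labels of its vertices,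 and the cellular complex has a free generator $e_F$ in homological degree $\dim F+1$ for each face $F$, with differential $e_F\mapsto\sum_G\mathrm{sign}(G,F)\frac{m_F}{m_G}e_G$ over the codimension one faces $G$ of $F$, $\mathrm{sign}$ being an incidence function. A morphism $(\mathbb N^r,\mathbf a)\to(\mathbb N^s,\mathbf b)$ is a semigroup (monoid) homomorphism $\phi:\mathbb N^r\to\mathbb N^s$ with $\phi(\mathbf a_i)=\mathbf b_i$ for all $i$. An object of $\mathrm{CM}(Z)$ is maximal if for every morphism $\phi:(\mathbb N^s,\mathbf b)\to(\mathbb N^r,\mathbf a)$ in $\mathrm{CM}(Z)$ to it, $\phi$ is surjective and there is a splitting, i.e. a morphism $\psi:(\mathbb N^r,\mathbf a)\to(\mathbb N^s,\mathbf b)$ with $\phi\circ\psi=\mathrm{id}$. *)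

(* Defs.v *)
From mathcomp Require Import all_boot all_order all_algebra.
From mathcomp Require Export mpoly.

Set Implicit Arguments.
Unset Strict Implicit.
Unset Printing Implicit Defensive.

Import Order.TTheory GRing.Theory Num.Theory.
Local Open Scope ring_scope.

(** * Polytopes and their faces *)

Definition in_conv (R : realFieldType) (d n : nat) (p : 'I_n -> 'rV[R]_d)
    (x : 'rV[R]_d) : Prop :=
  exists w : 'I_n -> R,
    [/\ forall i, 0 <= w i, \sum_i w i = 1 & x = \sum_i w i *: p i].

Definition in_aff (R : realFieldType) (d n : nat) (p : 'I_n -> 'rV[R]_d)
    (x : 'rV[R]_d) : Prop :=
  exists w : 'I_n -> R, \sum_i w i = 1 /\ x = \sum_i w i *: p i.

(* Faces of the polytope conv p, recorded by their sets of vertices: F consists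
   of the vertices lying on the hyperplane x.c = b of a valid inequality
   x.c <= b.  The degenerate inequalities 0 <= 1 and 0 <= 0 give the empty face
   and the polytope itself. *)
Definition is_face (R : realFieldType) (d n : nat) (p : 'I_n -> 'rV[R]_d)
    (F : {set 'I_n}) : Prop :=
  exists (c : 'cV[R]_d) (b : R),
    (forall x, in_conv p x -> (x *m c) 0 0 <= b) /\
    (forall i, (i \in F) = ((p i *m c) 0 0 == b)).

(* p lists, without repetition, the vertices of the polytope conv p. *)
Definition polytope_vertices (R : realFieldType) (d n : nat)
    (p : 'I_n -> 'rV[R]_d) : Prop :=
  injective p /\ forall i, is_face p [set i].

(* dim F + 1, the homological degree of F: the affine dimension of a point set
   is one less than the rank of the vectors (p i, 1).  It is 0 for the empty
   face. *)
Definition hdeg (R : realFieldType) (d n : nat) (p : 'I_n -> 'rV[R]_d)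
    (F : {set 'I_n}) : nat :=
  \rank (\matrix_(i < n) (if i \in F then row_mx (p i) (1%:M : 'M[R]_1) else 0)).

Definition is_facet (R : realFieldType) (d n : nat) (p : 'I_n -> 'rV[R]_d)
    (G F : {set 'I_n}) : Prop :=
  [/\ is_face p G, is_face p F, G \subset F & hdeg p F = (hdeg p G).+1].

(* The last condition is usually written with the two faces H1, H2 strictly
   between G and F; all other terms of the sum vanish. *)
Definition incidence_function (R : realFieldType) (d n : nat)
    (p : 'I_n -> 'rV[R]_d) (sgn : {set 'I_n} -> {set 'I_n} -> int) : Prop :=
  [/\ forall G F, sgn G F \in [:: 0; 1; -1],
      forall G F, sgn G F <> 0 <-> is_facet p G F,
      forall i, sgn set0 [set i] = 1 &
      forall G F, is_face p G -> is_face p F -> G \subset F ->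
        hdeg p F = (hdeg p G).+2 -> \sum_H sgn G H * sgn H F = 0].

(* Vertices of the pyramid: those of the base, followed by the apex. *)
Definition pyramid (R : realFieldType) (d n : nat) (p : 'I_n -> 'rV[R]_d)
    (t : 'rV[R]_d) (i : 'I_n.+1) : 'rV[R]_d :=
  oapp p t (unlift ord_max i).

(** * Cohen-Macaulay quotients of a commutative ring

    Ideals of A/I are represented by the ideals of A containing I. *)

Definition is_ideal (A : comNzRingType) (I : A -> Prop) : Prop :=
  [/\ I 0, forall x y, I x -> I y -> I (x + y) & forall c x, I x -> I (c * x)].

Definition ideal_sub (A : comNzRingType) (I J : A -> Prop) : Prop :=
  forall x, I x -> J x.

Definition prime_ideal (A : comNzRingType) (P : A -> Prop) : Prop :=
  [/\ is_ideal P, ~ P 1 & forall x y, P (x * y) -> P x \/ P y].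

Definition maximal_ideal (A : comNzRingType) (P : A -> Prop) : Prop :=
  [/\ is_ideal P, ~ P 1 &
      forall J, is_ideal J -> ideal_sub P J -> ~ J 1 -> ideal_sub J P].

(* A chain Q 0 < ... < Q h = P of primes of A/I, of length h. *)
Definition prime_chain (A : comNzRingType) (I P : A -> Prop) (h : nat)
    (Q : nat -> A -> Prop) : Prop :=
  [/\ ideal_sub I (Q 0%N),
      forall x, Q h x <-> P x,
      forall i, (i <= h)%N -> prime_ideal (Q i) &
      forall i, (i < h)%N ->
        ideal_sub (Q i) (Q i.+1) /\ exists x, Q i.+1 x /\ ~ Q i x].

(* The height (codimension) of the prime P/I of A/I is h. *)
Definition height_mod (A : comNzRingType) (I P : A -> Prop) (h : nat) : Prop :=
  (exists Q, prime_chain I P h Q) /\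
  (forall m Q, prime_chain I P m Q -> (m <= h)%N).

(* The codimension of A/I is c: the least height of a prime containing I. *)
Definition codim_quot (A : comNzRingType) (I : A -> Prop) (c : nat) : Prop :=
  (exists P, [/\ prime_ideal P, ideal_sub I P &
                 height_mod (fun x => x = 0) P c]) /\
  (forall P h, prime_ideal P -> ideal_sub I P ->
     height_mod (fun x => x = 0) P h -> (c <= h)%N).

(* The ideal I + (s). *)
Definition ideal_add_seq (A : comNzRingType) (I : A -> Prop) (s : seq A)
    (x : A) : Prop :=
  exists (y : A) (c : nat -> A), I y /\ x = y + \sum_(i < size s) c i * s`_i.

Definition regular_seq (A : comNzRingType) (I : A -> Prop) (s : seq A) : Prop :=
  (forall i, (i < size s)%N -> forall x,
     ideal_add_seq I (take i s) (s`_i * x) -> ideal_add_seq I (take i s) x) /\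
  ~ ideal_add_seq I s 1.

(* depth(P, A/I) = h *)
Definition depth_mod (A : comNzRingType) (I P : A -> Prop) (h : nat) : Prop :=
  (exists s : seq A,
     [/\ regular_seq I s, {in s, forall x, P x} & size s = h]) /\
  (forall s : seq A,
     regular_seq I s -> {in s, forall x, P x} -> (size s <= h)%N).

(* For Noetherian A: depth and codimension agree at each maximal ideal. *)
Definition cohen_macaulay_quot (A : comNzRingType) (I : A -> Prop) : Prop :=
  forall P, maximal_ideal P -> ideal_sub I P ->
    exists h, depth_mod I P h /\ height_mod I P h.

(** * Labelled cellular complexes *)

Definition monomial_ideal (k : fieldType) (r n : nat) (a : 'I_n -> 'X_{1..r})
    (f : {mpoly k[r]}) : Prop :=
  exists g : 'I_n -> {mpoly k[r]}, f = \sum_i g i * 'X_[k, a i].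

Definition face_label (r n : nat) (a : 'I_n -> 'X_{1..r}) (F : {set 'I_n}) :
    'X_{1..r} :=
  \big[@mlcm r/0%MM]_(i in F) a i.

(* Elements of the free module on the generators e_F, F a face of
   homological degree j. *)
Definition is_chain (k : fieldType) (r : nat) (R : realFieldType) (d n : nat)
    (p : 'I_n -> 'rV[R]_d) (j : nat)
    (c : {ffun {set 'I_n} -> {mpoly k[r]}}) : Prop :=
  forall F, c F <> 0 -> is_face p F /\ hdeg p F = j.

(* Since sgn G F = 0 unless G is a facet of F, the truncated difference below
   is only used when m_G divides m_F. *)
Definition cell_diff (k : fieldType) (r n : nat)
    (sgn : {set 'I_n} -> {set 'I_n} -> int) (a : 'I_n -> 'X_{1..r})
    (c : {ffun {set 'I_n} -> {mpoly k[r]}}) :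
    {ffun {set 'I_n} -> {mpoly k[r]}} :=
  [ffun G => \sum_F (c F * 'X_[k, (face_label a F - face_label a G)%MM])
                      *~ sgn G F].

(* Exactness of ... -> C_2 -> C_1 -> C_0 = S e_set0 -> S/(m_1, ..., m_n) -> 0. *)
Definition is_free_resolution (k : fieldType) (r : nat) (R : realFieldType)
    (d n : nat) (p : 'I_n -> 'rV[R]_d)
    (sgn : {set 'I_n} -> {set 'I_n} -> int) (a : 'I_n -> 'X_{1..r}) : Prop :=
  (forall c : {ffun {set 'I_n} -> {mpoly k[r]}}, is_chain p 0 c ->
     (monomial_ideal a (c set0) <->
      exists e, is_chain p 1 e /\ cell_diff sgn a e = c)) /\
  (forall (j : nat) (c : {ffun {set 'I_n} -> {mpoly k[r]}}),
     is_chain p j.+1 c ->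
     (cell_diff sgn a c = 0 <->
      exists e, is_chain p j.+2 e /\ cell_diff sgn a e = c)).

(* The differential is zero modulo the ideal of the variables. *)
Definition is_minimal_complex (k : fieldType) (r : nat) (R : realFieldType)
    (d n : nat) (p : 'I_n -> 'rV[R]_d)
    (sgn : {set 'I_n} -> {set 'I_n} -> int) (a : 'I_n -> 'X_{1..r}) : Prop :=
  forall (j : nat) (c : {ffun {set 'I_n} -> {mpoly k[r]}}),
    is_chain p j c -> forall G, (cell_diff sgn a c G)@_0%MM = 0.

(** * The category CM(conv p) *)

Definition CM_labelling (k : fieldType) (R : realFieldType) (d n : nat)
    (p : 'I_n -> 'rV[R]_d) (r : nat) (a : 'I_n -> 'X_{1..r}) : Prop :=
  [/\ forall i j, i != j -> ~~ (a i <= a j)%MM,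
      cohen_macaulay_quot (@monomial_ideal k r n a),
      codim_quot (@monomial_ideal k r n a) (hdeg p [set: 'I_n]) &
      exists sgn, [/\ incidence_function p sgn,
        @is_free_resolution k r R d n p sgn a &
        @is_minimal_complex k r R d n p sgn a]].

Definition CM_morphism (n r s : nat) (a : 'I_n -> 'X_{1..r})
    (b : 'I_n -> 'X_{1..s}) (phi : 'X_{1..r} -> 'X_{1..s}) : Prop :=
  [/\ phi 0%MM = 0%MM, {morph phi : x y / (x + y)%MM} &
      forall i, phi (a i) = b i].

Definition CM_isomorphic (n r s : nat) (a : 'I_n -> 'X_{1..r})
    (b : 'I_n -> 'X_{1..s}) : Prop :=
  exists phi psi, [/\ CM_morphism a b phi, CM_morphism b a psi,
                      cancel phi psi & cancel psi phi].

Definition CM_maximal (k : fieldType) (R : realFieldType) (d n : nat)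
    (p : 'I_n -> 'rV[R]_d) (r : nat) (a : 'I_n -> 'X_{1..r}) : Prop :=
  CM_labelling k p a /\
  forall (s : nat) (b : 'I_n -> 'X_{1..s}) (phi : 'X_{1..s} -> 'X_{1..r}),
    CM_labelling k p b -> CM_morphism b a phi ->
    (forall y, exists x, phi x = y) /\
    (exists psi, CM_morphism a b psi /\ cancel psi phi).

(* The labelling (a_1, ..., a_n, y) over S[y]: y is the last variable, and
   mnmwiden is the inclusion of the monomials of S in those of S[y]. *)
Definition pyramid_label (r n : nat) (a : 'I_n -> 'X_{1..r}) (i : 'I_n.+1) :
    'X_{1..r.+1} :=
  oapp (fun j => mnmwiden (a j)) U_(ord_max)%MM (unlift ord_max i).

(* Main.v *)
Require Import Defs.
From HB Require Import structures.
From mathcomp Require Import all_boot all_order all_algebra.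
From mathcomp Require Import ring lra zify.
From mathcomp Require classical_sets.
From Stdlib Require Import Classical ClassicalEpsilon.

(** In both directions of the theorem the Cohen-Macaulay condition is a consequence of
    the rest of a labelling: if a complex of length [c] resolves [S/I] and [I] is a
    monomial ideal of codimension [c], then [S/I] is Cohen-Macaulay.  Let [D = r - c].
    Every elementary symmetric polynomial [e_j] with [j > D] has a power in [I], and by
    the Nullstellensatz a maximal ideal [P] contains, for each [j <= D], a nonconstant
    monic polynomial in [e_j].  Since [S] is flat over [k[e_1, ..., e_r]], these elements
    form regular sequences of [S] in any order; the powers lying in [I] keep the
    resolution exact modulo the others (a form of the acyclicity lemma of Peskine and
    Szpiro), so the latter form a regular sequence of length [D] modulo [I], inside [P].

    The rest is checked one multidegree at a time.  For the pyramid over [X], the part of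
    the cellular complex in a degree divisible by [y] is a cone.  Conversely, in a
    CM labelling of [PX] the label [m_t] of the apex is prime to the labels of [X]: if a
    variable [z] divides [m_t], the faces whose label is free of [z] resolve an ideal of
    codimension at least [dim X + 1], hence one of them has dimension at least [dim X],
    and this can only be [X] itself.  So the labels of [X], with [y] on the apex, give
    a labelling of [PX] mapping to the given one by [y |-> m_t]. *)

Set Implicit Arguments.
Unset Strict Implicit.
Unset Printing Implicit Defensive.

Import Order.TTheory GRing.Theory Num.Theory.
Local Open Scope ring_scope.

(** * Ideals and regular sequences *)

(** Depth is tested at every maximal ideal, over a field that may be finite, so generic linear forms
    cannot serve as parameters. Elementary symmetric polynomials require no choice: a term of [e_j]
    with [j > D] is a product of [j] variables; the other [r - j < c] variables do not meet every
    generator, so some generator involves only those [j] variables and divides a power of the term.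

    The depth of [S/I] and the lower bound on the dimension of a face free of [z] come from the same
    lemma [acyclicity]. It is stated for congruences modulo an ideal, so that no complex over a
    quotient ring is ever formed.

    Flatness enters as one property: a nonzerodivisor modulo an ideal stays one modulo the extended
    ideal. It is obtained by splitting off the variables one at a time, each as a root of a monic
    polynomial.

    Passing from [PX] back to [X] changes the polynomial ring as well as the ideal. The criterion
    leaves only exactness, codimension and minimality to be transferred, and these are
    combinatorial. *)

Lemma dep_choice (I T : Type) (P : I -> T -> Prop) :
  (forall i, exists y, P i y) -> exists f : I -> T, forall i, P i (f i).
Proof.
move=> H; exists (fun i => proj1_sig (constructive_indefinite_description _ (H i))).
by move=> i; case: constructive_indefinite_description.
Qed.

Section Ideals.
Variable A : comNzRingType.
Implicit Types (I J : A -> Prop) (s : seq A).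

Definition zero_ideal (x : A) : Prop := x = 0.

Definition add_elt J (x : A) (z : A) : Prop := exists y b, J y /\ z = y + b * x.

Lemma zero_idealP : is_ideal zero_ideal.
Proof. by rewrite /zero_ideal; split=> // [x y -> ->|c x ->]; rewrite ?addr0 ?mulr0. Qed.

Lemma ideal0 J : is_ideal J -> J 0. Proof. by case. Qed.
Lemma idealD J : is_ideal J -> forall x y, J x -> J y -> J (x + y). Proof. by case. Qed.
Lemma idealM J : is_ideal J -> forall c x, J x -> J (c * x). Proof. by case. Qed.
Lemma ideal_mulr J : is_ideal J -> forall c x, J x -> J (x * c).
Proof. by move=> hJ c x Jx; rewrite mulrC; apply: idealM. Qed.
Lemma idealN J : is_ideal J -> forall x, J x -> J (- x).
Proof. by move=> hJ x Jx; rewrite -mulN1r; apply: idealM. Qed.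
Lemma idealB J : is_ideal J -> forall x y, J x -> J y -> J (x - y).
Proof. by move=> hJ x y Jx Jy; apply: idealD => //; apply: idealN. Qed.
Lemma idealBK J : is_ideal J -> forall x y, J (x - y) -> J y -> J x.
Proof. by move=> hJ x y Jxy Jy; rewrite -(subrK y x); apply: idealD. Qed.
Lemma ideal_sum J : is_ideal J -> forall (T : Type) (r : seq T) (P : pred T) (F : T -> A),
  (forall i, P i -> J (F i)) -> J (\sum_(i <- r | P i) F i).
Proof. by move=> hJ T r P F H; elim/big_ind: _ => //; [apply: ideal0 | apply: idealD]. Qed.

Lemma add_elt_ideal J x : is_ideal J -> is_ideal (add_elt J x).
Proof.
move=> hJ; split.
- by exists 0, 0; rewrite mul0r addr0; split=> //; apply: ideal0.
- move=> _ _ [y [b [Jy ->]]] [y' [b' [Jy' ->]]].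
  by exists (y + y'), (b + b'); rewrite mulrDl addrACA; split=> //; apply: idealD.
- move=> c _ [y [b [Jy ->]]]; exists (c * y), (c * b).
  by rewrite mulrDr mulrA; split=> //; apply: idealM.
Qed.

Lemma add_elt_sub J x : ideal_sub J (add_elt J x).
Proof. by move=> y Jy; exists y, 0; rewrite mul0r addr0. Qed.

Lemma add_elt_mem J x : is_ideal J -> add_elt J x x.
Proof. by move=> hJ; exists 0, 1; rewrite mul1r add0r; split=> //; apply: ideal0. Qed.

Lemma add_elt_min J x K : is_ideal K -> ideal_sub J K -> K x -> ideal_sub (add_elt J x) K.
Proof. by move=> hK JK Kx _ [y [b [Jy ->]]]; apply: idealD => //; [apply: JK | apply: idealM]. Qed.

Lemma add_elt_mono J K x : ideal_sub J K -> ideal_sub (add_elt J x) (add_elt K x).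
Proof. by move=> JK _ [y [b [Jy ->]]]; exists y, b; split=> //; apply: JK. Qed.

Definition regular_mod J x := forall y, J (x * y) -> J y.

(** Regularity without properness of the ideal generated, so that it can be cut and extended freely;
    properness is added back in [regular_seqP]. *)
Fixpoint regular_list J s : Prop :=
  if s is x :: s' then regular_mod J x /\ regular_list (add_elt J x) s' else True.

Definition ideal_eq I J := forall x, I x <-> J x.

Lemma regular_mod_eq I J x : ideal_eq I J -> regular_mod I x -> regular_mod J x.
Proof. by move=> H R y /H/R/H. Qed.

Definition ideal_list J s := foldl add_elt J s.

Lemma ideal_list_ideal J s : is_ideal J -> is_ideal (ideal_list J s).
Proof. by elim: s J => //= x s IH J hJ; apply: IH; apply: add_elt_ideal. Qed.

Lemma ideal_list_sub J s : ideal_sub J (ideal_list J s).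
Proof. by elim: s J => [|x s IH] J y Jy //=; apply: IH; apply: add_elt_sub. Qed.

Lemma ideal_list_mem J s x : is_ideal J -> x \in s -> ideal_list J s x.
Proof.
elim: s J => //= y s IH J hJ; rewrite inE => /predU1P[->|xs].
  by apply: ideal_list_sub; apply: add_elt_mem.
by apply: IH => //; apply: add_elt_ideal.
Qed.

Lemma ideal_list_min J s K : is_ideal K -> ideal_sub J K -> {in s, forall x, K x} ->
  ideal_sub (ideal_list J s) K.
Proof.
elim: s J => //= x s IH J hK JK sK; apply: IH => //.
  by apply: add_elt_min => //; apply: sK; rewrite mem_head.
by move=> y ys; apply: sK; rewrite inE ys orbT.
Qed.

Lemma ideal_list_mono J K s : ideal_sub J K -> ideal_sub (ideal_list J s) (ideal_list K s).
Proof. by elim: s J K => [|x s IH] J K JK; [exact: JK | apply: IH]; apply: add_elt_mono. Qed.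

Lemma ideal_list_rcons J s x : ideal_list J (rcons s x) = add_elt (ideal_list J s) x.
Proof. by rewrite /ideal_list foldl_rcons. Qed.

Lemma ideal_add_seqE I s : is_ideal I -> ideal_eq (ideal_add_seq I s) (ideal_list I s).
Proof.
move=> hI x; elim/last_ind: s x => [|s y IH] x.
  split=> [[z [c [Iz ->]]]|Ix]; first by rewrite big_ord0 addr0.
  by exists x, (fun=> 0); rewrite big_ord0 addr0.
rewrite ideal_list_rcons; split.
  move=> [z [c [Iz ->]]]; exists (z + \sum_(i < size s) c i * s`_i), (c (size s)).
  split; first by apply/IH; exists z, c.
  rewrite size_rcons big_ord_recr /= nth_rcons ltnn eqxx addrA; congr (_ + _ + _).
  by apply: eq_bigr => i _; rewrite nth_rcons ltn_ord.
move=> [z [b [/IH[w [c [Iw ->]]] ->]]].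
exists w, (fun i => if (i < size s)%N then c i else b); split=> //.
rewrite size_rcons big_ord_recr /= nth_rcons ltnn eqxx addrA; congr (_ + _ + _).
by apply: eq_bigr => i _; rewrite nth_rcons ltn_ord.
Qed.

Lemma regular_seqP I s : is_ideal I ->
  regular_seq I s <-> (regular_list I s /\ ~ ideal_list I s 1).
Proof.
move=> hI; suff E : (forall i, (i < size s)%N -> forall x,
     ideal_add_seq I (take i s) (s`_i * x) -> ideal_add_seq I (take i s) x)
     <-> regular_list I s.
  split=> -[H1 H2]; split; try by apply/E.
    by move/(ideal_add_seqE s hI).
  by move/(ideal_add_seqE s hI).
have -> : (forall i, (i < size s)%N -> forall x,
     ideal_add_seq I (take i s) (s`_i * x) -> ideal_add_seq I (take i s) x)
     <-> (forall i, (i < size s)%N -> regular_mod (ideal_list I (take i s)) s`_i).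
  by split=> H i ilt y /(ideal_add_seqE _ hI)/(H i ilt)/(ideal_add_seqE _ hI).
elim: s I {hI} => //= x s IH I; split=> [H|[r1 /IH r2] [|i] //= ilt]; last exact: r2.
split; first exact: (H 0%N).
by apply/IH => i ilt; apply: (H i.+1).
Qed.

End Ideals.

(** * Acyclicity of complexes of free modules *)

Section Complex.
Variables (A : comNzRingType) (X : finType) (M : X -> X -> A) (C : nat -> X -> Prop).
Implicit Types (J : A -> Prop) (c e u w : X -> A).

Definition bd c (G : X) : A := \sum_F c F * M F G.

Definition supported j c : Prop := forall F, c F <> 0 -> C j F.

(** Chains of the reduced complex are represented by chains over [A], compared modulo [J]; the
    support condition is imposed on the representatives. *)
Definition bounds_mod J j u := exists e, supported j.+1 e /\ forall G, J (u G - bd e G).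

Definition exact_mod J j := forall c, supported j c -> (forall G, J (bd c G)) -> bounds_mod J j c.

Hypothesis bd_degree : forall j F G, C j.+1 F -> M F G <> 0 -> C j G.
Hypothesis bd_bd : forall c G, bd (bd c) G = 0.

Lemma bdZ a c G : bd (fun F => a * c F) G = a * bd c G.
Proof. by rewrite /bd mulr_sumr; apply: eq_bigr => F _; rewrite mulrA. Qed.

Lemma bdB c e G : bd (fun F => c F - e F) G = bd c G - bd e G.
Proof. by rewrite /bd -sumrB; apply: eq_bigr => F _; rewrite mulrBl. Qed.

Lemma bd_ideal J c G : is_ideal J -> (forall F, J (c F)) -> J (bd c G).
Proof. by move=> hJ Jc; apply: ideal_sum => // F _; apply: ideal_mulr. Qed.

Lemma supported_bd j c : supported j.+1 c -> supported j (bd c).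
Proof.
move=> sc G bdG; have [//|nC] := classic (C j G); case: bdG.
apply: big1 => F _; have [->|cF] := eqVneq (c F) 0; first by rewrite mul0r.
have [->|MF] := eqVneq (M F G) 0; first by rewrite mulr0.
by case: nC; apply: bd_degree (sc F _) _; apply/eqP.
Qed.

Lemma supportedB j c e : supported j c -> supported j e -> supported j (fun F => c F - e F).
Proof.
move=> sc se F; have [c0|/eqP/sc//] := eqVneq (c F) 0.
have [e0|/eqP/se//] := eqVneq (e F) 0.
by rewrite c0 e0 subr0.
Qed.

Lemma supportedZ j a c : supported j c -> supported j (fun F => a * c F).
Proof. by move=> sc F; have [->|/eqP/sc//] := eqVneq (c F) 0; rewrite mulr0. Qed.

Lemma add_elt_quotient J x j c : is_ideal J -> supported j c ->
  (forall G, add_elt J x (c G)) ->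
  exists u, supported j u /\ forall G, J (c G - x * u G).
Proof.
move=> hJ sc H.
(* Choosing 0 wherever [c] vanishes keeps the quotient supported in the same degree. *)
have /dep_choice[u hu] : forall G, exists b, J (c G - x * b) /\ (c G = 0 -> b = 0).
  move=> G; have [c0|c0] := eqVneq (c G) 0.
    by exists 0; rewrite c0 mulr0 subr0; split=> //; apply: ideal0.
  have [y [b [Jy E]]] := H G; exists b; split; first by rewrite E [b * x]mulrC addrK.
  by move=> E0; rewrite E0 eqxx in c0.
exists u; split=> [F uF|G]; last by case: (hu G).
by apply: sc => cF; apply: uF; case: (hu F) => _; apply.
Qed.

(** The long exact homology sequence of multiplication by [x], chased by hand: the boundary of [c]
    is [x u] with [u] a cycle, [u] bounds some [w], and [c - x w] is a cycle modulo [J]. *)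
Lemma exact_mod_add J x j : is_ideal J -> regular_mod J x ->
  exact_mod J j -> exact_mod J j.+1 -> exact_mod (add_elt J x) j.+1.
Proof.
move=> hJ rx ex0 ex1 c sc /(add_elt_quotient hJ (supported_bd sc))[u [su hu]].
have [|w [sw hw]] := ex0 u su.
  move=> G; apply: rx.
  have := bd_ideal G hJ hu; rewrite bdB bd_bd bdZ sub0r => /(idealN hJ).
  by rewrite opprK.
have [||e [se he]] := ex1 (fun F => c F - x * w F).
- by apply: supportedB => //; apply: supportedZ.
- move=> G; rewrite bdB bdZ -(subrK (x * u G) (bd c G)) -addrA -mulrBr.
  by apply: idealD => //; apply: idealM.
exists e; split=> // G; exists (c G - x * w G - bd e G), (w G); split=> //.
by rewrite mulrC addrAC subrK.
Qed.

(* Modulo [x], the class of [u] lifts to a class one degree higher, namely the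
   class of [w] where [x u] is the boundary of [w]. *)
Lemma acyclicity (hs : seq A) J j u :
  is_ideal J -> regular_list J hs -> (forall F, ~ C (j + size hs) F) ->
  (forall i, (j < i)%N -> exact_mod J i) ->
  supported j u -> (forall x, x \in hs -> bounds_mod J j (fun G => x * u G)) ->
  bounds_mod J j u.
Proof.
elim: hs J j u => [|x hs IH] J j u hJ /=.
  rewrite addn0 => _ nC _ su _; exists (fun=> 0); split=> [F /eqP|G]; first by rewrite eqxx.
  have -> : u G = 0 by apply/eqP/negPn/negP => /eqP/su; apply: nC.
  by rewrite /bd big1 ?subr0 => [|F _]; rewrite ?mul0r //; apply: ideal0.
rewrite addnS -addSn => -[rx rhs] nC ex su Hu.
have [w [sw hw]] := Hu x (mem_head _ _).
have hJx := add_elt_ideal x hJ.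
have [||e [se he]] := IH _ j.+1 w hJx rhs nC _ sw.
- move=> [//|i] ji; apply: exact_mod_add => //; apply: ex => //; exact: ltnW.
- move=> y yhs; have [|v [sv hv]] := Hu y; first by rewrite inE yhs orbT.
  (* Both [y w] and [x v] have boundary [x y u] modulo [J], so their difference is a cycle and [y]
     kills the class of [w] modulo [J + (x)]. *)
  have [||e [se he]] := ex j.+1 (ltnSn j) (fun G => y * w G - x * v G).
  + by apply: supportedB; apply: supportedZ.
  + move=> G; rewrite bdB !bdZ.
    have -> : y * bd w G - x * bd v G =
       x * (y * u G - bd v G) - y * (x * u G - bd w G).
      by ring.
    by apply: idealB => //; apply: idealM.
  exists e; split=> // G; exists (y * w G - x * v G - bd e G), (v G); split=> //.
  by rewrite [v G * x]mulrC addrAC subrK.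
(* Here [w - bd e = x z] modulo [J]; taking boundaries, [x u] agrees with [x] times the boundary of
   [z], and [x] cancels. *)
have [z [sz hz]] := add_elt_quotient hJ (supportedB sw (supported_bd se)) he.
exists z; split=> // G; apply: rx.
rewrite mulrBr -(subrK (bd w G) (x * u G)) -addrA; apply: idealD => //.
by have := bd_ideal G hJ hz; rewrite !bdB bd_bd bdZ subr0.
Qed.

(** Exactness modulo [g] in degrees at least 2 is formal. The homology in degree 1 modulo [g] embeds
    in the homology of degree 0 modulo [J], which the [hs] kill, so [acyclicity] makes it vanish.
    Its vanishing says that [g] is injective on the homology of degree 0. *)
Lemma regular_step J g (hs : seq A) :
  is_ideal J -> regular_mod J g -> (forall j, exact_mod J j.+1) ->
  regular_list (add_elt J g) hs -> (forall F, ~ C (1 + size hs) F) ->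
  (forall h u, h \in hs -> supported 0 u -> bounds_mod J 0 (fun G => h * u G)) ->
  (forall j, exact_mod (add_elt J g) j.+1) /\
  (forall u, supported 0 u -> bounds_mod J 0 (fun G => g * u G) -> bounds_mod J 0 u).
Proof.
move=> hJ rg ex rhs nC Hhs; have hJg := add_elt_ideal g hJ.
have ex1 : exact_mod (add_elt J g) 1.
  move=> c sc Hc; apply: (acyclicity hJg rhs nC _ sc) => [[|[|i]] // _|h hhs].
    exact: exact_mod_add.
  have [u [su hu]] := add_elt_quotient hJ (supported_bd sc) Hc.
  have [w [sw hw]] := Hhs _ _ hhs su.
  have [||e [se he]] := ex 0%N (fun G => h * c G - g * w G).
  - by apply: supportedB; apply: supportedZ.
  - move=> G; rewrite bdB !bdZ.
    have -> : h * bd c G - g * bd w G = h * (bd c G - g * u G) + g * (h * u G - bd w G).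
      by ring.
    by apply: idealD => //; apply: idealM.
  exists e; split=> // G; exists (h * c G - g * w G - bd e G), (w G); split=> //.
  by rewrite [w G * g]mulrC addrAC subrK.
split=> [[|j]|u su [c [sc hc]]]; [exact: ex1 | exact: exact_mod_add | ].
have [|e [se he]] := ex1 c sc.
  move=> G; exists (- (g * u G - bd c G)), (u G); split; first exact: idealN.
  by ring.
have [w [sw hw]] := add_elt_quotient hJ (supportedB sc (supported_bd se)) he.
exists w; split=> // G; apply: rg.
rewrite mulrBr -(subrK (bd c G) (g * u G)) -addrA; apply: idealD => //.
by have := bd_ideal G hJ hw; rewrite !bdB bd_bd bdZ subr0.
Qed.

End Complex.

(** * Prime ideals and chains *)

Lemma prime_avoiding (A : comNzRingType) (J M : A -> Prop) :
  is_ideal J -> M 1 -> (forall x y, M x -> M y -> M (x * y)) ->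
  (forall x, M x -> ~ J x) ->
  exists Q, [/\ prime_ideal Q, ideal_sub J Q & forall x, M x -> ~ Q x].
Proof.
move=> hJ M1 MM MJ.
(* Zorn is applied to sets that need not contain [J], and [J] is added by [U]: the empty chain then
   has the empty set as an admissible union. *)
pose U I (x : A) := J x \/ I x.
have [|I [[idI dI] maxI]] := @classical_sets.Zorn_bigcup A
    (fun I => is_ideal (U I) /\ forall x, M x -> ~ U I x).
  move=> F FP totF; split.
  - split; first by left; apply: ideal0.
    + move=> x y [Jx|[I FI Ix]] [Jy|[I' FI' Iy]].
      * by left; apply: idealD.
      * have [idI _] := FP _ FI'.
        by have [J'|I''] := idealD idI (or_introl Jx) (or_intror Iy); [left | right; exists I'].
      * have [idI _] := FP _ FI.
        by have [J'|I''] := idealD idI (or_intror Ix) (or_introl Jy); [left | right; exists I].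
      * have [sub|sub] := totF _ _ FI FI'.
          have [idI _] := FP _ FI'.
          have [J'|I''] := idealD idI (or_intror (sub _ Ix)) (or_intror Iy);
            by [left | right; exists I'].
        have [idI _] := FP _ FI.
        have [J'|I''] := idealD idI (or_intror Ix) (or_intror (sub _ Iy));
          by [left | right; exists I].
    + move=> c x [Jx|[I FI Ix]]; first by left; apply: idealM.
      have [idI _] := FP _ FI.
      by have [J'|I''] := idealM idI c (or_intror Ix); [left | right; exists I].
  - move=> x Mx [/(MJ _ Mx)//|[I FI Ix]].
    by have [_ /(_ _ Mx)] := FP _ FI; apply; right.
have key x : ~ U I x -> exists m, M m /\ add_elt (U I) x m.
  move=> nUx; apply: NNPP => nm; apply: (maxI (add_elt (U I) x)).
    split=> [y Iy|sub]; first by apply: add_elt_sub; right.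
    by apply: nUx; right; apply: sub; apply: add_elt_mem.
  have E y : U (add_elt (U I) x) y <-> add_elt (U I) x y.
    split=> [[Jy|//]|H]; [by apply: add_elt_sub; left | by right].
  split=> [|y My /E Uy]; last by apply: nm; exists y.
  have [z0 zD zM] := add_elt_ideal x idI; split; first exact/E.
    by move=> y z /E Uy /E Uz; apply/E/zD.
  by move=> c y /E Uy; apply/E/zM.
exists (U I); split=> //; last by move=> x Jx; left.
split=> //; first exact: dI.
move=> x y Uxy; apply: NNPP => /not_or_and[/key[m [Mm [u [a [Uu Em]]]]]].
move=> /key[n [Mn [w [b [Uw En]]]]]; apply: (dI (m * n)); first exact: MM.
have -> : m * n = w * m + b * y * u + (a * b) * (x * y) by rewrite Em En; ring.
apply: (idealD idI _ (idealM idI _ Uxy)).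
exact: (idealD idI (ideal_mulr idI _ Uw) (idealM idI _ Uu)).
Qed.

(* The multiplicative set of the products [u * x ^ n] with [u] outside [P] is
   disjoint from [J], since [x] is a nonzerodivisor modulo [J]. *)
Lemma regular_avoided_prime (A : comNzRingType) (J P : A -> Prop) (x : A) :
  is_ideal J -> prime_ideal P -> ideal_sub J P -> regular_mod J x ->
  exists Q, [/\ prime_ideal Q, ideal_sub J Q, ideal_sub Q P & ~ Q x].
Proof.
move=> hJ [idP P1 primeP] JP rx.
have [||||Q [primeQ JQ MQ]] := @prime_avoiding A J
    (fun z => exists u n, ~ P u /\ z = u * x ^+ n) => //.
- by exists 1, 0%N; rewrite mulr1.
- move=> _ _ [u [n [nPu ->]]] [w [m [nPw ->]]]; exists (u * w), (n + m)%N.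
  by split=> [/primeP[]//|]; rewrite exprD; ring.
- move=> _ [u [n [nPu ->]]] Jux; apply: nPu; apply: JP.
  by elim: n Jux => [|n IH]; rewrite ?mulr1 // exprS mulrCA => /rx/IH.
exists Q; split=> // [z Qz|Qx].
  by apply: NNPP => nPz; apply: MQ Qz; exists z, 0%N; rewrite mulr1.
by apply: MQ Qx; exists 1, 1%N; rewrite mul1r.
Qed.

Lemma prime_chain_rcons (A : comNzRingType) (J Q P : A -> Prop) (h : nat) C :
  prime_chain J Q h C -> prime_ideal P -> ideal_sub Q P -> (exists x, P x /\ ~ Q x) ->
  exists C', prime_chain J P h.+1 C'.
Proof.
move=> [JC CQ primeC stepC] primeP QP [x [Px nQx]].
exists (fun i => if (i <= h)%N then C i else P); split=> //.
- by rewrite ltnn.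
- by move=> i _; case: ifP => [/primeC|].
- move=> i; rewrite ltnS => ih /=; rewrite ih.
  move: ih; rewrite leq_eqVlt => /predU1P[->|ih]; last by rewrite ih; apply: stepC.
  by rewrite ltnn; split=> [y /CQ/QP//|]; exists x; split=> // /CQ.
Qed.

Lemma regular_list_rcons (A : comNzRingType) (J : A -> Prop) s x :
  regular_list J (rcons s x) <-> regular_list J s /\ regular_mod (ideal_list J s) x.
Proof.
elim: s J => [|y s IH] J /=; first by split=> [[]|[]].
by split=> [[? /IH[]]|[[? ?] ?]]; [|split=> //; apply/IH].
Qed.

(** Built from the top: below [P] there is a prime that contains the earlier elements but avoids the
    last one, and the induction continues under it. This bounds depth by lengths of prime chains. *)
Lemma regular_list_prime_chain (A : comNzRingType) (J P : A -> Prop) s :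
  is_ideal J -> prime_ideal P -> ideal_sub J P -> regular_list J s ->
  {in s, forall x, P x} -> exists C, prime_chain J P (size s) C.
Proof.
move=> hJ; elim/last_ind: s P => [|s x IH] P primeP JP.
  by exists (fun=> P); split=> // -[].
move=> /regular_list_rcons[rs rx] sP; rewrite size_rcons.
have hJs := ideal_list_ideal s hJ; have [idP _ _] := primeP.
have [|Q [primeQ JQ QP Qx]] := regular_avoided_prime hJs primeP _ rx.
  by apply: ideal_list_min => // y ys; apply: sP; rewrite mem_rcons inE ys orbT.
have [||||C chC] := IH Q => //.
- by move=> y Jy; apply/JQ/ideal_list_sub.
- by move=> y ys; apply/JQ/ideal_list_mem.
apply: prime_chain_rcons chC primeP QP _; exists x; split=> //.
by apply: sP; rewrite mem_rcons mem_head.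
Qed.

(** * The dimension of a polynomial ring *)

(** The exponents of monomials of degree below [N] lie in a box with [N ^ r] points; this crude
    count suffices for comparing orders of growth. *)
Lemma mpoly_linear_dependence (k : fieldType) (r N q : nat) (g : 'I_q -> {mpoly k[r]}) :
  (forall i, (msize (g i) <= N)%N) -> (N ^ r < q)%N ->
  exists v : 'I_q -> k, (exists i, v i != 0) /\ \sum_i v i *: g i = 0.
Proof.
move=> gN Nq; pose U := {ffun 'I_r -> 'I_N}.
pose mon (u : U) := [multinom (u l : nat) | l < r].
pose B := \matrix_(i < q, j < #|U|) (g i)@_(mon (enum_val j)).
have nzK : kermx B != 0.
  rewrite kermx_eq0 -row_leq_rank -ltnNge; apply: leq_ltn_trans (rank_leq_col _) _.
  by rewrite card_ffun !card_ord.
pose w := nz_row (kermx B).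
have wB : w *m B = 0 by apply/sub_kermxP/nz_row_sub.
have /rV0Pn[i0 wi0] : w != 0 by rewrite nz_row_eq0.
exists (w 0); split; first by exists i0.
apply/mpolyP => m; rewrite mcoeff0 raddf_sum /=.
have [mN|Nm] := ltnP (mdeg m) N; last first.
  apply: big1 => i _; rewrite mcoeffZ memN_msupp_eq0 ?mulr0 //.
  by apply: msize_mdeg_ge; apply: leq_trans Nm.
have mlN l : (m l < N)%N.
  by apply: leq_ltn_trans mN; rewrite mdegE (bigD1 l) //= leq_addr.
pose u : U := [ffun l => Ordinal (mlN l)].
have <- : mon u = m by apply/mnmP => l; rewrite mnmE ffunE.
have := congr1 (fun C : 'M_(1, _) => C 0 (enum_rank u)) wB.
rewrite !mxE => E; rewrite -[RHS]E; apply: eq_bigr => i _.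
by rewrite mcoeffZ mxE enum_rankK.
Qed.

Definition deg_le (k : fieldType) (r d : nat) (f : {mpoly k[r]}) := (msize f <= d.+1)%N.

Lemma deg_leM (k : fieldType) r d e (f g : {mpoly k[r]}) :
  deg_le d f -> deg_le e g -> deg_le (d + e) (f * g).
Proof.
rewrite /deg_le => df dg.
have [->|f0] := eqVneq f 0; first by rewrite mul0r msize0.
have [->|g0] := eqVneq g 0; first by rewrite mulr0 msize0.
by rewrite msizeM // -subn1 leq_subLR (leq_trans (leq_add df dg)) // addSn addnS.
Qed.

Lemma deg_leX (k : fieldType) r d n (f : {mpoly k[r]}) :
  deg_le d f -> deg_le (n * d) (f ^+ n).
Proof.
by move=> df; elim: n => [|n IH]; rewrite ?expr0 /deg_le ?msize1 // exprS mulSn; apply: deg_leM.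
Qed.

(** Exponent vectors with entries below [B], as lists so that an induction can peel off the first
    element of [fs]. *)
Fixpoint words (B m : nat) : seq (seq nat) :=
  if m is m'.+1 then [seq a :: t | a <- iota 0 B, t <- words B m'] else [:: [::]].

Lemma size_words B m : size (words B m) = (B ^ m)%N.
Proof. by elim: m => //= m IH; rewrite size_allpairs size_iota IH expnS. Qed.

Lemma words_uniq B m : uniq (words B m).
Proof.
by elim: m => //= m IH; apply: allpairs_uniq; rewrite ?iota_uniq // => -[a s] [b t] _ _ [-> ->].
Qed.

Fixpoint monomial_value (A : comNzRingType) (fs : seq A) (t : seq nat) : A :=
  match fs, t with f :: fs', a :: t' => f ^+ a * monomial_value fs' t' | _, _ => 1 end.

Lemma deg_le_monomial_value (k : fieldType) r (fs : seq {mpoly k[r]}) d B t :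
  {in fs, forall f, deg_le d f} -> t \in words B (size fs) ->
  deg_le (size fs * (B * d)) (monomial_value fs t).
Proof.
elim: fs t => [|f fs IH] t /= dfs; first by rewrite /deg_le msize1.
move=> /allpairsP[[a s] [/= aB sw ->]] /=; rewrite mulSn; apply: deg_leM.
  apply: leq_trans (deg_leX a _) _; first by apply: dfs; rewrite mem_head.
  by rewrite ltnS leq_mul2r; move: aB; rewrite mem_iota add0n => /ltnW->; rewrite orbT.
by apply: IH => // g gs; apply: dfs; rewrite inE gs orbT.
Qed.

Lemma prime_idealX_cancel (A : comNzRingType) (P : A -> Prop) x y n :
  prime_ideal P -> ~ P x -> P (x ^+ n * y) -> P y.
Proof.
move=> [_ _ primeP] nPx; elim: n => [|n IH]; first by rewrite mul1r.
by rewrite exprS -mulrA => /primeP[].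
Qed.

(* A polynomial relation lying in the first prime of the chain: its terms free of the
   first variable lie in the second prime, and so on. *)
Lemma prime_chain_independent (k : fieldType) r (C : nat -> {mpoly k[r]} -> Prop)
    (fs : seq {mpoly k[r]}) B (c : seq nat -> k) :
  (forall i, (i <= size fs)%N -> prime_ideal (C i)) ->
  (forall i, (i < size fs)%N -> ideal_sub (C i) (C i.+1)) ->
  (forall i, (i < size fs)%N -> C i.+1 fs`_i /\ ~ C i fs`_i) ->
  C 0%N (\sum_(t <- words B (size fs)) c t *: monomial_value fs t) ->
  {in words B (size fs), forall t, c t = 0}.
Proof.
elim: fs C c => [|f fs IH] C c primeC subC stepC /=.
  rewrite big_seq1 => C0 t; rewrite inE => /eqP->; apply/eqP/negPn/negP => c0.
  have [idC C1 _] := primeC 0%N isT; apply: C1.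
  have := idealM idC ((c [::])^-1)%:MP C0.
  by rewrite mul_mpolyC scalerA mulVf // scale1r.
rewrite big_allpairs_dep /= => C0 _ /allpairsP[[a s] [/= aB sw ->]].
pose S a := \sum_(t <- words B (size fs)) c (a :: t) *: monomial_value fs t.
have {}C0 : C 0%N (\sum_(a <- iota 0 B) f ^+ a * S a).
  congr (C 0%N _): C0; apply: eq_bigr => b _; rewrite mulr_sumr.
  by apply: eq_bigr => t _; rewrite scalerAr.
suff Sa : forall a, (a < B)%N -> {in words B (size fs), forall t, c (a :: t) = 0}.
  by move: aB; rewrite mem_iota add0n => /Sa; apply.
move=> {a s sw aB} a; elim/ltn_ind: a => a IHa aB.
apply: (IH (fun i => C i.+1)) => [i|i|i|].
- exact: (primeC i.+1).
- exact: (subC i.+1).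
- exact: (stepC i.+1).
rewrite -/(S a).
have [id0 _ prime0] := primeC 0%N isT; have [id1 _ _] := primeC 1%N isT.
have [C1f nC0f] := stepC 0%N isT.
(* The terms of exponent below [a] vanish by induction, so [f ^+ a] factors out and cancels in the
   prime [C 0]. What is left is [S a] up to a multiple of [f], which lies in [C 1]. *)
have E : \sum_(a <- iota 0 B) f ^+ a * S a =
    f ^+ a * (S a + f * \sum_(a.+1 <= b < B) f ^+ (b - a.+1) * S b).
  rewrite -{1}[B]subn0 -/(index_iota 0 B).
  rewrite (big_cat_nat (n := a)) //=; last exact: ltnW.
  rewrite big_nat big1 ?add0r => [|b /andP[_ ba]].
    rewrite big_ltn // mulrDr; congr (_ + _).
    rewrite mulrA -exprSr mulr_sumr [LHS]big_nat [RHS]big_nat; apply: eq_bigr => b /andP[ab _].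
    by rewrite mulrA -exprD subnKC.
  rewrite {1}/S big_seq big1 ?mulr0 // => t tw.
  by rewrite IHa ?scale0r //; apply: ltn_trans aB.
move: C0; rewrite E => C0.
move: C0 => /(prime_idealX_cancel (primeC 0%N isT) nC0f) /(subC 0%N isT).
rewrite -[f * _]opprK => /(idealBK id1); apply; apply: idealN => //.
exact: ideal_mulr.
Qed.

(** One element from each step of the chain gives [m] polynomials whose [B ^ m] monomials with
    exponents below [B] are linearly independent. Their degrees grow linearly in [B], so they lie in
    a space of dimension of order [B ^ r]. *)
Theorem krull_dim_mpoly (k : fieldType) (r m : nat) (C : nat -> {mpoly k[r]} -> Prop) :
  (forall i, (i <= m)%N -> prime_ideal (C i)) ->
  (forall i, (i < m)%N -> ideal_sub (C i) (C i.+1) /\ exists x, C i.+1 x /\ ~ C i x) ->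
  (m <= r)%N.
Proof.
move=> primeC stepC; rewrite leqNgt; apply/negP => rm.
have /dep_choice[f hf] : forall i : 'I_m, exists x, C i.+1 x /\ ~ C i x.
  by move=> i; case: (stepC i).
pose fs := [seq f i | i <- enum 'I_m].
have sfs : size fs = m by rewrite size_map size_enum_ord.
pose d := \max_i msize (f i).
have dfs : {in fs, forall g, deg_le d g}.
  by move=> _ /mapP[i _ ->]; apply/leqW/leq_bigmax.
(* With these values the dimension bound satisfies [(m B d + 1)^r <= (B D)^r = B^r D^r < B^(r+1) <=
   B^m]. *)
pose D := (m * d).+1; pose B := (D ^ r).+1.
pose W := words B m.
have sW : size W = (B ^ m)%N by rewrite size_words.
have [||v [[i0 vi0] hv]] := @mpoly_linear_dependence k r (m * (B * d)).+1 (size W)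
    (fun i => monomial_value fs (nth [::] W i)).
- move=> i; rewrite -[m in (m * _)%N]sfs; apply: deg_le_monomial_value => //.
  by rewrite sfs mem_nth.
- rewrite sW; apply: (@leq_ltn_trans (B ^ r * D ^ r)).
    rewrite -expnMn; have [->//|r0] := posnP r.
    by rewrite leq_exp2r // mulnCA /D mulnS addnC -addn1 leq_add2l.
  apply: (@leq_trans (B ^ r.+1)); last by rewrite leq_pexp2l.
  by rewrite expnSr ltn_pmul2l ?expn_gt0.
pose c t := if insub (index t W) is Some i then v i else 0.
have c0 : {in W, forall t, c t = 0}.
  rewrite /W -sfs; apply: (@prime_chain_independent k r C fs) => [i|i|i|].
  - by rewrite sfs; apply: primeC.
  - by rewrite sfs => /stepC[].
  - rewrite sfs => im; have := hf (Ordinal im); rewrite /fs (nth_map (Ordinal im)) ?size_enum_ord //.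
    by rewrite -[i in nth _ _ i]/(nat_of_ord (Ordinal im)) nth_ord_enum.
  rewrite sfs (big_nth [::]) big_mkord.
  have [id0 _ _] := primeC 0%N isT.
  rewrite [X in C _ X](_ : _ = 0); first exact: ideal0.
  rewrite -[RHS]hv; apply: eq_bigr => i _.
  by rewrite /c index_uniq ?words_uniq // valK.
have := c0 (nth [::] W i0) (mem_nth _ (ltn_ord i0)).
by rewrite /c index_uniq ?words_uniq // valK => /eqP; rewrite (negPf vi0).
Qed.

(** * The Nullstellensatz *)

Section Integrality.
Variables (A : comNzRingType) (K : fieldType) (phi : {rmorphism A -> K}).

(** Membership in the subring [phi(A)[s]], given as an intersection so that a property of its
    elements follows from closure alone. *)
Definition generated (s : seq K) (z : K) : Prop :=
  forall T : K -> Prop, (forall x, T (phi x)) -> {in s, forall a, T a} ->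
    (forall x y, T x -> T y -> T (x - y)) -> (forall x y, T x -> T y -> T (x * y)) -> T z.

Lemma integral_phi_mul c n z : integralOver phi z -> integralOver phi (phi c ^+ n * z).
Proof. by move=> iz; rewrite -rmorphXn; apply: integral_mul => //; apply: integral_id. Qed.

Lemma integral_phi_mulD c m n z : (m <= n)%N ->
  integralOver phi (phi c ^+ m * z) -> integralOver phi (phi c ^+ n * z).
Proof. by move=> mn; rewrite -(subnK mn) exprD -mulrA; apply: integral_phi_mul. Qed.

Lemma generated_integral u s z :
  {in s, forall a, integralOver phi (phi u * a)} -> generated s z ->
  exists N, integralOver phi (phi u ^+ N * z).
Proof.
move=> us gz; apply: (gz (fun z => exists N, integralOver phi (phi u ^+ N * z))) => [x|a /us ia|x y [m ix] [n iy]|x y [m ix] [n iy]].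
- by exists 0%N; rewrite mul1r; apply: integral_id.
- by exists 1%N.
- exists (m + n)%N; rewrite mulrBr; apply: integral_sub.
    by apply: integral_phi_mulD ix; rewrite leq_addr.
  by apply: integral_phi_mulD iy; rewrite leq_addl.
- by exists (m + n)%N; rewrite exprD mulrACA; apply: integral_mul.
Qed.

(** Let [c] be the coefficient of [f] that maps to the leading coefficient of its image; multiplying
    [f(a) = 0] by the image of [c^(n-1)] gives a monic equation for [c a]. *)
Lemma algebraic_scaled_integral (f : {poly A}) a :
  map_poly phi f != 0 -> root (map_poly phi f) a ->
  exists c, phi c != 0 /\ integralOver phi (phi c * a).
Proof.
set g := map_poly phi f => g0 ga; pose n := (size g).-1; pose c := f`_n.
have phic : phi c = lead_coef g by rewrite lead_coefE coef_map.
exists c; rewrite phic lead_coef_eq0 g0; split=> //.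
have sg : size g = n.+1 by rewrite prednK // size_poly_gt0.
exists ('X^n + \poly_(i < n) (c ^+ (n.-1 - i) * f`_i)).
  by rewrite monicE lead_coefDl ?lead_coefXn // size_polyXn ltnS size_poly.
apply/rootP; rewrite rmorphD /= map_polyXn hornerD hornerXn.
rewrite (@horner_coef_wide _ n); last first.
  by apply: leq_trans (size_poly _ _) _; apply: size_poly.
move/rootP: ga; rewrite horner_coef sg big_ord_recr /= => E.
have [n0|n_gt0] := posnP n.
  by move: E; rewrite n0 big_ord0 add0r mulr1 -n0 -lead_coefE => /eqP; rewrite lead_coef_eq0 (negPf g0).
rewrite -{1}(prednK n_gt0) (prednK n_gt0) -phic.
have -> : \sum_(i < n) (map_poly phi (\poly_(i < n) (c ^+ (n.-1 - i) * f`_i)))`_i * (phi c * a) ^+ i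
   = phi c ^+ n.-1 * \sum_(i < n) g`_i * a ^+ i.
  rewrite mulr_sumr; apply: eq_bigr => i _.
  rewrite coef_map coef_poly ltn_ord /= rmorphM rmorphXn /= coef_map exprMn /=.
  rewrite -{2}(subnK (_ : i <= n.-1)%N); last by rewrite -ltnS prednK.
  by rewrite exprD; ring.
have -> : \sum_(i < n) g`_i * a ^+ i = - (phi c * a ^+ n).
  by apply/eqP; rewrite -addr_eq0; apply/eqP; rewrite -[RHS]E coef_map.
rewrite exprMn -{1}(prednK n_gt0) exprS.
by rewrite mulrN mulrA -exprSr -exprS subrr.
Qed.

(** The inverse of [t] is a root of the reversed equation, which is nonzero because its constant
    coefficient is 1. *)
Lemma integral_inverse t : t != 0 -> integralOver phi t ->
  exists c, phi c != 0 /\ integralOver phi (phi c * t^-1).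
Proof.
move=> t0 [F mF /rootP Ft]; pose n := (size F).-1.
have sF : size F = n.+1 by rewrite prednK // size_poly_gt0 monic_neq0.
apply: (@algebraic_scaled_integral (\poly_(i < n.+1) F`_(n - i))).
  apply/eqP => /(congr1 (fun p : {poly K} => p`_0)); rewrite coef0 coef_map coef_poly /= subn0.
  by move/monicP: mF; rewrite lead_coefE -/n => ->; rewrite rmorph1 => /eqP; rewrite oner_eq0.
apply/rootP; rewrite (@horner_coef_wide _ n.+1); last first.
  by apply: leq_trans (size_poly _ _) _; apply: size_poly.
apply: (mulIf (expf_neq0 n t0)); rewrite mul0r -[RHS]Ft.
rewrite (@horner_coef_wide _ n.+1); last by rewrite -sF size_poly.
rewrite (reindex_inj rev_ord_inj) /= mulr_suml; apply: eq_bigr => i _.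
have il : (i <= n)%N by rewrite -ltnS.
rewrite !coef_map coef_poly subSS ltnS leq_subr (subKn il) -mulrA; congr (_ * _).
have -> : t ^+ n = t ^+ (n - i) * t ^+ i by rewrite -exprD subnK.
by rewrite exprVn mulKf ?expf_neq0.
Qed.

End Integrality.

Definition adjoin (A : comNzRingType) (K : fieldType) (phi : {rmorphism A -> K}) (a : K) :
  {rmorphism {poly A} -> K} := horner_eval a \o map_poly phi.

Lemma adjoinE (A : comNzRingType) (K : fieldType) (phi : {rmorphism A -> K}) (a : K) p :
  adjoin phi a p = (map_poly phi p).[a].
Proof. by []. Qed.

Section Zariski.
Variables (A : comNzRingType) (K : fieldType) (phi : {rmorphism A -> K}).

(** Clearing denominators in a monic equation for the fraction shows that [q] divides a power of [x]
    in the image of [phi]. *)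
Lemma integral_fraction (x q : A) : phi q != 0 -> integralOver phi (phi x / phi q) ->
  exists n G, phi (x ^+ n + q * G) = 0.
Proof.
move=> q0 [F mF /rootP Fz]; pose n := (size F).-1.
have sF : size F = n.+1 by rewrite prednK // size_poly_gt0 monic_neq0.
exists n, (\sum_(i < n) F`_i * x ^+ i * q ^+ (n.-1 - i)).
apply: (mulIf (expf_neq0 n (invr_neq0 q0))); rewrite mul0r -[RHS]Fz.
rewrite (@horner_coef_wide _ n.+1); last by rewrite -sF size_poly.
rewrite big_ord_recr /= addrC coef_map /= -[F`_n]/(lead_coef F) (monicP mF) rmorph1 mul1r.
rewrite rmorphD mulrDl rmorphXn exprMn; congr (_ + _).
rewrite rmorphM raddf_sum -mulrA mulrCA mulr_suml; apply: eq_bigr => i _.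
rewrite coef_map /= !rmorphM !rmorphXn exprMn -!mulrA; congr (_ * (_ * _)).
have En : n = ((n.-1 - i).+1 + i)%N.
  by rewrite addSn subnK ?(ltn_predK (ltn_ord i)) // -ltnS (ltn_predK (ltn_ord i)).
have -> : (phi q)^-1 ^+ n = (phi q)^-1 ^+ (n.-1 - i).+1 * (phi q)^-1 ^+ i by rewrite -exprD -En.
by rewrite mulrA -exprSr mulrA -exprMn divff // expr1n mul1r.
Qed.

Lemma generated_adjoin a p : generated phi [:: a] (adjoin phi a p).
Proof.
move=> T Tphi Ta TB TM; rewrite adjoinE.
have T0 : T 0 by rewrite -(rmorph0 phi); apply: Tphi.
have TD x y : T x -> T y -> T (x + y).
  by move=> Tx Ty; rewrite -[y]opprK -[- y]sub0r; apply: (TB) => //; apply: (TB).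
rewrite horner_coef; elim/big_ind: _ => // j _; apply: (TM); first by rewrite coef_map; apply: Tphi.
elim: (j : nat) => [|m IH]; first by rewrite expr0 -(rmorph1 phi); apply: Tphi.
by rewrite exprS; apply: (TM) => //; apply: Ta; rewrite inE.
Qed.

Lemma integral_trans_adjoin c a w :
  integralOver phi (phi c * a) -> integralOver (adjoin phi a) w ->
  exists N, integralOver phi (phi c ^+ N * w).
Proof.
move=> ca [F mF /rootP Fw]; pose n := (size F).-1.
have sF : size F = n.+1 by rewrite prednK // size_poly_gt0 monic_neq0.
have /dep_choice[M hM] : forall i : 'I_n, exists m, integralOver phi (phi c ^+ m * adjoin phi a F`_i).
  move=> i; apply: (@generated_integral _ _ _ c [:: a]); first by move=> b; rewrite inE => /eqP->.
  exact: generated_adjoin.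
exists (\max_i M i)%N; set N := (\max_i M i)%N.
(* The equation of [c^N w] multiplies the coefficient of index [i] by [c^(N (n - i))]. For [i < n]
   this is at least [c^N], enough to make that coefficient, a polynomial in [a], integral. *)
pose g i := phi c ^+ (N * (n - i)) * adjoin phi a F`_i.
have gn : g n = 1.
  by rewrite /g subnn muln0 mul1r -[F`_n]/(lead_coef F) (monicP mF) rmorph1.
have sg : size (\poly_(i < n.+1) g i) = n.+1 by rewrite size_poly_eq // gn oner_eq0.
apply: (@integral_root_monic _ _ _ _ (\poly_(i < n.+1) g i)).
- by rewrite monicE lead_coefE sg coef_poly ltnSn gn.
- apply/rootP; rewrite horner_poly.
  transitivity (phi c ^+ (N * n) * (map_poly (adjoin phi a) F).[w]); last by rewrite Fw mulr0.
  rewrite (@horner_coef_wide _ n.+1); last by rewrite -sF size_poly.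
  rewrite mulr_sumr; apply: eq_bigr => i _; rewrite coef_map /g exprMn -exprM.
  have -> : (N * n = N * (n - i) + N * i)%N by rewrite -mulnDr subnK // -ltnS.
  by rewrite exprD mulrACA -!mulrA; congr (_ * _); rewrite mulrCA.
apply/integral_poly => i; rewrite coef_poly; case: ifP => [|_]; last exact: integral0.
rewrite ltnS leq_eqVlt => /predU1P[->|iltn]; first by rewrite gn; apply: integral1.
apply: integral_phi_mulD (hM (Ordinal iltn)).
apply: leq_trans (leq_bigmax (Ordinal iltn)) _.
by rewrite leq_pmulr // subn_gt0.
Qed.

End Zariski.

(* If [a] were transcendental over the image of [A], then [1 + p(a) X], with [p(a)] the
   denominator given by the induction hypothesis, would be invertible up to a power of
   [p(a)], although it is coprime to [p]. *)
Lemma zariski (K : fieldType) (s : seq K) (A : comNzRingType) (phi : {rmorphism A -> K}) :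
  (forall z, generated phi s z) ->
  exists u, phi u != 0 /\ {in s, forall a, integralOver phi (phi u * a)}.
Proof.
elim: s A phi => [|a s IH] A phi gen.
  by exists 1; rewrite rmorph1 oner_neq0.
pose psi := adjoin phi a.
have genpsi z : generated psi s z.
  move=> T Tpsi Ts TB TM; apply: (gen z T) => // [x|b].
    by rewrite -[phi x](_ : psi x%:P = _) // /psi adjoinE map_polyC hornerC.
  rewrite inE => /predU1P[->|]; last exact: Ts.
  by rewrite -[a](_ : psi 'X = _) // /psi adjoinE map_polyX hornerX.
have [p [p0 hp]] := IH _ psi genpsi.
have [f [f0 fa]] : exists f, map_poly phi f != 0 /\ root (map_poly phi f) a.
  apply: NNPP => nf.
  have trans f : psi f = 0 -> map_poly phi f = 0.
    by move=> fa; apply/eqP/negPn/negP => f0; apply: nf; exists f; split=> //; apply/rootP.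
  pose q := 1 + 'X * p.
  have pbar0 : map_poly phi p != 0.
    by apply: contraNneq p0 => E; rewrite /psi adjoinE E horner0.
  have qbar : map_poly phi q = 1 + 'X * map_poly phi p.
    by rewrite rmorphD rmorphM /= map_polyX rmorph1.
  have sq : (1 < size (map_poly phi q))%N.
    by rewrite qbar addrC mulrC size_polyDl size_mulX // ?size_poly1 ltnS size_poly_gt0.
  have q0 : psi q != 0.
    by apply: contraTneq sq => /trans->; rewrite size_poly0.
  have [N] := generated_integral hp (genpsi (psi q)^-1).
  rewrite -rmorphXn => /(integral_fraction q0)[n [G /trans E]].
  have : map_poly phi q %| map_poly phi p ^+ (N * n).
    move/eqP: E; rewrite rmorphD rmorphM !rmorphXn /= -exprM addr_eq0 => /eqP->.
    by rewrite -mulrN dvdp_mulr.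
  have cop : coprimep (map_poly phi q) (map_poly phi p ^+ (N * n)).
    apply: coprimep_expr; rewrite qbar addrC.
    by rewrite coprimep_sym coprimep_addl_mul coprimep1.
  by move=> dv; have := coprimep_dvdl dv cop; rewrite coprimepp => /eqP E1; rewrite E1 in sq.
have [c [c0 ca]] := algebraic_scaled_integral f0 fa.
have [M hM] : exists M, integralOver phi (phi c ^+ M * psi p).
  apply: (@generated_integral _ _ _ c [:: a]); first by move=> b; rewrite inE => /eqP->.
  exact: generated_adjoin.
have [|c' [c'0 hc']] := integral_inverse _ hM; first by rewrite mulf_neq0 ?expf_neq0.
have {hc'} ip : integralOver phi (phi c' * (psi p)^-1).
  have := integral_phi_mul c M hc'.
  by rewrite invfM mulrCA mulVKf ?expf_neq0.
have [N hN] : exists N, {in s, forall b, integralOver phi (phi c ^+ N * (psi p * b))}.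
  elim: s hp {IH gen genpsi} => [|b s IH] hp; first by exists 0%N.
  have [|N hN] := IH; first by move=> d ds; apply: hp; rewrite inE ds orbT.
  have [N' hN'] := integral_trans_adjoin ca (hp b (mem_head _ _)).
  exists (N + N')%N => d; rewrite inE => /predU1P[->|/hN].
    by apply: integral_phi_mulD hN'; rewrite leq_addl.
  by apply: integral_phi_mulD; rewrite leq_addr.
(* [c^N] clears the denominator of [psi p * b] and [c'] that of the inverse of [psi p], so their
   product works for [b] in [s]; the additional factor [c] is for [a] itself. *)
exists (c' * c ^+ N.+1); rewrite rmorphM rmorphXn mulf_neq0 ?expf_neq0 //.
split=> // b; rewrite inE => /predU1P[->|bs].
  rewrite exprSr -!mulrA; apply: integral_mul; first exact: integral_id.
  exact: integral_phi_mul.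
have := integral_mul ip (integral_phi_mul c 1 (hN b bs)).
congr (integralOver _ _); rewrite expr1 exprS -!mulrA; congr (_ * _).
by rewrite mulrCA; congr (_ * _); rewrite mulrCA mulKf.
Qed.

Section QuotientField.
Variables (A : comNzRingType) (P : A -> Prop).
Hypothesis maxP : maximal_ideal P.

(** The boolean form of [P], required to form the quotient ring. *)
Definition ideal_mem (x : A) : bool := if excluded_middle_informative (P x) then true else false.

Lemma ideal_memP x : reflect (P x) (ideal_mem x).
Proof. by rewrite /ideal_mem; case: excluded_middle_informative => H; constructor. Qed.

Fact ideal_mem_closed : idealr_closed ideal_mem.
Proof.
have [idP P1 _] := maxP; split.
- by rewrite unfold_in; apply/ideal_memP; case: idP.
- by rewrite unfold_in; apply/ideal_memP.
- move=> a u v; rewrite !unfold_in => /ideal_memP Pu /ideal_memP Pv.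
  by apply/ideal_memP; apply: (idealD idP) => //; apply: (idealM idP).
Qed.

HB.instance Definition _ := isIdealr.Build A ideal_mem ideal_mem_closed.

Local Notation Q := {ideal_quot (ideal_mem : idealr A)}.
Local Open Scope quotient_scope.

Lemma pi_eq0 x : (\pi_Q x == 0) = ideal_mem x.
Proof. by rewrite -[0](rmorph0 \pi_Q) -Quotient.idealrBE subr0. Qed.

Lemma quotient_inverse_exists (z : Q) : exists w : Q, if z == 0 then w = 0 else w * z = 1.
Proof.
have [idP P1 max] := maxP.
have [z0|] := eqVneq z 0; first by exists 0.
rewrite -[z]reprK pi_eq0 => /ideal_memP nPz.
have [x [y [Px E]]] : add_elt P (repr z) 1.
  apply: NNPP => n1; apply: nPz; apply: (max (add_elt P (repr z))) => //.
  - exact: add_elt_ideal.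
  - exact: add_elt_sub.
  - exact: add_elt_mem.
exists (\pi y); have /(congr1 (\pi_Q : {rmorphism A -> Q})) := E.
have /ideal_memP := Px; rewrite -pi_eq0 rmorph1 rmorphD rmorphM /= => /eqP->.
by rewrite add0r.
Qed.

Definition quotient_inv (z : Q) : Q :=
  proj1_sig (constructive_indefinite_description _ (quotient_inverse_exists z)).

Fact quotient_mulVf (z : Q) : z != 0 -> quotient_inv z * z = 1.
Proof.
rewrite /quotient_inv => z0; case: constructive_indefinite_description => w /=.
by rewrite (negPf z0).
Qed.

Fact quotient_inv0 : quotient_inv 0 = 0.
Proof. by rewrite /quotient_inv; case: constructive_indefinite_description => w /=; rewrite eqxx. Qed.

Definition residue_type : Type := Q.
HB.instance Definition _ := GRing.ComNzRing.on residue_type.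
HB.instance Definition _ := GRing.ComNzRing_isField.Build residue_type quotient_mulVf quotient_inv0.

Lemma residue_field : exists (K : fieldType) (f : {rmorphism A -> K}),
  (forall x, P x <-> f x = 0) /\ forall z, exists x, f x = z.
Proof.
exists (residue_type : fieldType), (\pi_Q : {rmorphism A -> residue_type}).
split=> [x|z]; last by exists (repr z); apply: reprK.
split=> [/ideal_memP|/eqP]; first by rewrite -pi_eq0 => /eqP.
by rewrite pi_eq0 => /ideal_memP.
Qed.

End QuotientField.

(** The residue field is generated over [k] by the images of the variables, so [zariski] makes it
    algebraic over [k]. *)
Theorem nullstellensatz (k : fieldType) (r : nat) (P : {mpoly k[r]} -> Prop) f :
  maximal_ideal P -> exists q : {poly k}, q \is monic /\ P (map_poly (@mpolyC r k) q).[f].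
Proof.
move=> /residue_field[K [g [gP gK]]].
pose phi : {rmorphism k -> K} := g \o @mpolyC r k.
pose s := [seq g 'X_i | i <- enum 'I_r].
have gen z : generated phi s z.
  move=> T Tphi Ts TB TM; have [h <-] := gK z.
  have T0 : T 0 by rewrite -(rmorph0 phi); apply: Tphi.
  have T1 : T 1 by rewrite -(rmorph1 phi); apply: Tphi.
  have TD x y : T x -> T y -> T (x + y).
    by move=> Tx Ty; rewrite -[y]opprK -[- y]sub0r; apply: (TB) => //; apply: (TB).
  rewrite [h]mpolyE rmorph_sum; elim/big_ind: _ => // m _.
  rewrite -mul_mpolyC rmorphM; apply: (TM); first exact: (Tphi).
  rewrite mpolyXE_id rmorph_prod; elim/big_ind: _ => // i _; rewrite rmorphXn.
  have TX : T (g 'X_i) by apply: Ts; apply: map_f; rewrite mem_enum.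
  by elim: (m i) => [|n IHn]; rewrite ?expr0 // exprS; apply: TM.
have [u [u0 us]] := zariski gen.
have [N [q mq /rootP qf]] := generated_integral us (gen (g f)).
(* The denominator [u] is a nonzero constant of [k], so its inverse is again integral and the
   scaling can be undone. *)
have [p mp /rootP pf] : integralOver phi (g f).
  have := integral_mul (integral_id phi (u^-1 ^+ N)) (ex_intro2 _ _ q mq (introT rootP qf)).
  by rewrite rmorphXn fmorphV exprVn mulKf // expf_neq0.
exists p; split=> //; apply/gP; rewrite -pf map_poly_comp /= horner_map.
by [].
Qed.

(** * Regular sequences of polynomials in the elementary symmetric polynomials *)

Definition ext_ideal (A B : comNzRingType) (phi : A -> B) (J : A -> Prop) (z : B) : Prop :=
  forall K, is_ideal K -> (forall x, J x -> K (phi x)) -> K z.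

Lemma ext_ideal_ideal (A B : comNzRingType) (phi : A -> B) J : is_ideal (ext_ideal phi J).
Proof.
split=> [K hK _|x y Ex Ey K hK H|c x Ex K hK H].
- exact: ideal0.
- by apply: (idealD hK); [apply: Ex | apply: Ey].
- by apply: (idealM hK); apply: Ex.
Qed.

Lemma ext_ideal_mem (A B : comNzRingType) (phi : A -> B) J x :
  J x -> ext_ideal phi J (phi x).
Proof. by move=> Jx K hK; apply. Qed.

(* A weak form of flatness. *)
Definition preserves_regular (A B : comNzRingType) (phi : A -> B) : Prop :=
  forall J y, is_ideal J -> regular_mod J y -> regular_mod (ext_ideal phi J) (phi y).

Lemma preimage_ideal (A B : comNzRingType) (phi : {rmorphism A -> B}) K :
  is_ideal K -> is_ideal (fun x => K (phi x)).
Proof.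
move=> hK; split=> [|x y Kx Ky|c x Kx]; rewrite ?rmorph0 ?rmorphD ?rmorphM.
- exact: ideal0.
- exact: idealD.
- exact: idealM.
Qed.

Lemma ext_ideal_comp (A B C : comNzRingType) (phi : A -> B) (psi : {rmorphism B -> C}) J :
  ideal_eq (ext_ideal (psi \o phi) J) (ext_ideal psi (ext_ideal phi J)).
Proof.
move=> z; split=> E K hK H; apply: E => // x.
  by move=> Jx; apply: H; apply: ext_ideal_mem.
by move=> E; apply: (E (fun y => K (psi y))) => //; apply: preimage_ideal.
Qed.

Lemma preserves_regular_comp (A B C : comNzRingType) (phi : A -> B)
    (psi : {rmorphism B -> C}) :
  preserves_regular phi -> preserves_regular psi -> preserves_regular (psi \o phi).
Proof.
move=> H1 H2 J y hJ ry.
apply: (@regular_mod_eq _ (ext_ideal psi (ext_ideal phi J))).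
  by move=> z; have [] := @ext_ideal_comp _ _ _ phi psi J z; split.
by apply: H2; [apply: ext_ideal_ideal | apply: H1].
Qed.

Lemma preserves_regular_eq (A B : comNzRingType) (phi psi : A -> B) :
  phi =1 psi -> preserves_regular phi -> preserves_regular psi.
Proof.
move=> E H J y hJ ry; rewrite -E; apply: regular_mod_eq (H J y hJ ry) => z.
by split=> Hz K hK HK; apply: Hz => // x /HK; rewrite E.
Qed.

Lemma preserves_regular_iso (A B : comNzRingType) (phi : {rmorphism A -> B})
    (psi : {rmorphism B -> A}) :
  cancel phi psi -> cancel psi phi -> preserves_regular phi.
Proof.
move=> K1 K2 J y hJ ry z.
have E w : ext_ideal phi J w -> J (psi w).
  by move=> Ew; apply: (Ew (fun x => J (psi x))) => [|x]; [apply: preimage_ideal | rewrite K1].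
move=> /E; rewrite rmorphM K1 => /ry Jz.
by rewrite -[z]K2; apply: ext_ideal_mem.
Qed.

Definition poly_ideal (A : comNzRingType) (J : A -> Prop) (f : {poly A}) : Prop :=
  forall i, J f`_i.

Lemma poly_ideal_ideal (A : comNzRingType) (J : A -> Prop) : is_ideal J -> is_ideal (poly_ideal J).
Proof.
move=> hJ; split=> [i|f g Jf Jg i|c f Jf i]; rewrite ?coef0 ?coefD ?coefM.
- exact: ideal0.
- exact: idealD.
- by apply: ideal_sum => // j _; apply: idealM.
Qed.

Lemma poly_ideal_rmodp (A : comNzRingType) (J : A -> Prop) (p f : {poly A}) :
  is_ideal J -> p \is monic -> poly_ideal J f -> poly_ideal J (Pdiv.Ring.rmodp f p).
Proof.
move=> hJ mp Jf; have hJp := poly_ideal_ideal hJ.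
have modD := Pdiv.RingMonic.rmodpD mp; have modZ := Pdiv.RingMonic.rmodpZ mp.
rewrite -[f]coefK poly_def; elim: (size f) => [|n IH].
  by rewrite big_ord0 Pdiv.Ring.rmod0p; apply: ideal0.
rewrite big_ord_recr /= modD; apply: (idealD hJp) => // i.
by rewrite modZ coefZ; apply: ideal_mulr.
Qed.

(** The hypotheses make [B] the quotient of [A[X]] by the monic [p], hence free over [A] on the
    powers of [X] below the degree of [p]; regularity is then read off coefficient by coefficient.
    The section [lift] can be a ring morphism because [B] will itself be a polynomial ring. *)
Lemma preserves_regular_monic (A B : comNzRingType) (phi : A -> B)
    (ev : {rmorphism {poly A} -> B}) (lift : {rmorphism B -> {poly A}}) (p : {poly A}) :
  p \is monic -> (forall c, ev c%:P = phi c) -> ev p = 0 -> cancel lift ev ->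
  (forall f, exists q, f = lift (ev f) + q * p) -> preserves_regular phi.
Proof.
move=> mp evC evp evK liftK J y hJ ry b Eb.
pose f := Pdiv.Ring.rmodp (lift b) p.
have sf : (size f < size p)%N by rewrite Pdiv.Ring.ltn_rmodpN0 // monic_neq0.
have evf : ev f = b.
  rewrite -[RHS]evK [in RHS](Pdiv.RingMonic.rdivp_eq mp (lift b)).
  by rewrite rmorphD rmorphM evp mulr0 add0r.
have [h [Jh evh]] : exists h, poly_ideal J h /\ ev h = phi y * b.
  apply: (Eb (fun z => exists h, poly_ideal J h /\ ev h = z)) => [|x Jx].
    have [p0 pD pM] := poly_ideal_ideal hJ.
    split=> [|_ _ [h [Jh <-]] [g [Jg <-]]|c _ [h [Jh <-]]].
    - by exists 0; rewrite rmorph0.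
    - by exists (h + g); rewrite rmorphD; split=> //; apply: pD.
    - by exists (lift c * h); rewrite rmorphM evK; split=> //; apply: pM.
  exists x%:P; split=> // i; rewrite coefC; case: eqP => _ //; exact: ideal0.
have [q Eq] := liftK (y%:P * f - h).
(* [y f] is already reduced and congruent to [h] modulo [p], so it is the remainder of [h], and
   remainders by a monic polynomial keep coefficients in [J]. *)
have E : y%:P * f = Pdiv.Ring.rmodp h p.
  have -> : h = (- q) * p + y%:P * f.
    move: Eq; rewrite rmorphB rmorphM evC evf evh subrr rmorph0 add0r => Eq.
    by rewrite mulNr -Eq opprB subrK.
  rewrite Pdiv.RingMonic.rmodp_addl_mul_small //.
  by apply: leq_ltn_trans sf; rewrite mul_polyC size_scale_leq.
have Jf : poly_ideal J f.
  by move=> i; apply: ry; rewrite -coefCM E; apply: poly_ideal_rmodp.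
have hE := ext_ideal_ideal phi J.
rewrite -evf -[f]coefK poly_def rmorph_sum; apply: (ideal_sum hE) => i _.
rewrite -mul_polyC rmorphM evC; refine (ideal_mulr hE _ _).
exact: ext_ideal_mem.
Qed.

(** The elements where [f] and [g] agree modulo [I] form a subring. Both the zero ideal and the
    multiples of [tower_poly] will be used as [I]. *)
Lemma mpoly_morph_congr (A B : comNzRingType) n (f g : {rmorphism {mpoly A[n]} -> B}) I :
  is_ideal I -> (forall c : A, I (f c%:MP - g c%:MP)) -> (forall i, I (f 'X_i - g 'X_i)) ->
  forall x, I (f x - g x).
Proof.
move=> hI Hc HX.
have HM x y : I (f x - g x) -> I (f y - g y) -> I (f (x * y) - g (x * y)).
  move=> Ix Iy; rewrite !rmorphM.
  have -> : f x * f y - g x * g y = f y * (f x - g x) + g x * (f y - g y) by ring.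
  by apply: (idealD hI); apply: (idealM hI).
have H1 : I (f 1 - g 1) by rewrite !rmorph1 subrr; apply: ideal0.
move=> x; rewrite [x]mpolyE !rmorph_sum -sumrB; apply: ideal_sum => // m _.
rewrite -mul_mpolyC; apply: (HM); first exact: Hc.
rewrite mpolyXE_id; apply: (big_ind (fun x => I (f x - g x))); [exact: H1 | exact: HM | move=> i _].
by elim: (m i) => [|k IH]; rewrite ?expr0 // exprS; apply: (HM).
Qed.

Lemma poly_morph_congr (A B : comNzRingType) (f g : {rmorphism {poly A} -> B}) I :
  is_ideal I -> (forall c : A, I (f c%:P - g c%:P)) -> I (f 'X - g 'X) ->
  forall x, I (f x - g x).
Proof.
move=> hI Hc HX.
have HM x y : I (f x - g x) -> I (f y - g y) -> I (f (x * y) - g (x * y)).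
  move=> Ix Iy; rewrite !rmorphM.
  have -> : f x * f y - g x * g y = f y * (f x - g x) + g x * (f y - g y) by ring.
  by apply: (idealD hI); apply: (idealM hI).
have H1 : I (f 1 - g 1) by rewrite !rmorph1 subrr; apply: ideal0.
move=> x; rewrite -[x]coefK poly_def !rmorph_sum -sumrB; apply: ideal_sum => // i _.
rewrite -mul_polyC; apply: (HM); first exact: Hc.
by elim: (i : nat) => [|k IH]; rewrite ?expr0 // exprS; apply: (HM).
Qed.

Lemma mpoly_morph_eq (A B : comNzRingType) n (f g : {rmorphism {mpoly A[n]} -> B}) :
  (forall c : A, f c%:MP = g c%:MP) -> (forall i, f 'X_i = g 'X_i) -> f =1 g.
Proof.
move=> Hc HX x; apply/eqP; rewrite -subr_eq0; apply/eqP.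
apply: (mpoly_morph_congr (@zero_idealP B)) => [c|i]; rewrite /zero_ideal.
  by rewrite Hc subrr.
by rewrite HX subrr.
Qed.

Lemma poly_morph_eq (A B : comNzRingType) (f g : {rmorphism {poly A} -> B}) :
  (forall c : A, f c%:P = g c%:P) -> f 'X = g 'X -> f =1 g.
Proof.
move=> Hc HX x; apply/eqP; rewrite -subr_eq0; apply/eqP.
apply: (poly_morph_congr (@zero_idealP B)) => [c|]; rewrite /zero_ideal.
  by rewrite Hc subrr.
by rewrite HX subrr.
Qed.

(** * Splitting off one variable from the elementary symmetric polynomials *)

Section Tower.
Variables (A : comNzRingType) (r : nat).
Local Notation E := {mpoly A[r.+1]}.
Local Notation C := {mpoly {poly A}[r]}.

(** An indeterminate standing for the elementary symmetric polynomial of degree [j] in the first [r]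
    variables, with its values 1 at [j = 0] and 0 for [j > r]. *)
Definition tower_var (j : nat) : C :=
  if j is i.+1 then (if insub i is Some k then 'X_k else 0) else 1.

Local Notation z := ('X%:MP : C).

(** The recursion [e_j(x_1..x_{r+1}) = e_j(x_1..x_r) + x_{r+1} e_{j-1}(x_1..x_r)], with
    indeterminates for the symmetric polynomials and [z] for the last variable. *)
Definition tower_up : {rmorphism E -> C} :=
  mmap (@mpolyC r _ \o polyC) (fun j : 'I_r.+1 => tower_var j.+1 + z * tower_var j).

Definition tower_eval : {rmorphism {poly E} -> C} := horner_eval z \o map_poly tower_up.

(** The same recursion solved for the symmetric polynomials in [r] variables: the sum of
    [(-X)^i e_{j-i}]. *)
Fixpoint tower_root (j : nat) : {poly E} :=
  if j is i.+1 then ('X_(inord i))%:P - 'X * tower_root i else 1.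

Definition tower_lift : {rmorphism C -> {poly E}} :=
  mmap (map_poly (@mpolyC r.+1 A)) (fun j : 'I_r => tower_root j.+1).

Lemma tower_evalC e : tower_eval e%:P = tower_up e.
Proof. by rewrite /tower_eval /= map_polyC horner_evalE hornerC. Qed.

Lemma tower_evalX : tower_eval 'X = z.
Proof. by rewrite /tower_eval /= map_polyX horner_evalE hornerX. Qed.

Lemma tower_upC c : tower_up c%:MP = c%:P%:MP.
Proof. by rewrite -[LHS]/(mmap _ _ _) mmapC. Qed.

Lemma tower_upU i : tower_up 'X_i = tower_var i.+1 + z * tower_var i.
Proof. by rewrite -[LHS]/(mmap _ _ _) mmapX mmap1U. Qed.

Lemma tower_upX j : (j < r.+1)%N -> tower_up 'X_(inord j) = tower_var j.+1 + z * tower_var j.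
Proof. by move=> jr; rewrite /tower_up /= mmapX mmap1U inordK. Qed.

Lemma tower_eval_root j : (j <= r.+1)%N -> tower_eval (tower_root j) = tower_var j.
Proof.
elim: j => [|j IH] jr; first by rewrite rmorph1.
by rewrite rmorphB rmorphM tower_evalC tower_evalX tower_upX // IH ?addrK // ltnW.
Qed.

Lemma tower_lift_var j : (j <= r)%N -> tower_lift (tower_var j) = tower_root j.
Proof.
case: j => [|j] jr; first by rewrite rmorph1.
by rewrite /tower_var insubT /tower_lift /= mmapX mmap1U.
Qed.

Lemma tower_liftC c : tower_lift c%:MP = map_poly (@mpolyC r.+1 A) c.
Proof. by rewrite /tower_lift /= mmapC. Qed.

Lemma tower_liftK : cancel tower_lift tower_eval.
Proof.
apply: (@mpoly_morph_eq _ _ _ (tower_eval \o tower_lift) idfun) => [c|i].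
  transitivity (tower_eval (map_poly (@mpolyC r.+1 A) c)).
    by congr (tower_eval _); exact: tower_liftC.
  apply: (@poly_morph_eq _ _ (tower_eval \o map_poly (@mpolyC r.+1 A)) (@mpolyC r _)) => [a|].
    transitivity (tower_eval a%:MP%:P); first by congr (tower_eval _); exact: map_polyC.
    by rewrite tower_evalC tower_upC.
  transitivity (tower_eval 'X); first by congr (tower_eval _); exact: map_polyX.
  by rewrite tower_evalX.
transitivity (tower_eval (tower_lift (tower_var i.+1))).
  by rewrite /tower_var valK.
rewrite tower_lift_var // tower_eval_root ?(ltnW (ltn_ord i)) //; first by rewrite /tower_var valK.
exact: ltnW (ltn_ord i).
Qed.

(** The generic polynomial [X^{r+1} - e_1 X^r + ...], whose roots are the [r + 1] variables: the
    symmetric polynomial of degree [r + 1] in [r] variables must vanish. *)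
Definition tower_poly : {poly E} := (-1) ^+ r.+1 * tower_root r.+1.

Lemma tower_root_monic j :
  (-1) ^+ j * tower_root j \is monic /\ size ((-1) ^+ j * tower_root j) = j.+1.
Proof.
elim: j => [|j [mj sj]]; first by rewrite mul1r monic1 size_poly1.
have -> : (-1) ^+ j.+1 * tower_root j.+1 =
    'X * ((-1) ^+ j * tower_root j) + ((-1) ^+ j.+1 * 'X_(inord j))%:P.
  by rewrite /= rmorphM rmorphXn rmorphN1 exprS; ring.
have sX : size ('X * ((-1) ^+ j * tower_root j)) = j.+2.
  by rewrite mulrC size_mulX ?sj // monic_neq0.
have sc (c : E) : (size c%:P < j.+2)%N by rewrite ltnS (leq_trans (size_polyC_leq1 _)).
split; last by rewrite size_polyDl sX.
rewrite monicE lead_coefDl; last by rewrite sX.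
by rewrite -monicE; apply: rpredM => //; apply: monicX.
Qed.

(** [C] is [E[X]] modulo [tower_poly]: evaluating and lifting back fixes [X], the constants of [A]
    and every variable of [E] but the last, which changes by [tower_poly] up to sign. *)
Lemma tower_up_regular : preserves_regular tower_up.
Proof.
apply: (@preserves_regular_monic _ _ _ tower_eval tower_lift tower_poly).
- by have [] := tower_root_monic r.+1.
- exact: tower_evalC.
- by rewrite rmorphM tower_eval_root // /tower_var insubN ?ltnn // mulr0.
- exact: tower_liftK.
move=> f; pose I x := exists q, x = q * tower_poly.
have hI : is_ideal I.
  split=> [|_ _ [q ->] [q' ->]|c _ [q ->]]; first by exists 0; rewrite mul0r.
    by exists (q + q'); rewrite mulrDl.
  by exists (c * q); rewrite mulrA.
suff [q Eq] : I (f - tower_lift (tower_eval f)) by exists q; rewrite -Eq addrC subrK.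
pose F : {rmorphism {poly E} -> {poly E}} := tower_lift \o tower_eval.
pose G : {rmorphism {poly E} -> {poly E}} := idfun.
rewrite -[I _]/(I (G f - F f)); move: f; apply: poly_morph_congr => // [e|]; last first.
  rewrite -[F _]/(tower_lift (tower_eval 'X)) tower_evalX tower_liftC map_polyX.
  by rewrite -[G _]/'X subrr; apply: ideal0.
pose F' : {rmorphism E -> {poly E}} := tower_lift \o tower_up.
pose G' : {rmorphism E -> {poly E}} := polyC.
have -> : F e%:P = F' e by rewrite -[LHS]/(tower_lift (tower_eval e%:P)) tower_evalC.
rewrite -[G _]/(G' e); move: e; apply: mpoly_morph_congr => // [a|].
  rewrite -[F' _]/(tower_lift (tower_up a%:MP)) tower_upC tower_liftC map_polyC.
  by rewrite -[G' _]/(a%:MP%:P) subrr; apply: ideal0.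
move=> i.
have -> : F' 'X_i = tower_lift (tower_var i.+1) + 'X * tower_root i.
  rewrite -[LHS]/(tower_lift (tower_up 'X_i)) tower_upU rmorphD rmorphM.
  by rewrite tower_liftC map_polyX [tower_lift (tower_var i)]tower_lift_var // -ltnS.
have -> : G' 'X_i = tower_root i.+1 + 'X * tower_root i.
  by rewrite -[LHS]/(('X_i)%:P) /= inord_val subrK.
rewrite opprD addrACA subrr addr0.
have [ir|ri] := ltnP i r; first by rewrite tower_lift_var // subrr; apply: ideal0.
have -> : tower_var i.+1 = 0 by rewrite /tower_var insubN // -leqNgt.
have -> : (i = r :> nat) by apply/eqP; rewrite eqn_leq ri -ltnS ltn_ord.
rewrite rmorph0 subr0; exists ((-1) ^+ r.+1).
by rewrite /tower_poly mulrA -exprMn mulrNN mulr1 expr1n mul1r.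
Qed.

End Tower.

Definition sym_map (A : comNzRingType) (r : nat) : {rmorphism {mpoly A[r]} -> {mpoly A[r]}} :=
  mmap (@mpolyC r A) (fun i : 'I_r => mesym r A i.+1).

Lemma sym_mapX (A : comNzRingType) r (i : 'I_r) : sym_map A r 'X_i = mesym r A i.+1.
Proof. by rewrite -[LHS]/(mmap _ _ _) mmapX mmap1U. Qed.

Lemma sym_mapC (A : comNzRingType) r c : sym_map A r c%:MP = c%:MP.
Proof. by rewrite -[LHS]/(mmap _ _ _) mmapC. Qed.

Section TowerDown.
Variables (A : comNzRingType) (r : nat).
Local Notation E := {mpoly A[r.+1]}.
Local Notation C := {mpoly {poly A}[r]}.

Definition poly_last : {rmorphism {poly A} -> E} :=
  horner_eval ('X_ord_max : E) \o map_poly (@mpolyC r.+1 A).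

Definition tower_down : {rmorphism C -> E} :=
  mmap poly_last (fun i : 'I_r => 'X_(widen_ord (leqnSn r) i)).

Definition tower_down_inv : {rmorphism E -> C} :=
  mmap (@mpolyC r _ \o polyC) (fun i => oapp (fun j => 'X_j) 'X%:MP (unlift ord_max i)).

Lemma poly_lastC c : poly_last c%:P = c%:MP.
Proof. by rewrite -[LHS]/((map_poly _ _).[_]) map_polyC hornerC. Qed.

Lemma poly_lastX : poly_last 'X = 'X_ord_max.
Proof. by rewrite -[LHS]/((map_poly _ _).[_]) map_polyX hornerX. Qed.

Lemma tower_downC c : tower_down c%:MP = poly_last c.
Proof. by rewrite -[LHS]/(mmap _ _ _) mmapC. Qed.

Lemma tower_downX i : tower_down 'X_i = 'X_(widen_ord (leqnSn r) i).
Proof. by rewrite -[LHS]/(mmap _ _ _) mmapX mmap1U. Qed.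

Lemma tower_down_invC c : tower_down_inv c%:MP = c%:P%:MP.
Proof. by rewrite -[LHS]/(mmap _ _ _) mmapC. Qed.

Lemma lift_widen (i : 'I_r) : widen_ord (leqnSn r) i = lift ord_max i.
Proof. by apply/val_inj; rewrite /= /bump leqNgt ltn_ord. Qed.

Lemma tower_down_invX i : tower_down_inv 'X_(widen_ord (leqnSn r) i) = 'X_i.
Proof. by rewrite -[LHS]/(mmap _ _ _) mmapX mmap1U lift_widen liftK. Qed.

Lemma tower_down_invXmax : tower_down_inv 'X_ord_max = 'X%:MP.
Proof. by rewrite -[LHS]/(mmap _ _ _) mmapX mmap1U unlift_none. Qed.

Lemma tower_downK : cancel tower_down tower_down_inv.
Proof.
apply: (@mpoly_morph_eq _ _ _ (tower_down_inv \o tower_down) idfun) => [c|i].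
  transitivity (tower_down_inv (poly_last c)).
    by congr (tower_down_inv _); exact: tower_downC.
  apply: (@poly_morph_eq _ _ (tower_down_inv \o poly_last) (@mpolyC r _)) => [a|].
    transitivity (tower_down_inv a%:MP); last by rewrite tower_down_invC.
    by congr (tower_down_inv _); exact: poly_lastC.
  transitivity (tower_down_inv 'X_ord_max); last by rewrite tower_down_invXmax.
  by congr (tower_down_inv _); exact: poly_lastX.
transitivity (tower_down_inv 'X_(widen_ord (leqnSn r) i)); last by rewrite tower_down_invX.
by congr (tower_down_inv _); exact: tower_downX.
Qed.

Lemma tower_down_invK : cancel tower_down_inv tower_down.
Proof.
apply: (@mpoly_morph_eq _ _ _ (tower_down \o tower_down_inv) idfun) => [c|i].
  transitivity (tower_down c%:P%:MP); last by rewrite tower_downC poly_lastC.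
  by congr (tower_down _); exact: tower_down_invC.
transitivity (tower_down (tower_down_inv 'X_i)) => //.
case: (unliftP ord_max i) => [j ->|->].
  by rewrite -lift_widen tower_down_invX tower_downX.
by rewrite tower_down_invXmax tower_downC poly_lastX.
Qed.

Lemma tower_down_mesym k : tower_down (mesym r _ k) = mwiden (mesym r A k).
Proof.
rewrite /mesym !rmorph_sum; apply: eq_bigr => h _; rewrite !rmorph_prod; apply: eq_bigr => i _.
by rewrite tower_downX /= mwidenX mnmwiden1.
Qed.

Lemma sym_map_tower_var j : (j <= r.+1)%N ->
  sym_map {poly A} r (tower_var A r j) = mesym r {poly A} j.
Proof.
case: j => [|j] jr; first by rewrite rmorph1 mesym0E.
rewrite /tower_var; case: insubP => [i _ <-|]; first exact: sym_mapX.
by rewrite -leqNgt => rj; rewrite rmorph0 mesym_geqnE.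
Qed.

Lemma sym_map_tower : tower_down \o (sym_map {poly A} r \o @tower_up A r) =1 sym_map A r.+1.
Proof.
apply: (@mpoly_morph_eq _ _ _ (tower_down \o (sym_map {poly A} r \o @tower_up A r))) => [c|i].
  transitivity (tower_down (sym_map {poly A} r c%:P%:MP)).
    by congr (tower_down (sym_map _ _ _)); exact: tower_upC.
  by rewrite !sym_mapC tower_downC poly_lastC.
transitivity (tower_down (sym_map {poly A} r (tower_var A r i.+1 + 'X%:MP * tower_var A r i))).
  by congr (tower_down (sym_map _ _ _)); exact: tower_upU.
rewrite 2!rmorphD 2!rmorphM.
rewrite (sym_map_tower_var (ltn_ord i)) (sym_map_tower_var (ltnW (ltn_ord i))).
rewrite sym_mapC tower_downC poly_lastX !tower_down_mesym sym_mapX mesymSS.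
by rewrite [X in _ + X = _]mulrC.
Qed.

End TowerDown.

(** The induction on [r] runs over all rings [A] at once, since [sym_map_tower] factors the map for
    [r.+1] through the one for [r] over [{poly A}]. *)
Lemma sym_map_regular (A : comNzRingType) r : preserves_regular (sym_map A r).
Proof.
elim: r A => [|r IH] A.
  apply: (@preserves_regular_iso _ _ (sym_map A 0) (sym_map A 0)) => p;
    by rewrite [p]nvar0_mpolyC !sym_mapC.
apply: preserves_regular_eq (@sym_map_tower A r) _.
apply: preserves_regular_comp.
  by apply: preserves_regular_comp; [apply: tower_up_regular | apply: IH].
exact: preserves_regular_iso (@tower_downK A r) (@tower_down_invK A r).
Qed.

Lemma poly_ideal_monic (A : comNzRingType) (J : A -> Prop) (p : {poly A}) :
  is_ideal J -> p \is monic -> regular_mod (poly_ideal J) p.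
Proof.
move=> hJ mp; have hJp := poly_ideal_ideal hJ.
suff H n : forall g : {poly A}, (size g <= n)%N -> poly_ideal J (p * g) -> poly_ideal J g.
  by move=> g; apply: H.
elim: n => [|n IH] g; first by rewrite leqn0 size_poly_eq0 => /eqP-> _; apply: ideal0.
move=> sg Jpg; have [g0|g0] := eqVneq g 0; first by rewrite g0; apply: ideal0.
have Jl : J (lead_coef g).
  rewrite -(lead_coef_monicM _ mp) lead_coefE; exact: Jpg.
have Jm : poly_ideal J (lead_coef g *: 'X^((size g).-1)).
  by move=> i; rewrite coefZ; apply: ideal_mulr.
rewrite -[g](subrK (lead_coef g *: 'X^((size g).-1))); apply: (idealD hJp) => //.
apply: IH; last by rewrite mulrBr; apply: (idealB hJp) => //; apply: (idealM hJp).
have gt0 : (0 < size g)%N by rewrite size_poly_gt0.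
rewrite -ltnS (leq_trans _ sg) // -[X in (_ < X)%N](prednK gt0) ltnS.
apply/leq_sizeP => j; rewrite leq_eqVlt coefB coefZ coefXn => /predU1P[<-|].
  by rewrite eqxx mulr1 lead_coefE subrr.
move=> lj; rewrite (gtn_eqF lj) mulr0 subr0; apply/leq_sizeP: j lj.
by rewrite -(prednK gt0).
Qed.

Section UnivariateSequences.
Variables (A : comNzRingType) (r : nat) (q : 'I_r -> {poly A}).
Hypothesis mq : forall i, q i \is monic.
Local Notation E := {mpoly A[r]}.

Definition poly_at (p : {poly A}) (x : E) : E := (map_poly (@mpolyC r A) p).[x].

Lemma poly_at_morph (B : comNzRingType) (f : {rmorphism E -> B}) p x :
  f (poly_at p x) = (map_poly (f \o @mpolyC r A) p).[f x].
Proof. by rewrite /poly_at -horner_map /= -map_poly_comp. Qed.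

(** [rho] exhibits [X_i] as a polynomial variable over [E]: the other [q l] stay constants lying in
    [J], while [q i] becomes monic. The coefficients remain in [E] itself, and evaluation at [X_i]
    undoes [rho]. *)
Lemma univariate_regular (L : seq 'I_r) i : i \notin L ->
  regular_mod (ideal_list (@zero_ideal E) [seq poly_at (q l) 'X_l | l <- L]) (poly_at (q i) 'X_i).
Proof.
move=> iL; set J := ideal_list _ _.
have hJ : is_ideal J by apply: ideal_list_ideal; apply: zero_idealP.
pose rho : {rmorphism E -> {poly E}} :=
  mmap (polyC \o @mpolyC r A) (fun l => if l == i then 'X else ('X_l)%:P).
have rhoC c : rho c%:MP = c%:MP%:P by rewrite -[LHS]/(mmap _ _ _) mmapC.
have rhoX l : rho 'X_l = if l == i then 'X else ('X_l)%:P.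
  by rewrite -[LHS]/(mmap _ _ _) mmapX mmap1U.
have rho_at p x : rho (poly_at p x) = (map_poly polyC (map_poly (@mpolyC r A) p)).[rho x].
  rewrite poly_at_morph -map_poly_comp; congr (_.[_]); apply: eq_map_poly => c.
  exact: rhoC.
have rhoK x : (rho x).['X_i] = x.
  apply: (@mpoly_morph_eq _ _ _ (horner_eval 'X_i \o rho) idfun) => [c|l].
    transitivity (c%:MP%:P.['X_i] : E); last by rewrite hornerC.
    by congr (_.['X_i]); exact: rhoC.
  transitivity ((if l == i then 'X else ('X_l)%:P).['X_i] : E).
    by congr (_.['X_i]); exact: rhoX.
  by case: eqP => [->|_]; rewrite ?hornerX ?hornerC.
have hK := preimage_ideal rho (poly_ideal_ideal hJ).
have JK : ideal_sub J (fun x => poly_ideal J (rho x)).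
  apply: ideal_list_min => // [x ->|_ /mapP[l lL ->]].
    by rewrite rmorph0; apply: ideal0; apply: poly_ideal_ideal.
  rewrite rho_at rhoX ifN; last by apply: contraNneq iL => <-.
  rewrite horner_map /= => j; rewrite coefC; case: eqP => _; last exact: ideal0.
  by apply: ideal_list_mem; [apply: zero_idealP | apply: map_f].
move=> f /JK; rewrite rmorphM rho_at rhoX eqxx -/(_ \Po _) comp_polyXr.
have mqi : map_poly (@mpolyC r A) (q i) \is monic by apply: monic_map.
move=> /(poly_ideal_monic hJ mqi) Jf.
rewrite -[f]rhoK horner_coef; apply: (ideal_sum hJ) => j _; exact: (ideal_mulr hJ).
Qed.

Lemma ext_ideal_list (B : comNzRingType) (phi : {rmorphism E -> B}) s :
  ideal_eq (ext_ideal phi (ideal_list (@zero_ideal E) s)) (ideal_list (@zero_ideal B) (map phi s)).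
Proof.
move=> z; split=> [Hz|].
  apply: Hz; first by apply: ideal_list_ideal; apply: zero_idealP.
  have hK := preimage_ideal phi (ideal_list_ideal (map phi s) (@zero_idealP B)).
  apply: ideal_list_min => // [x ->|x xs].
    by rewrite rmorph0; apply: ideal0; apply: ideal_list_ideal; apply: zero_idealP.
  by apply: ideal_list_mem; [apply: zero_idealP | apply: map_f].
move: z; apply: ideal_list_min; first exact: ext_ideal_ideal.
  by move=> x ->; apply: ideal0; apply: ext_ideal_ideal.
move=> _ /mapP[x xs ->]; apply: ext_ideal_mem; apply: ideal_list_mem => //.
exact: zero_idealP.
Qed.

Lemma symmetric_regular (L : seq 'I_r) i : i \notin L ->
  regular_mod (ideal_list (@zero_ideal E) [seq poly_at (q l) (mesym r A l.+1) | l <- L])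
    (poly_at (q i) (mesym r A i.+1)).
Proof.
move=> iL.
have sym_at p l : sym_map A r (poly_at p 'X_l) = poly_at p (mesym r A l.+1).
  rewrite poly_at_morph sym_mapX; congr (_.[_]); apply: eq_map_poly => c; exact: sym_mapC.
have hJ : is_ideal (ideal_list (@zero_ideal E) [seq poly_at (q l) 'X_l | l <- L]).
  by apply: ideal_list_ideal; apply: zero_idealP.
have := sym_map_regular hJ (univariate_regular iL).
rewrite sym_at; apply: regular_mod_eq => z.
rewrite (_ : [seq poly_at (q l) (mesym r A l.+1) | l <- L] =
  map (sym_map A r) [seq poly_at (q l) 'X_l | l <- L]); first exact: ext_ideal_list.
by rewrite -map_comp; apply: eq_map => l; rewrite -sym_at.
Qed.

End UnivariateSequences.

(** * Monomial ideals *)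

Section MonomialIdeals.
Variables (k : fieldType) (r : nat).
Local Notation S := {mpoly k[r]}.

Lemma monomial_ideal_ideal n (a : 'I_n -> 'X_{1..r}) : is_ideal (@monomial_ideal k r n a).
Proof.
split=> [|_ _ [g ->] [h ->]|c _ [g ->]].
- by exists (fun=> 0); rewrite big1 // => i _; rewrite mul0r.
- by exists (fun i => g i + h i); rewrite -big_split; apply: eq_bigr => i _; rewrite mulrDl.
- by exists (fun i => c * g i); rewrite mulr_sumr; apply: eq_bigr => i _; rewrite mulrA.
Qed.

Lemma monomial_ideal_X n (a : 'I_n -> 'X_{1..r}) i m :
  (a i <= m)%MM -> @monomial_ideal k r n a 'X_[m].
Proof.
move=> am; exists (fun j => if j == i then 'X_[m - a i] else 0).
rewrite (bigD1 i) //= eqxx big1 ?addr0 => [|j /negPf->]; last by rewrite mul0r.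
by rewrite -mpolyXD submK.
Qed.

Definition kill_vars (T : {set 'I_r}) : {rmorphism S -> S} :=
  mmap (@mpolyC r k) (fun j => if j \in T then 0 else 'X_j).

Lemma kill_varsX T j : kill_vars T 'X_j = if j \in T then 0 else 'X_j.
Proof. by rewrite -[LHS]/(mmap _ _ _) mmapX mmap1U. Qed.

Lemma kill_varsC T c : kill_vars T c%:MP = c%:MP.
Proof. by rewrite -[LHS]/(mmap _ _ _) mmapC. Qed.

(** The ideal generated by the variables of [T], taken as the kernel of a morphism to a domain so
    that it is visibly prime. *)
Definition var_ideal (T : {set 'I_r}) (f : S) : Prop := kill_vars T f = 0.

Lemma var_ideal_prime T : prime_ideal (var_ideal T).
Proof.
have idT : is_ideal (var_ideal T) := preimage_ideal (kill_vars T) (@zero_idealP S).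
split=> //; first by rewrite /var_ideal rmorph1 => /eqP; rewrite oner_eq0.
by move=> x y; rewrite /var_ideal rmorphM => /eqP; rewrite mulf_eq0 => /orP[]/eqP; [left | right].
Qed.

Lemma var_ideal_min (T : {set 'I_r}) (Q : S -> Prop) :
  is_ideal Q -> (forall j, j \in T -> Q 'X_j) -> ideal_sub (var_ideal T) Q.
Proof.
move=> hQ QT f fT; pose G : {rmorphism S -> S} := idfun.
suff : Q (G f - kill_vars T f) by rewrite fT subr0.
move: {fT} f; apply: mpoly_morph_congr => // [c|j].
  by rewrite kill_varsC subrr; apply: ideal0.
rewrite kill_varsX; case: ifP => [/QT|_]; first by rewrite subr0.
by rewrite subrr; apply: ideal0.
Qed.

Lemma var_ideal_step (T : {set 'I_r}) j : j \notin T ->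
  ideal_sub (var_ideal T) (var_ideal (j |: T)) /\
  exists x, var_ideal (j |: T) x /\ ~ var_ideal T x.
Proof.
move=> jT; split.
  apply: var_ideal_min => [|i iT]; first by have [] := var_ideal_prime (j |: T).
  by rewrite /var_ideal kill_varsX in_setU1 iT orbT.
exists 'X_j; rewrite /var_ideal !kill_varsX setU11 (negPf jT); split=> //.
by apply/eqP; rewrite -msupp_eq0 msuppX.
Qed.

Lemma var_ideal_chain T :
  exists C, prime_chain (@zero_ideal S) (var_ideal T) #|T| C.
Proof.
move: {2}#|T| (erefl #|T|) => h; elim: h T => [|h IH] T.
  move=> T0; rewrite T0; exists (fun=> var_ideal T); split=> //.
  - move=> x ->; have [idT _ _] := var_ideal_prime T; exact: ideal0.
  - by move=> i _; apply: var_ideal_prime.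
move=> cT; have [j jT] : exists j, j \in T by apply/card_gt0P; rewrite cT.
have cTj : #|T :\ j| = h by move: cT; rewrite (cardsD1 j) jT => -[].
have [C chC] := IH _ cTj; rewrite cTj in chC.
have [sub ex] := @var_ideal_step (T :\ j) j (negbT (setD11 _ _)); rewrite (setD1K jT) in sub ex.
by rewrite cT; apply: prime_chain_rcons chC (var_ideal_prime T) sub ex.
Qed.

(** The two chains need not meet: the last prime of the first one is replaced by [D 0], which
    contains it, so no length is lost. *)
Lemma prime_chain_cat (A : comNzRingType) (I P P' Q : A -> Prop) h m C D :
  prime_chain I P h C -> ideal_sub P P' -> prime_chain P' Q m D ->
  exists C', prime_chain I Q (h + m) C'.
Proof.
move=> chC PP' [P'D DQ primeD stepD].
have chD0 : exists C', prime_chain I (D 0%N) (h + 0) C'.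
  have [IC CP primeC stepC] := chC; rewrite addn0.
  case: h {chC} => [|h] in IC CP primeC stepC *.
    exists (fun=> D 0%N); split=> //; last by move=> i _; apply: primeD.
    by move=> x /IC/CP/PP'/P'D.
  have chC' : prime_chain I (C h) h C.
    by split=> // i ih; [apply: primeC; apply: ltnW | apply: stepC; apply: ltnW].
  have [sub [x [Cx nCx]]] := stepC h (ltnSn h).
  apply: prime_chain_rcons chC' (primeD _ _) _ _ => //.
    by move=> y /sub/CP/PP'/P'D.
  by exists x; split=> //; apply/P'D/PP'/CP.
suff [C' [IC' CQ' p' s']] : exists C', prime_chain I (D m) (h + m) C'.
  by exists C'; split=> // x; rewrite CQ'.
elim: {-2}m (leqnn m) => // i IH im; rewrite addnS.
have [C' chC'] := IH (ltnW im).
by have [sub ex] := stepD i im; apply: prime_chain_rcons chC' (primeD _ im) sub ex.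
Qed.

(** The chain is prolonged by adding the missing variables one by one, and [krull_dim_mpoly] bounds
    the result. *)
Lemma var_ideal_chain_bound (I : S -> Prop) T h C :
  prime_chain I (var_ideal T) h C -> (h + (r - #|T|) <= r)%N.
Proof.
move: {2}(r - #|T|)%N (erefl (r - #|T|)%N) => d; elim: d T h C => [|d IH] T h C.
  move=> ->; rewrite addn0 => -[_ _ primeC stepC]; exact: krull_dim_mpoly primeC stepC.
move=> cT chC; have Tr : (#|T| < r)%N by rewrite -subn_gt0 cT.
have [j jT] : exists j, j \notin T.
  apply/existsP; rewrite -negb_forall; apply: contraL Tr => /forallP T1.
  by rewrite -leqNgt -[X in (X <= _)%N](card_ord r) subset_leq_card //; apply/subsetP => i _; apply: T1.
have [sub ex] := var_ideal_step jT.
have [C' chC'] := prime_chain_rcons chC (var_ideal_prime _) sub ex.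
have cT' : (r - #|j |: T|)%N = d by rewrite cardsU1 jT add1n; move: cT; lia.
by have := IH _ _ _ cT' chC'; rewrite cT cT'; lia.
Qed.

Lemma var_ideal_height T : height_mod (fun x : S => x = 0) (var_ideal T) #|T|.
Proof.
split; first exact: var_ideal_chain.
move=> m C /var_ideal_chain_bound; have := max_card (mem T); rewrite card_ord; lia.
Qed.

Section Covers.
Variables (n : nat) (a : 'I_n -> 'X_{1..r}).
Local Notation I := (@monomial_ideal k r n a).

(** [T] meets the support of every generator; such sets index the primes generated by variables that
    contain [I]. *)
Definition covers (T : {set 'I_r}) : Prop := forall i, exists j, j \in T /\ a i j <> 0%N.

Definition min_cover (c : nat) : Prop :=
  (exists T, covers T /\ #|T| = c) /\ forall T, covers T -> (c <= #|T|)%N.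

Lemma monomial_ideal_sub_var T : covers T -> ideal_sub I (var_ideal T).
Proof.
move=> cT _ [g ->]; have [idT _ _] := var_ideal_prime T.
apply: (ideal_sum idT) => i _; apply: (idealM idT); have [j [jT aij]] := cT i.
rewrite /var_ideal mpolyXE_id rmorph_prod (bigD1 j) //= rmorphXn /= kill_varsX jT.
by case: (a i j) aij => // m _; rewrite exprS !mul0r.
Qed.

Lemma prime_contains_cover (Q : S -> Prop) : prime_ideal Q -> ideal_sub I Q ->
  exists T, covers T /\ ideal_sub (var_ideal T) Q.
Proof.
move=> [idQ Q1 primeQ] IQ.
pose T := [set j | if excluded_middle_informative (Q 'X_j) then true else false].
have TP j : j \in T <-> Q 'X_j by rewrite inE; case: excluded_middle_informative.
exists T; split; last by apply: var_ideal_min => // j /TP.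
move=> i; have := IQ _ (monomial_ideal_X (lepm_refl (a i))).
rewrite mpolyXE_id => QX; apply: NNPP => nT; move: QX.
apply: (big_ind (fun x => ~ Q x)) => // [x y nx ny /primeQ[]//|j _].
have [->//|aij] := eqVneq (a i j) 0%N; elim: (a i j) => // m IH.
rewrite exprS => /primeQ[Qj|//]; apply: nT; exists j; split; first exact/TP.
exact/eqP.
Qed.

(** A prime containing [I] contains a variable of each generator, hence the prime ideal of some
    cover, and the height of the latter is the size of that cover. *)
Lemma codim_monomial c : codim_quot I c <-> min_cover c.
Proof.
have lower T : covers T -> codim_quot I c -> (c <= #|T|)%N.
  move=> cT [_ H]; apply: H (var_ideal_prime T) _ (var_ideal_height T).
  exact: monomial_ideal_sub_var.
split=> [H|[[T [cT <-]] H]].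
  split=> [|T cT]; last exact: lower.
  have [[P [primeP IP [_ hP]]] _] := H.
  have [T [cT TP]] := prime_contains_cover primeP IP.
  exists T; split=> //; apply/eqP; rewrite eqn_leq lower // andbT.
  have [C chC] := var_ideal_chain T.
  have chP : prime_chain P P 0 (fun=> P) by split.
  have [C' chC'] := prime_chain_cat chC TP chP.
  by have := hP _ _ chC'; rewrite addn0.
split=> [|P h primeP IP [_ hP]].
  exists (var_ideal T); split; [exact: var_ideal_prime | exact: monomial_ideal_sub_var |].
  exact: var_ideal_height.
have [T' [cT' T'P]] := prime_contains_cover primeP IP.
apply: leq_trans (H _ cT') _.
have [C chC] := var_ideal_chain T'.
have chP : prime_chain P P 0 (fun=> P) by split.
have [C' chC'] := prime_chain_cat chC T'P chP.
by have := hP _ _ chC'; rewrite addn0.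
Qed.

(** The bottom prime of the chain contains the ideal of a cover, below which there is room for at
    least [c] further primes. *)
Lemma chain_mod_monomial_bound c P m C : min_cover c -> prime_ideal P ->
  prime_chain I P m C -> (m <= r - c)%N.
Proof.
move=> [_ mc] primeP chC; have [IC _ primeC stepC] := chC.
have [T [cT TQ]] := prime_contains_cover (primeC 0%N isT) IC.
have [D chD] := var_ideal_chain T.
have chC0 : prime_chain (C 0%N) P m C by have [_ ? ? ?] := chC; split.
have [C' [_ _ pC' sC']] := prime_chain_cat chD TQ chC0.
by have := krull_dim_mpoly pC' sC'; have := mc T cT; lia.
Qed.

Definition radical (f : S) : Prop := exists N, I (f ^+ N).

Lemma radicalD f g : radical f -> radical g -> radical (f + g).
Proof.
move=> [m If] [n' Ig]; exists (m + n')%N; rewrite exprDn.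
have hI := monomial_ideal_ideal a.
apply: (ideal_sum hI) => i _; rewrite -mulr_natr; apply: (ideal_mulr hI).
have [mi|im] := leqP n' i.
  by rewrite -(subnK mi) exprD mulrA; apply: (idealM hI).
apply: (ideal_mulr hI); have mi : (m <= m + n' - i)%N by lia.
by rewrite -(subnK mi) exprD; apply: (idealM hI).
Qed.

Lemma mesym_radical c i : min_cover c -> (r - c <= i)%N -> radical (mesym r k i.+1).
Proof.
move=> [_ mc] ri; rewrite mesymE; elim/big_ind: _ => [||h /eqP ch].
- by exists 1%N; rewrite expr1; apply: ideal0; apply: monomial_ideal_ideal.
- exact: radicalD.
(* [h] has [i + 1 > r - c] elements, so its complement has fewer than [c] and is not a cover. *)
have [l hl] : exists l, forall j, j \notin h -> a l j = 0%N.
  apply: NNPP => nl; have : covers (~: h).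
    move=> l; apply: NNPP => nj; apply: nl; exists l => j jh.
    by apply: NNPP => alj; apply: nj; exists j; rewrite inE.
  by move/mc; have := cardsC h; rewrite card_ord ch; lia.
exists (mdeg (a l)); rewrite mpolyXn; apply: (@monomial_ideal_X _ _ l).
apply/mnm_lepP => j; rewrite mulmnE mnmE; have [jh|/hl->//] := boolP (j \in h).
by rewrite mul1n mdegE (bigD1 j) //= leq_addr.
Qed.

End Covers.
End MonomialIdeals.

(** Regularity modulo [I] adds [s] to [I], while the complex is reduced modulo [s] alone; this
    splitting lets the augmentation translate between the two. *)
Lemma ideal_list_addP (A : comNzRingType) (I : A -> Prop) s f : is_ideal I ->
  ideal_list I s f <-> exists y, I y /\ ideal_list (@zero_ideal A) s (f - y).
Proof.
move=> hI; have h0 := ideal_list_ideal s (@zero_idealP A); split.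
  move: f; apply: ideal_list_min => [|y Iy|y ys].
  - split=> [|x1 x2 [y [Iy Jy]] [z [Iz Jz]]|c x [y [Iy Jy]]].
    + by exists 0; rewrite subrr; split; apply: ideal0.
    + exists (y + z); split; first exact: (idealD hI).
      by rewrite opprD addrACA; apply: (idealD h0).
    + by exists (c * y); rewrite -mulrBr; split; [apply: (idealM hI) | apply: (idealM h0)].
  - by exists y; rewrite subrr; split=> //; apply: ideal0.
  - exists 0; rewrite subr0; split; first exact: ideal0.
    exact: ideal_list_mem (@zero_idealP A) ys.
move=> [y [Iy]] /(ideal_list_mono (K := I) _) H.
have hIs := ideal_list_ideal s hI.
apply: (idealBK hIs (H _)) => [x ->|]; first exact: ideal0.
exact: ideal_list_sub.
Qed.

Lemma regular_list_cat (A : comNzRingType) (J : A -> Prop) s1 s2 :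
  regular_list J (s1 ++ s2) -> regular_list (ideal_list J s1) s2.
Proof. by elim: s1 J => //= x s IH J [_ /IH]. Qed.

Lemma maximal_ideal_prime (A : comNzRingType) (P : A -> Prop) :
  maximal_ideal P -> prime_ideal P.
Proof.
move=> [idP P1 maxP]; split=> // x y Pxy; have [Px|nPx] := classic (P x); [by left | right].
have [z [b [Pz E]]] : add_elt P x 1.
  apply: NNPP => n1; apply: nPx; apply: (maxP (add_elt P x)) => //.
  - exact: add_elt_ideal.
  - exact: add_elt_sub.
  - exact: add_elt_mem.
rewrite -[y]mul1r E mulrDl -mulrA; apply: (idealD idP); last exact: (idealM idP).
exact: (ideal_mulr idP).
Qed.

(** * Cohen-Macaulayness from a resolution whose length is the codimension *)

Section Criterion.
Variables (k : fieldType) (r n c : nat) (a : 'I_n -> 'X_{1..r}).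
Local Notation S := {mpoly k[r]}.
Local Notation I := (@monomial_ideal k r n a).
Variables (X : finType) (M : X -> X -> S) (C : nat -> X -> Prop) (u0 : X -> S).
Hypothesis bd_degree : forall j F G, C j.+1 F -> M F G <> 0 -> C j G.
Hypothesis bd_bd : forall e G, bd M (bd M e) G = 0.
Hypothesis exact_pos : forall j, exact_mod M C (@zero_ideal S) j.+1.
Hypothesis length_c : forall F, ~ C c.+1 F.
Hypothesis supported_u0 : supported C 0 u0.
Hypothesis rank_one : forall u, supported C 0 u -> exists f, forall G, u G = f * u0 G.
Hypothesis augmentation : forall J, is_ideal J -> forall f,
  bounds_mod M C J 0 (fun G => f * u0 G) <-> exists y, I y /\ J (f - y).

Lemma sym_parameter (P : S -> Prop) (i : 'I_r) : min_cover a c -> maximal_ideal P ->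
  exists q : {poly k}, [/\ q \is monic,
    (i < r - c)%N -> P (poly_at q (mesym r k i.+1)) &
    (r - c <= i)%N -> I (poly_at q (mesym r k i.+1))].
Proof.
move=> mc maxP; have [ic|ci] := ltnP i (r - c).
  by have [q [mq Pq]] := nullstellensatz (mesym r k i.+1) maxP; exists q; split.
have [N IN] := mesym_radical k mc ci; exists 'X^N; split=> //; first exact: monicXn.
by rewrite /poly_at map_polyXn hornerXn.
Qed.

(* The polynomials [g] in the first elementary symmetric polynomials lie in [P], those
   [h] in the last ones lie in [I]; the [h] force the complex to stay exact modulo the
   [g], which makes the [g] a regular sequence modulo [I]. *)
Lemma maximal_regular_sequence (P : S -> Prop) : min_cover a c -> maximal_ideal P ->
  exists s : seq S, [/\ size s = (r - c)%N, regular_list I s & {in s, forall x, P x}].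
Proof.
move=> mc maxP; have hI := monomial_ideal_ideal k a.
have [q hq] := dep_choice (fun i => sym_parameter i mc maxP).
pose f (i : 'I_r) := poly_at (q i) (mesym r k i.+1).
have mq i : q i \is monic by have [] := hq i.
have cr : (c <= r)%N.
  by have [[T [_ <-]] _] := mc; have := max_card (mem T); rewrite card_ord.
have regf s : uniq s -> regular_list (@zero_ideal S) [seq f i | i <- s].
  elim/last_ind: s => // s i IH; rewrite rcons_uniq map_rcons => /andP[is_ us].
  by apply/regular_list_rcons; split; [apply: IH | apply: symmetric_regular].
pose enumr := enum 'I_r; pose D := (r - c)%N.
have sz : size enumr = r by rewrite size_enum_ord.
have Dr : (D <= r)%N by rewrite leq_subr.
pose gs := [seq f i | i <- take D enumr]; pose hs := [seq f i | i <- drop D enumr].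
have sgs : size gs = D by rewrite size_map size_takel ?sz.
have gsP : {in gs, forall x, P x}.
  move=> _ /mapP[i iD ->]; have [_ + _] := hq i; apply.
  have := map_f val iD; rewrite map_take val_enum_ord take_iota mem_iota add0n.
  by rewrite /= leq_min => /andP[].
have hsI h : h \in hs -> I h.
  move=> /mapP[i iD ->]; have [_ _] := hq i; apply.
  by have := map_f val iD; rewrite map_drop val_enum_ord drop_iota mem_iota => /andP[].
have shs : size hs = c by rewrite size_map size_drop sz subKn.
(* Exactness modulo the first [t] elements and their regularity modulo [I] have to be proved
   together, as each step of [regular_step] consumes the former. *)
suff H t : (t <= D)%N ->
    (forall j, exact_mod M C (ideal_list (@zero_ideal S) (take t gs)) j.+1) /\
    regular_list I (take t gs).
  exists gs; split=> //; have [_] := H D (leqnn _).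
  by rewrite take_oversize // sgs.
elim: t => [|t IH] tD; first by rewrite take0; split.
have [ext regt] := IH (ltnW tD).
have tg : (t < size gs)%N by rewrite sgs.
set J := ideal_list (@zero_ideal S) (take t gs).
have hJ : is_ideal J by apply: ideal_list_ideal; apply: zero_idealP.
have Etake : take t.+1 gs = rcons (take t gs) gs`_t by rewrite (take_nth 0).
(* Regularity in any order is used here: the first [t + 1] elements of [gs] are followed at once by
   all of [hs], skipping the rest of [gs]. *)
have regall : regular_list (@zero_ideal S) (take t.+1 gs ++ hs).
  rewrite -map_take -map_cat; apply: regf.
  have -> : take t.+1 (take D enumr) = take t.+1 enumr by rewrite take_takel.
  apply: (subseq_uniq _ (enum_uniq 'I_r)).
  rewrite -[X in subseq _ X](cat_take_drop D); apply: cat_subseq => //.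
  by rewrite -(take_takel _ tD) take_subseq.
have regJ : regular_mod J gs`_t.
  have := regall; rewrite Etake cat_rcons => /regular_list_cat /= [] //.
have reghs : regular_list (add_elt J gs`_t) hs.
  by have := regular_list_cat regall; rewrite Etake ideal_list_rcons.
have [||ext' regI] := regular_step bd_degree bd_bd hJ regJ ext reghs.
- by rewrite shs add1n.
- move=> h u hhs su; have [x Ex] := rank_one su.
  have [|e [se He]] := proj2 (augmentation hJ (h * x)).
    exists (h * x); rewrite subrr; split; last exact: ideal0.
    by apply: (ideal_mulr hI); apply: hsI.
  by exists e; split=> // G; rewrite Ex mulrA.
rewrite Etake ideal_list_rcons; split=> //; apply/regular_list_rcons; split=> //.
(* Through [augmentation], cancelling the next element modulo [I] is its injectivity on the homology
   of degree 0. *)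
move=> x /(ideal_list_addP _ _ hI) H; apply/(ideal_list_addP _ _ hI).
apply/(augmentation hJ); apply: regI.
  by move=> F xF; apply: supported_u0 => u0F; apply: xF; rewrite u0F mulr0.
have /(augmentation hJ)[e [se He]] := H; exists e; split=> // G.
by rewrite mulrA.
Qed.

(** The sequence gives depth at least [r - c]. A regular sequence in [P] produces a prime chain of
    the same length ending at [P], and such chains have length at most [r - c], which bounds depth
    and height alike. *)
Theorem cm_criterion : min_cover a c -> cohen_macaulay_quot I.
Proof.
move=> mc P maxP IP; have hI := monomial_ideal_ideal k a.
have primeP := maximal_ideal_prime maxP; have [idP P1 _] := primeP.
have [s [ss regs sP]] := maximal_regular_sequence mc maxP.
exists (r - c)%N; split.
  split=> [|s' /(regular_seqP _ hI)[regs' _] sP'].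
    exists s; split=> //; apply/(regular_seqP _ hI); split=> // /(ideal_list_min idP IP sP).
    exact: P1.
  have [C' chC'] := regular_list_prime_chain hI primeP IP regs' sP'.
  exact: chain_mod_monomial_bound mc primeP chC'.
split; first by rewrite -ss; apply: regular_list_prime_chain hI primeP IP regs sP.
by move=> m Q; apply: chain_mod_monomial_bound mc primeP.
Qed.

End Criterion.

(** * Faces of a pyramid *)

Section Faces.
Variables (R : realFieldType) (d n : nat) (p : 'I_n -> 'rV[R]_d).
Implicit Types (F G : {set 'I_n}).

Lemma is_faceP F : is_face p F <-> exists (c : 'cV[R]_d) (b : R),
  (forall i, (p i *m c) 0 0 <= b) /\ (forall i, (i \in F) = ((p i *m c) 0 0 == b)).
Proof.
split=> -[c [b [H1 H2]]]; exists c, b; split=> //.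
  move=> i; apply: H1; exists (fun j => (j == i)%:R); split.
  - by move=> j; rewrite ler0n.
  - by rewrite (bigD1 i) //= eqxx big1 ?addr0 // => j /negPf->.
  - by rewrite (bigD1 i) //= eqxx scale1r big1 ?addr0 // => j /negPf->; rewrite scale0r.
move=> _ [w [w0 w1 ->]]; rewrite mulmx_suml summxE -[b]mul1r -w1 mulr_suml.
by apply: ler_sum => i _; rewrite -scalemxAl mxE ler_wpM2l.
Qed.

Definition face_mx F : 'M[R]_(n, d + 1) :=
  \matrix_(i < n) (if i \in F then row_mx (p i) (1%:M : 'M[R]_1) else 0).

Lemma row_face_mx F i : row i (face_mx F) = if i \in F then row_mx (p i) 1%:M else 0.
Proof. by rewrite rowK. Qed.

Lemma face_mxP m F (B : 'M_(m, d + 1)) :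
  reflect (forall i, i \in F -> (row_mx (p i) (1%:M : 'M_1) <= B)%MS) (face_mx F <= B)%MS.
Proof.
apply: (iffP row_subP) => H i; last by rewrite row_face_mx; case: ifP => [/H|_] //; rewrite sub0mx.
by move=> iF; have := H i; rewrite row_face_mx iF.
Qed.

Lemma face_mx_row F i : i \in F -> (row_mx (p i) (1%:M : 'M_1) <= face_mx F)%MS.
Proof. by move=> iF; have := row_sub i (face_mx F); rewrite row_face_mx iF. Qed.

Lemma face_mxS F G : F \subset G -> (face_mx F <= face_mx G)%MS.
Proof. by move=> /subsetP FG; apply/face_mxP => i /FG; apply: face_mx_row. Qed.

Lemma hdegS F G : F \subset G -> (hdeg p F <= hdeg p G)%N.
Proof. by move=> FG; apply: mxrankS; apply: face_mxS. Qed.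

(** A face contains every vertex in its affine span: the linear form [(c, -b)] vanishes on the rows
    of [F], and with equal ranks these span the rows of [G]. *)
Lemma face_hdeg_eq F G : is_face p F -> F \subset G -> hdeg p F = hdeg p G -> F = G.
Proof.
move=> [c [b [_ Fcb]]] FG E; apply/eqP; rewrite eqEsubset FG; apply/subsetP => i iG.
have GF : (face_mx G <= face_mx F)%MS by rewrite -(geq_leqif (mxrank_leqif_sup (face_mxS FG))); apply: eq_leq (esym E).
pose K := col_mx c (- b%:M) : 'M_(d + 1, 1).
have rowK0 j : row_mx (p j) 1%:M *m K = p j *m c - b%:M by rewrite mul_row_col mul1mx.
have FK : face_mx F *m K = 0.
  apply/row_matrixP => j; rewrite row_mul row_face_mx row0.
  case: ifP => jF; last by rewrite mul0mx.
  by rewrite rowK0 [p j *m c]mx11_scalar; move: jF; rewrite Fcb => /eqP->; rewrite subrr.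
have /submxP[D E'] := submx_trans (face_mx_row iG) GF.
have : row_mx (p i) 1%:M *m K = 0 by rewrite E' -mulmxA FK mulmx0.
rewrite rowK0 Fcb => /(congr1 (fun A : 'M_1 => A 0 0)); rewrite !mxE mulr1n => /eqP.
by rewrite subr_eq0.
Qed.

Lemma is_face0 : is_face p set0.
Proof. by apply/is_faceP; exists 0, 1; split=> i; rewrite mulmx0 mxE ?inE ?ler01 // eq_sym oner_eq0. Qed.

Lemma hdeg0 : hdeg p set0 = 0%N.
Proof.
apply/eqP; rewrite mxrank_eq0; apply/eqP/row_matrixP => i.
by rewrite -/(face_mx set0) row_face_mx inE row0.
Qed.

Lemma hdeg_eq0 F : hdeg p F = 0%N -> F = set0.
Proof.
move=> /eqP; rewrite mxrank_eq0 -/(face_mx F) => /eqP F0; apply/eqP; rewrite -subset0; apply/subsetP => i iF.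
have := row_face_mx F i; rewrite F0 row0 iF => /esym/(congr1 rsubmx).
rewrite row_mxKr => /(congr1 (fun A : 'M_1 => A 0 0)); rewrite !mxE mulr1n => /eqP.
by rewrite oner_eq0.
Qed.

End Faces.

Section Pyramid.
Variables (R : realFieldType) (d v : nat) (p : 'I_v -> 'rV[R]_d) (t : 'rV[R]_d).
Hypothesis ht : ~ in_aff p t.
Local Notation q := (pyramid p t).
Implicit Types (F G H : {set 'I_v}) (b : bool).

(** In the pyramid, [up false G] is the base face [G] and [up true G] the cone over it. *)
Definition up b G : {set 'I_v.+1} := [set i | if unlift ord_max i is Some j then j \in G else b].
Definition base (F : {set 'I_v.+1}) : {set 'I_v} := [set i | lift ord_max i \in F].

Lemma in_up_lift b G i : (lift ord_max i \in up b G) = (i \in G).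
Proof. by rewrite inE liftK. Qed.

Lemma in_up_max b G : (ord_max \in up b G) = b.
Proof. by rewrite inE unlift_none. Qed.

Lemma base_up b G : base (up b G) = G.
Proof. by apply/setP => i; rewrite inE in_up_lift. Qed.

Lemma up_base (F : {set 'I_v.+1}) : up (ord_max \in F) (base F) = F.
Proof.
by apply/setP => i; case: (unliftP ord_max i) => [j ->|->]; rewrite ?in_up_lift ?in_up_max ?inE.
Qed.

Lemma up_sub b b' G G' : (up b G \subset up b' G') = (b ==> b') && (G \subset G').
Proof.
apply/subsetP/andP => [H|[bb /subsetP GG] i].
  split; first by apply/implyP => hb; have := H ord_max; rewrite !in_up_max; apply.
  by apply/subsetP => i; have := H (lift ord_max i); rewrite !in_up_lift.
case: (unliftP ord_max i) => [j ->|->]; rewrite ?in_up_lift ?in_up_max; first exact: GG.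
exact: implyP.
Qed.

Lemma up0 : up false set0 = set0.
Proof. by apply/setP => i; rewrite !inE; case: unliftP => // j _; rewrite inE. Qed.

Lemma upT : up true setT = setT.
Proof. by apply/setP => i; rewrite !inE; case: unliftP => // j _; rewrite inE. Qed.

Lemma up1 i : up false [set i] = [set lift ord_max i].
Proof.
apply/setP => l; case: (unliftP ord_max l) => [j ->|->].
  by rewrite in_up_lift !inE (inj_eq lift_inj).
by rewrite in_up_max inE; apply/esym/negbTE; rewrite neq_lift.
Qed.

Lemma up1max : up true set0 = [set ord_max].
Proof.
apply/setP => l; case: (unliftP ord_max l) => [j ->|->]; last by rewrite in_up_max inE eqxx.
by rewrite in_up_lift !inE; apply/esym/negbTE; rewrite eq_sym neq_lift.
Qed.

Lemma big_up (V : nmodType) (f : {set 'I_v.+1} -> V) :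
  \sum_F f F = \sum_G f (up false G) + \sum_G f (up true G).
Proof.
rewrite (bigID (fun F : {set 'I_v.+1} => ord_max \notin F)) /=; congr (_ + _).
  rewrite (reindex_onto (up false) base) /= => [|F /negPf mF].
    by apply: eq_bigl => G; rewrite in_up_max base_up eqxx.
  by rewrite -[in RHS](up_base F) mF.
rewrite (reindex_onto (up true) base) /= => [|F mF].
  by apply: eq_bigl => G; rewrite in_up_max base_up eqxx.
by rewrite -[in RHS](up_base F); move: mF; rewrite negbK => ->.
Qed.

Lemma pyramid_lift i : q (lift ord_max i) = p i.
Proof. by rewrite /pyramid liftK. Qed.

Lemma pyramid_max : q ord_max = t.
Proof. by rewrite /pyramid unlift_none. Qed.

(** The last column forces the coefficients of such a combination to sum to 1, which would put [t]
    in the affine span; zero rows get coefficient 0. *)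
Lemma apex_not_sub (F : {set 'I_v}) : ~~ (row_mx t (1%:M : 'M[R]_1) <= face_mx p F)%MS.
Proof.
apply/negP => /submxP[D E]; apply: ht; exists (fun i => if i \in F then D 0 i else 0).
move: E; rewrite mulmx_sum_row => E; split.
  have := congr1 (fun A => rsubmx A 0 0) E; rewrite row_mxKr mxE mulr1n => ->.
  rewrite linear_sum summxE; apply: eq_bigr => i _; rewrite linearZ /= row_face_mx.
  by case: ifP => _; rewrite ?row_mxKr ?linear0 ?mxE ?mulr1n ?mulr1 ?mulr0 //.
have := congr1 lsubmx E; rewrite row_mxKl => {1}->.
rewrite linear_sum; apply: eq_bigr => i _; rewrite linearZ /= row_face_mx.
by case: ifP => _; rewrite ?row_mxKl ?linear0 ?scale0r ?scaler0.
Qed.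

(** A column of the cokernel of the vertex matrix that does not vanish at the apex gives a
    functional constant on the base. *)
Lemma apex_functional : exists (c : 'cV[R]_d) (b : R),
  (forall i, (p i *m c) 0 0 = b) /\ (t *m c) 0 0 != b.
Proof.
have := apex_not_sub setT; rewrite submxE => /matrix0Pn[i [j]].
set K := cokermx _; rewrite ord1 => nz.
exists (usubmx (col j K)), (- (dsubmx (col j K)) 0 0).
have E (x : 'rV[R]_d) : (row_mx x (1%:M : 'M_1) *m K) 0 j =
    (x *m usubmx (col j K)) 0 0 + (dsubmx (col j K)) 0 0.
  rewrite -[K in LHS]vsubmxK mul_row_col mul1mx !mxE; congr (_ + _).
  by apply: eq_bigr => l _; rewrite !mxE.
split=> [l|]; last by rewrite -addr_eq0 -E.
apply/eqP; rewrite -addr_eq0 -E.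
have /submxP[D ->] := face_mx_row p (in_setT l).
by rewrite -mulmxA mulmx_coker mulmx0 mxE.
Qed.

Lemma is_face_up b G : is_face q (up b G) <-> is_face p G.
Proof.
rewrite !is_faceP; split=> -[c [e [H1 H2]]].
  exists c, e; split=> i; first by have := H1 (lift ord_max i); rewrite pyramid_lift.
  by have := H2 (lift ord_max i); rewrite pyramid_lift in_up_lift.
have [c0 [e0 [Hp Ht]]] := apex_functional.
pose s := (t *m c0) 0 0 - e0.
have s0 : s != 0 by rewrite subr_eq0.
(* Adding [l] times the functional constant on the base changes no base incidence; [l] places the
   apex on the hyperplane when [b] holds and at distance one below the bound otherwise. *)
pose l := (- (~~ b)%:R - ((t *m c) 0 0 - e)) / s.
have valE (x : 'rV[R]_d) : (x *m (c + l *: c0)) 0 0 = (x *m c) 0 0 + l * (x *m c0) 0 0.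
  by rewrite mulmxDr -scalemxAr !mxE.
have tE : (t *m (c + l *: c0)) 0 0 = e + l * e0 - (~~ b)%:R.
  have ls : l * s = - (~~ b)%:R - ((t *m c) 0 0 - e) by rewrite divfK.
  by rewrite valE; move: ls; rewrite /s; lra.
exists (c + l *: c0), (e + l * e0); split=> i; case: (unliftP ord_max i) => [j ->|->].
- by rewrite pyramid_lift valE Hp lerD2r.
- by rewrite pyramid_max tE gerBl ler0n.
- by rewrite pyramid_lift valE Hp in_up_lift H2 (inj_eq (addIr _)).
- by rewrite pyramid_max tE in_up_max; case: (b) => /=; rewrite ?subr0 ?eqxx // -subr_eq0 addrAC subrr add0r oppr_eq0 oner_eq0.
Qed.

Lemma hdeg_up b G : hdeg q (up b G) = (hdeg p G + b)%N.
Proof.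
have E0 : (face_mx q (up false G) :=: face_mx p G)%MS.
  apply/eqmxP/andP; split; apply/face_mxP => i.
    case: (unliftP ord_max i) => [j ->|->]; last by rewrite in_up_max.
    by rewrite in_up_lift pyramid_lift; apply: face_mx_row.
  by rewrite -(in_up_lift false) -pyramid_lift; apply: face_mx_row.
have E1 : (face_mx q (up true G) :=: face_mx p G + row_mx t (1%:M : 'M_1))%MS.
  apply/eqmxP/andP; split; last first.
    rewrite addsmx_sub; have := @face_mx_row _ _ _ q (up true G) ord_max (in_up_max true G).
    rewrite pyramid_max => ->; rewrite andbT.
    by apply/face_mxP => i; rewrite -(in_up_lift true) -pyramid_lift; apply: face_mx_row.
  apply/face_mxP => i; case: (unliftP ord_max i) => [j ->|->] => [|_]; last first.
    by rewrite pyramid_max addsmxSr.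
  by rewrite in_up_lift pyramid_lift => jG; apply: submx_trans (addsmxSl _ _); apply: face_mx_row.
case: b; last by rewrite addn0 /hdeg -!/(face_mx _ _) E0.
rewrite addn1 /hdeg -!/(face_mx _ _) E1; apply/eqP; rewrite eqn_leq; apply/andP; split.
  apply: leq_trans (mxrank_adds_leqif _ _) _; rewrite -[X in (_ <= X)%N]addn1 leq_add2l.
  exact: rank_leq_row.
rewrite ltn_neqAle mxrankS ?addsmxSl // andbT.
rewrite (mxrank_leqif_eq (addsmxSl _ _)); apply/negP => /eqmxP E.
by have := apex_not_sub G; rewrite E addsmxSr.
Qed.

Lemma is_facet_up b b' G F : is_facet q (up b G) (up b' F) <->
  if b == b' then is_facet p G F else [/\ b = false, b' = true, G = F & is_face p G].
Proof.
rewrite /is_facet up_sub !hdeg_up; have fG := is_face_up b G; have fF := is_face_up b' F.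
case: b b' fG fF => [] [] /= fG fF; rewrite ?addn1 ?addn0.
- split=> [[/fG ? /fF ? ? [E]] //|[/fG ? /fF ? ? ->] //].
- by split=> -[].
- split=> [[/fG ? /fF ? s [E]]|[_ _ <- f]]; last by split=> //; [apply/fG | apply/is_face_up].
  by split=> //; apply: (@face_hdeg_eq _ _ _ p).
- by split=> [[/fG ? /fF ? ? ?] //|[/fG ? /fF ? ? ?] //].
Qed.

End Pyramid.

(** * Incidence functions of a polytope and of its pyramid *)

Section Incidence.
Variables (R : realFieldType) (d n : nat) (p : 'I_n -> 'rV[R]_d).
Variable sgn : {set 'I_n} -> {set 'I_n} -> int.
Hypothesis inc : incidence_function p sgn.

Lemma incidence_facet G F : sgn G F != 0 -> is_facet p G F.
Proof. by have [_ H _ _] := inc => /eqP/H. Qed.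

Lemma incidence_vertex i : is_facet p set0 [set i].
Proof. by have [_ H H1 _] := inc; apply/H; rewrite H1. Qed.

(** A nonzero term forces [H] to be a facet of [F] and [G] a facet of [H], which is the case covered
    by the axiom; otherwise the sum is empty. *)
Lemma incidence_square G F : \sum_H sgn G H * sgn H F = 0.
Proof.
have [_ _ _ H] := inc; apply/eqP/negPn/negP => nz.
have [K] : exists K, sgn G K * sgn K F != 0.
  apply: NNPP => nK; case/eqP: nz; apply: big1 => K _; apply/eqP/negPn/negP => nz.
  by apply: nK; exists K.
rewrite mulf_eq0 negb_or => /andP[/incidence_facet[fG _ GK dK] /incidence_facet[_ fF KF dF]].
by move/eqP: nz; apply; apply: H => //; [apply: subset_trans KF | rewrite dF dK].
Qed.

Lemma incidence_unit (k : fieldType) G F : sgn G F != 0 -> (sgn G F)%:~R != 0 :> k.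
Proof.
have [H _ _ _] := inc; have := H G F; rewrite !inE => /or3P[]/eqP-> // _.
  by rewrite oner_neq0.
by rewrite mulrN1z oppr_eq0 oner_neq0.
Qed.

End Incidence.

Section PyramidIncidence.
Variables (R : realFieldType) (d v : nat) (p : 'I_v -> 'rV[R]_d) (t : 'rV[R]_d).
Hypothesis ht : ~ in_aff p t.
Local Notation q := (pyramid p t).

Lemma incidence_base sgn : incidence_function q sgn ->
  incidence_function p (fun G F => sgn (up false G) (up false F)).
Proof.
move=> inc; have [H1 H2 H3 H4] := inc; split=> // [G F|i|G F fG fF GF dF].
- by rewrite H2; have := is_facet_up ht false false G F; rewrite eqxx.
- by rewrite up0 up1.
have := incidence_square inc (up false G) (up false F); rewrite big_up => E.
rewrite -[LHS]addr0 -[in RHS]E; congr (_ + _); apply/esym/big1 => H _.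
apply/eqP; rewrite mulf_eq0; apply/orP; right; apply/negPn/negP => nz.
by have [_ _] := incidence_facet inc nz; rewrite up_sub.
Qed.

Variable sgn : {set 'I_v} -> {set 'I_v} -> int.
Hypothesis inc : incidence_function p sgn.

(** The signs of an algebraic cone: the boundary of the cone over [G] is the cone over the boundary
    of [G], plus [G] with a sign alternating with dimension. At the empty face this sign is 1, as
    the axiom on vertices demands for the apex. *)
Definition sgn_pyramid (G F : {set 'I_v.+1}) : int :=
  if (ord_max \in G) == (ord_max \in F) then sgn (base G) (base F)
  else if (ord_max \in F) && (base G == base F) && (if excluded_middle_informative (is_face p (base G)) then true else false)
  then (-1) ^+ hdeg p (base G) else 0.

Lemma sgn_pyramid_same b G F : sgn_pyramid (up b G) (up b F) = sgn G F.
Proof. by rewrite /sgn_pyramid !in_up_max eqxx !base_up. Qed.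

Lemma sgn_pyramid_down G F : sgn_pyramid (up true G) (up false F) = 0.
Proof. by rewrite /sgn_pyramid !in_up_max. Qed.

Lemma sgn_pyramid_cone G : is_face p G -> sgn_pyramid (up false G) (up true G) = (-1) ^+ hdeg p G.
Proof.
move=> fG; rewrite /sgn_pyramid !in_up_max /= !base_up eqxx /=.
by case: excluded_middle_informative.
Qed.

Lemma sgn_pyramid_up0 G F : G <> F \/ ~ is_face p G -> sgn_pyramid (up false G) (up true F) = 0.
Proof.
rewrite /sgn_pyramid !in_up_max /= !base_up.
by case: eqP => //= -> [//|]; case: excluded_middle_informative.
Qed.

Lemma incidence_pyramid : incidence_function q sgn_pyramid.
Proof.
have [H1 H2 H3 H4] := inc; split=> [G F|G F|i|].
- rewrite /sgn_pyramid; case: ifP => _; first exact: H1.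
  by case: ifP => _; rewrite ?inE // -signr_odd; case: odd.
- rewrite -(up_base G) -(up_base F); move: (base G) (base F) (_ \in G) (_ \in F) => {}G {}F b b'.
  have := is_facet_up ht b b' G F; case: b b' => [] [] /= E.
  + by rewrite sgn_pyramid_same H2; split=> /E.
  + by rewrite sgn_pyramid_down; split=> // /E[].
  + have [EF|GF] := eqVneq G F; last first.
      by rewrite sgn_pyramid_up0; [split=> // /E[_ _ /eqP]; rewrite (negPf GF) | left; apply/eqP].
    subst F; have [fG|nG] := classic (is_face p G); last first.
      by rewrite sgn_pyramid_up0; [split=> // /E[] | right].
    rewrite sgn_pyramid_cone //; split=> _; first exact/E.
    by apply/eqP; rewrite expf_neq0.
  + by rewrite sgn_pyramid_same H2; split=> /E.
- case: (unliftP ord_max i) => [j ->|->].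
    by rewrite -up0 -up1 sgn_pyramid_same.
  by rewrite -up0 -up1max sgn_pyramid_cone ?hdeg0 //; apply: is_face0.
move=> G F; rewrite -(up_base G) -(up_base F); move: (base G) (base F) (_ \in G) (_ \in F) => {}G {}F b b'.
move=> /(is_face_up ht) fG /(is_face_up ht) fF; rewrite up_sub !(hdeg_up ht) big_up.
have [<-|bb'] := eqVneq b b'.
  rewrite implybb => GF dF; have {}dF : hdeg p F = (hdeg p G).+2 by lia.
  rewrite -[RHS](H4 _ _ fG fF GF dF); case: b.
    rewrite big1 ?add0r => [|H _]; last by rewrite sgn_pyramid_down mul0r.
    by apply: eq_bigr => H _; rewrite !sgn_pyramid_same.
  rewrite [X in _ + X]big1 ?addr0 => [|H _]; last by rewrite sgn_pyramid_down mulr0.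
  by apply: eq_bigr => H _; rewrite !sgn_pyramid_same.
case: b b' bb' => [] [] //= _ GF dF; have {}dF : hdeg p F = (hdeg p G).+1 by lia.
(* Between a base face [G] and the cone over [F] only [F] and the cone over [G] contribute; the
   alternating sign makes the two terms cancel. *)
rewrite (bigD1 F) //= big1 ?addr0 => [|H /eqP HF]; last by rewrite sgn_pyramid_up0 ?mulr0; [|left].
rewrite [X in _ + X](bigD1 G) //= [X in _ + (_ + X)]big1 ?addr0 => [|H /eqP HG]; last first.
  by rewrite sgn_pyramid_up0 ?mul0r //; left => E; apply: HG.
rewrite !sgn_pyramid_same !sgn_pyramid_cone // dF exprS; ring.
Qed.

End PyramidIncidence.

(** * Labelled complexes, one multidegree at a time *)

Lemma mcoeff_mulX (k : nzRingType) r (f : {mpoly k[r]}) (m l : 'X_{1..r}) :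
  (f * 'X_[m])@_l = if (m <= l)%MM then f@_(l - m) else 0.
Proof.
case: ifP => [ml|nml]; first by rewrite -{1}(submK ml) addmC mcoeffMX.
apply: memN_msupp_eq0; rewrite (perm_mem (msuppMX _ _)); apply/mapP => -[m' _ E].
by rewrite E lem_addr in nml.
Qed.

Section Labelled.
Variables (k : fieldType) (r : nat) (X : finType).
Variables (sg : X -> X -> int) (lab : X -> 'X_{1..r}) (C : nat -> X -> Prop).
Local Notation S := {mpoly k[r]}.
Hypothesis lab_mono : forall G F, sg G F != 0 -> (lab G <= lab F)%MM.

Definition label_mx (F G : X) : S := 'X_[lab F - lab G] *~ sg G F.
Definition sign_mx (F G : X) : k := (sg G F)%:~R.
Definition cells_below (beta : 'X_{1..r}) (j : nat) (F : X) : Prop := C j F /\ (lab F <= beta)%MM.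

(** The component of multidegree [beta], as scalars: the basis element of [F] itself has degree
    [lab F]. *)
Definition degree_part (beta : 'X_{1..r}) (e : X -> S) (F : X) : k :=
  if (lab F <= beta)%MM then (e F)@_(beta - lab F) else 0.

Lemma bd_degree_part beta e G : (lab G <= beta)%MM ->
  (bd label_mx e G)@_(beta - lab G) = bd sign_mx (degree_part beta e) G.
Proof.
move=> Gb; rewrite /bd raddf_sum; apply: eq_bigr => F _ /=.
rewrite /label_mx /sign_mx /degree_part mulrzr mulrzAr raddfMz /=.
have [->|/lab_mono GF] := eqVneq (sg G F) 0; first by rewrite !mulr0z.
congr (_ *~ _); rewrite mcoeff_mulX.
have -> : (lab F - lab G <= beta - lab G)%MM = (lab F <= beta)%MM.
  apply/mnm_lepP/mnm_lepP => H i; have := H i; have := mnm_lepP GF i; have := mnm_lepP Gb i;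
  rewrite !mnmBE; lia.
case: ifP => // Fb; congr (_ @_ _); apply/mnmP => i; rewrite !mnmBE.
by have := mnm_lepP GF i; have := mnm_lepP Fb i; lia.
Qed.

Lemma bd_degree_part0 beta e G : ~~ (lab G <= beta)%MM ->
  bd sign_mx (degree_part beta e) G = 0.
Proof.
move=> nGb; apply: big1 => F _; rewrite /sign_mx /degree_part.
have [->|/lab_mono GF] := eqVneq (sg G F) 0; first by rewrite mulr0.
case: ifP => Fb; last by rewrite mul0r.
by rewrite (lepm_trans GF Fb) in nGb.
Qed.

Lemma supported_degree_part beta j e : supported C j e ->
  supported (cells_below beta) j (degree_part beta e).
Proof.
move=> se F; rewrite /degree_part; case: ifP => // Fb nz; split=> //.
by apply: se => eF; apply: nz; rewrite eF mcoeff0.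
Qed.

(** The chain over [S] is reassembled from scalar solutions in the finitely many multidegrees in
    which [c] is nonzero. *)
Lemma exact_degreewise j : (forall beta, exact_mod sign_mx (cells_below beta) (@zero_ideal k) j) ->
  exact_mod label_mx C (@zero_ideal S) j.
Proof.
move=> ex c sc c0.
(* The last clause selects the zero solution wherever [c] has no component, so that the sum over [B]
   misses nothing. *)
have /dep_choice[e he] : forall beta, exists e, [/\ supported (cells_below beta) j.+1 e,
    forall G, degree_part beta c G = bd sign_mx e G &
    (forall F, degree_part beta c F = 0) -> forall F, e F = 0].
  move=> beta; have [c00|nz] := classic (forall F, degree_part beta c F = 0).
    exists (fun=> 0); split=> // G; rewrite c00 /bd big1 // => F _; exact: mul0r.
  have [||e [se he]] := ex beta (degree_part beta c).
  - exact: supported_degree_part.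
  - move=> G; rewrite /zero_ideal; have [Gb|nGb] := boolP (lab G <= beta)%MM.
      by rewrite -bd_degree_part // c0 mcoeff0.
    exact: bd_degree_part0.
  exists e; split=> // G; apply/eqP; rewrite -subr_eq0; apply/eqP; exact: he.
pose B := undup (flatten [seq [seq (m + lab F)%MM | m <- msupp (c F)] | F <- enum X]).
have inB beta F : degree_part beta c F != 0 -> beta \in B.
  rewrite /degree_part; case: ifP => [Fb nz|]; last by rewrite eqxx.
  rewrite mem_undup; apply/flatten_mapP; exists F; first by rewrite mem_enum.
  by apply/mapP; exists (beta - lab F)%MM; rewrite ?mcoeff_msupp // submK.
pose E F : S := \sum_(beta <- B) e beta F *: 'X_[beta - lab F].
have partE beta : degree_part beta E =1 e beta.
  move=> F; have [se _ e0] := he beta; rewrite /degree_part; case: ifP => Fb; last first.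
    by apply/esym/eqP/negPn/negP => /eqP/se[_]; rewrite Fb.
  rewrite raddf_sum /=; have [bB|nB] := boolP (beta \in B).
    rewrite (bigD1_seq beta) ?undup_uniq //= mcoeffZ mcoeffX eqxx mulr1.
    rewrite big1 ?addr0 // => beta' nb; rewrite mcoeffZ mcoeffX.
    case: eqP => [E'|_]; last by rewrite mulr0.
    have [->|/eqP nz] := eqVneq (e beta' F) 0; first by rewrite mul0r.
    have [se' _ _] := he beta'; have [_ Fb'] := se' _ nz.
    by case/eqP: nb; rewrite -(submK Fb') E' submK.
  rewrite e0 => [|G]; last by apply/eqP; apply: contraNT nB => /inB.
  apply: big1_seq => beta' /andP[_ b'B]; rewrite mcoeffZ mcoeffX.
  case: eqP => [E'|_]; last by rewrite mulr0.
  have [->|/eqP nz] := eqVneq (e beta' F) 0; first by rewrite mul0r.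
  have [se' _ _] := he beta'; have [_ Fb'] := se' _ nz.
  by case/negP: nB; rewrite -(submK Fb) -E' submK.
exists E; split=> [F EF|G].
  have [beta] : exists beta, e beta F <> 0.
    apply: NNPP => nb; apply: EF; apply: big1 => beta _.
    have -> : e beta F = 0 by apply: NNPP => ne; apply: nb; exists beta.
    by rewrite scale0r.
  by have [se _ _] := he beta => /se[].
rewrite /zero_ideal; apply/eqP; rewrite subr_eq0; apply/eqP/mpolyP => m.
have Gb : (lab G <= m + lab G)%MM by rewrite lem_addl.
have [_ hE _] := he (m + lab G)%MM; have := hE G.
rewrite /degree_part Gb addmK => ->.
rewrite -[in RHS](addmK (lab G) m) bd_degree_part //; apply: eq_bigr => F _; congr (_ * _).
exact/esym/partE.
Qed.

(** A scalar cycle is homogenised by the monomials [x^(beta - lab F)]; the part of degree [beta] of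
    a solution over [S] then solves the scalar equation. *)
Lemma degreewise_exact beta j : exact_mod label_mx C (@zero_ideal S) j ->
  exact_mod sign_mx (cells_below beta) (@zero_ideal k) j.
Proof.
move=> ex c sc c0.
pose cS F : S := c F *: 'X_[beta - lab F].
have scS : supported C j cS.
  by move=> F cF; have [] : cells_below beta j F by apply: sc => c00; apply: cF; rewrite /cS c00 scale0r.
have part_cS : degree_part beta cS =1 c.
  move=> F; rewrite /degree_part; case: ifP => Fb.
    by rewrite mcoeffZ mcoeffX eqxx mulr1.
  by apply/esym/eqP/negPn/negP => /eqP/sc[_]; rewrite Fb.
have [G|e [se he]] := ex cS scS.
  apply/mpolyP => m; rewrite mcoeff0 /bd raddf_sum /=.
  have {}c0 := c0 G; rewrite /zero_ideal /bd in c0.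
  have [Em|nm] := eqVneq m (beta - lab G)%MM; last first.
    apply: big1 => F _; rewrite /cS /label_mx mulrzAr raddfMz -scalerAl /= mcoeffZ.
    have [->|/lab_mono GF] := eqVneq (sg G F) 0; first by rewrite mulr0z.
    have [->|/eqP/sc[_ Fb]] := eqVneq (c F) 0; first by rewrite mul0r mul0rz.
    rewrite -mpolyXD mcoeffX; case: eqP => [E|_]; last by rewrite mulr0 mul0rz.
    case/eqP: nm; rewrite -E; apply/mnmP => i; rewrite mnmDE !mnmBE.
    by have := mnm_lepP GF i; have := mnm_lepP Fb i; lia.
  rewrite -[RHS]c0; apply: eq_bigr => F _.
  rewrite /cS /label_mx /sign_mx mulrzAr raddfMz -scalerAl /= mcoeffZ mulrzr.
  have [->|/lab_mono GF] := eqVneq (sg G F) 0; first by rewrite !mulr0z.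
  have [->|/eqP/sc[_ Fb]] := eqVneq (c F) 0; first by rewrite mul0r.
  rewrite -mpolyXD mcoeffX; case: eqP => [_|[]]; first by rewrite mulr1.
  rewrite Em; apply/mnmP => i; rewrite mnmDE !mnmBE.
  by have := mnm_lepP GF i; have := mnm_lepP Fb i; lia.
exists (degree_part beta e); split; first exact: supported_degree_part.
move=> G; rewrite /zero_ideal; have [Gb|nGb] := boolP (lab G <= beta)%MM.
  have /eqP := he G; rewrite subr_eq0 => /eqP E.
  by rewrite -bd_degree_part // -E -part_cS /degree_part Gb subrr.
rewrite bd_degree_part0 // subr0; apply/eqP/negPn/negP => /eqP/sc[_].
by rewrite (negPf nGb).
Qed.

End Labelled.

Lemma face_label_le r n (a : 'I_n -> 'X_{1..r}) (F : {set 'I_n}) m :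
  (face_label a F <= m)%MM <-> (forall i, i \in F -> (a i <= m)%MM).
Proof.
rewrite /face_label; split=> [H i iF|H].
  apply: lepm_trans H; elim: (index_enum _) (mem_index_enum i) => // j s IH.
  rewrite inE big_cons => /predU1P[<-|/IH is_]; first by rewrite iF lem_mlcml.
  by case: ifP => // _; apply: lepm_trans is_ (lem_mlcmr _ _).
elim/big_ind: _ => // [|x y xm ym]; last by rewrite lem_mlcm xm.
by apply/mnm_lepP => i; rewrite mnm0E.
Qed.

Lemma face_labelS r n (a : 'I_n -> 'X_{1..r}) (F G : {set 'I_n}) :
  F \subset G -> (face_label a F <= face_label a G)%MM.
Proof.
move=> /subsetP FG; apply/face_label_le => i /FG iG.
by have /face_label_le := lepm_refl (face_label a G); apply.
Qed.

Lemma face_label0 r n (a : 'I_n -> 'X_{1..r}) : face_label a set0 = 0%MM.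
Proof. by rewrite /face_label big_set0. Qed.

Lemma face_label1 r n (a : 'I_n -> 'X_{1..r}) i : face_label a [set i] = a i.
Proof.
have le1 : (face_label a [set i] <= a i)%MM by apply/face_label_le => j /set1P->; apply: lepm_refl.
have le2 := proj1 (face_label_le a [set i] _) (lepm_refl _) i (set11 i).
by apply/mnmP => j; apply/eqP; rewrite eqn_leq (mnm_lepP le1) (mnm_lepP le2).
Qed.

(** * The cellular complex of a labelling *)

Section CellComplex.
Variables (k : fieldType) (r : nat) (R : realFieldType) (d n : nat) (p : 'I_n -> 'rV[R]_d).
Variables (sgn : {set 'I_n} -> {set 'I_n} -> int) (a : 'I_n -> 'X_{1..r}).
Hypothesis inc : incidence_function p sgn.
Local Notation S := {mpoly k[r]}.
Local Notation lab := (face_label a).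
Local Notation M := (label_mx k sgn lab).

Definition cells (j : nat) (F : {set 'I_n}) : Prop := is_face p F /\ hdeg p F = j.

Lemma sgn_lab_mono G F : sgn G F != 0 -> (lab G <= lab F)%MM.
Proof. by move=> /(incidence_facet inc)[_ _ GF _]; apply: face_labelS. Qed.

Lemma cell_diffE (c : {ffun {set 'I_n} -> S}) G : cell_diff sgn a c G = bd M c G.
Proof. by rewrite ffunE; apply: eq_bigr => F _; rewrite /label_mx mulrzAr. Qed.

Lemma cell_bd_degree j F G : cells j.+1 F -> M F G <> 0 -> cells j G.
Proof.
move=> [_ dF] nz; have /(incidence_facet inc)[fG _ _ dFG] : sgn G F != 0.
  by apply/eqP => s0; apply: nz; rewrite /label_mx s0 mulr0z.
by split=> //; move: dFG; rewrite dF => -[].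
Qed.

Lemma cell_bd_bd (e : {set 'I_n} -> S) G : bd M (bd M e) G = 0.
Proof.
rewrite /bd; under eq_bigr do rewrite mulr_suml.
rewrite exchange_big big1 //= => H _.
transitivity (e H * ('X_[lab H - lab G] *~ (\sum_F sgn G F * sgn F H))); last first.
  by rewrite (incidence_square inc) mulr0z mulr0.
rewrite mulrz_sumr mulr_sumr; apply: eq_bigr => F _; rewrite -mulrA; congr (_ * _).
rewrite /label_mx; have [->|sGF] := eqVneq (sgn G F) 0; first by rewrite mul0r !mulr0z mulr0.
have [->|sFH] := eqVneq (sgn F H) 0; first by rewrite mulr0 !mulr0z mul0r.
rewrite mulrzAl mulrzAr -mulrzA -mpolyXD mulrC; congr ('X_[_] *~ _); apply/mnmP => i.
rewrite mnmDE !mnmBE.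
by have := mnm_lepP (sgn_lab_mono sGF) i; have := mnm_lepP (sgn_lab_mono sFH) i; lia.
Qed.

Definition unit_chain (G : {set 'I_n}) : S := (G == set0)%:R.

Lemma supported_unit_chain : supported cells 0 unit_chain.
Proof.
move=> F; rewrite /unit_chain; case: eqP => // -> _.
by split; [apply: is_face0 | apply: hdeg0].
Qed.

Lemma supported0E u : supported cells 0 u -> forall G, u G = u set0 * unit_chain G.
Proof.
move=> su G; rewrite /unit_chain; have [->|G0] := eqVneq G set0; first by rewrite mulr1.
rewrite mulr0; apply/eqP/negPn/negP => /eqP/su[_ /hdeg_eq0 E].
by rewrite E eqxx in G0.
Qed.

Lemma bd_vertex m i G : (a i <= m)%MM ->
  bd M (fun F => if F == [set i] then 'X_[m - a i] else 0) G = 'X_[m] * unit_chain G.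
Proof.
move=> am; rewrite /bd (bigD1 [set i]) //= eqxx big1 ?addr0 => [|F /negPf->]; last by rewrite mul0r.
rewrite /label_mx /unit_chain; have [->|G0] := eqVneq G set0.
  have [_ _ -> _] := inc; rewrite face_label0 face_label1 mulr1 mulr1z -mpolyXD.
  by rewrite subm0 submK.
have [->|/(incidence_facet inc)[_ _ _ dG]] := eqVneq (sgn G [set i]) 0; first by rewrite !mulr0.
have [_ _ _] := incidence_vertex inc i; rewrite dG hdeg0 => -[/hdeg_eq0 E].
by rewrite E eqxx in G0.
Qed.

Lemma supported_vertex i (x : S) :
  supported cells 1 (fun F => if F == [set i] then x else 0).
Proof.
move=> F; case: eqP => // -> _; have [_ fi _ di] := incidence_vertex inc i.
by split=> //; rewrite di hdeg0.
Qed.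

Lemma bd_supported1_ideal e : supported cells 1 e -> monomial_ideal a (bd M e set0).
Proof.
have hI := monomial_ideal_ideal k a.
move=> se; apply: (ideal_sum hI) => F _.
have [->|/eqP/se[_ dF]] := eqVneq (e F) 0; first by rewrite mul0r; apply: ideal0.
apply: (idealM hI); rewrite /label_mx face_label0 subm0 -mulrzl; apply: (idealM hI).
have /set0Pn[i iF] : F != set0 by apply: contra_eq_neq dF => ->; rewrite hdeg0.
by apply: (@monomial_ideal_X _ _ _ _ i); have /face_label_le := lepm_refl (lab F); apply.
Qed.

Lemma cell_augmentation J f : is_ideal J ->
  bounds_mod M cells J 0 (fun G => f * unit_chain G) <->
  exists y, monomial_ideal a y /\ J (f - y).
Proof.
move=> hJ; split=> [[e [se he]]|[_ [[g ->] Jf]]].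
  exists (bd M e set0); split; first exact: bd_supported1_ideal.
  by have := he set0; rewrite /unit_chain eqxx mulr1.
(* The chain with coefficient [g i] at vertex [i]; ['X_[0]] stands for 1 to match [bd_vertex] at
   [m = a i]. *)
exists (fun F => \sum_i (g i * if F == [set i] then 'X_[0] else 0)); split.
  move=> F nz; have [i] : exists i, F = [set i].
    apply: NNPP => ni; apply: nz; apply: big1 => i _; case: eqP => [E|_]; last exact: mulr0.
    by case: ni; exists i.
  by move=> E; apply: (@supported_vertex i 1); rewrite E eqxx; apply/eqP/oner_neq0.
move=> G; rewrite [bd _ _ _](_ : _ = (\sum_i g i * 'X_[a i]) * unit_chain G).
  by rewrite -mulrBl; apply: ideal_mulr.
rewrite /bd; under eq_bigr do rewrite mulr_suml.
rewrite exchange_big mulr_suml; apply: eq_bigr => i _.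
rewrite -mulrA -(bd_vertex G (lepm_refl (a i))) mulr_sumr; apply: eq_bigr => F _.
rewrite -mulrA; congr (_ * (_ * _)); case: eqP => // _; congr 'X_[_].
by apply/mnmP => j; rewrite mnmBE mnm0E subnn.
Qed.

(** The augmentation and the vanishing of squares hold for every labelling, which leaves exactness
    in positive degrees. *)
Lemma free_resolutionP : is_free_resolution k p sgn a <->
  forall j, exact_mod M cells (@zero_ideal S) j.+1.
Proof.
split=> [[_ H] j c sc c0|H].
  have [||e [se Ee]] := proj1 (H j [ffun F => c F] _) _.
  - by move=> F; rewrite ffunE; apply: sc.
  - apply/ffunP => G; rewrite cell_diffE ffunE -[RHS](c0 G).
    by apply: eq_bigr => F _; rewrite ffunE.
  exists e; split=> // G; rewrite /zero_ideal -cell_diffE Ee ffunE; exact: subrr.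
have conv j (c : {ffun {set 'I_n} -> S}) :
    bounds_mod M cells (@zero_ideal S) j c <-> exists e, is_chain p j.+1 e /\ cell_diff sgn a e = c.
  split=> [[e [se he]]|[e [se <-]]].
    exists [ffun F => e F]; split=> [F|]; first by rewrite ffunE; apply: se.
    apply/ffunP => G; rewrite cell_diffE; apply/esym/eqP; rewrite -subr_eq0; apply/eqP.
    by rewrite -[RHS](he G); congr (_ - _); apply: eq_bigr => F _; rewrite ffunE.
  by exists e; split=> // G; rewrite cell_diffE; exact: subrr.
split=> [c sc|j c sc].
  rewrite -conv; have Ec G := supported0E sc G.
  have [A B] := cell_augmentation (c set0) (@zero_idealP S).
  split=> [Ic|[e [se he]]].
    have [|e [se he]] := B; first by exists (c set0); split=> //; exact: subrr.
    by exists e; split=> // G; rewrite Ec.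
  have [|y [Iy /eqP]] := A; first by exists e; split=> // G; rewrite -Ec.
  by rewrite subr_eq0 => /eqP->.
rewrite -conv; split=> [c0|[e [se he]]].
  by apply: H => // G; rewrite -cell_diffE c0 ffunE.
apply/ffunP => G; rewrite cell_diffE ffunE -[RHS](cell_bd_bd e G); apply: eq_bigr => F _.
by congr (_ * _); apply/eqP; rewrite -subr_eq0; apply/eqP/he.
Qed.

(** An entry of the differential is a sign times a monomial, and this monomial is 1 exactly when the
    two labels agree; the sign is nonzero in every characteristic. *)
Lemma minimal_complexP : is_minimal_complex k p sgn a <->
  forall G F, sgn G F != 0 -> lab F <> lab G.
Proof.
split=> [H G F sGF E|H j c sc G].
  have [_ fF _ _] := incidence_facet inc sGF.
  have ch : is_chain p (hdeg p F) [ffun F' => if F' == F then 1 else 0 : S].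
    by move=> F'; rewrite ffunE; case: eqP => // ->.
  have := H _ _ ch G; rewrite cell_diffE /bd (bigD1 F) //= ffunE eqxx big1 ?addr0; last first.
    by move=> F' /negPf nF; rewrite ffunE nF mul0r.
  rewrite mul1r /label_mx E raddfMz /= mcoeffX.
  have -> : (lab G - lab G)%MM = 0%MM by apply/mnmP => i; rewrite mnmBE mnm0E subnn.
  by move/eqP; apply/negP; rewrite eqxx; exact: (incidence_unit inc k sGF).
rewrite cell_diffE /bd raddf_sum big1 // => F _; rewrite /label_mx mulrzAr raddfMz /=.
have [->|sGF] := eqVneq (sgn G F) 0; first by rewrite mulr0z.
rewrite mcoeff_mulX; case: ifP => [le0|_]; last by rewrite mul0rz.
case: (H G F sGF); apply/mnmP => i.
have := mnm_lepP le0 i; rewrite mnmBE mnm0E; have := mnm_lepP (sgn_lab_mono sGF) i; lia.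
Qed.

End CellComplex.

(** Acyclicity over [k] of the faces whose label divides [x^beta]. Degree 0 is excluded: when only
    the empty face remains, it does not bound. *)
Definition exact_cells (k : fieldType) (R : realFieldType) (d n : nat) (p : 'I_n -> 'rV[R]_d)
    (r : nat) sgn (a : 'I_n -> 'X_{1..r}) : Prop :=
  forall beta j, exact_mod (sign_mx k sgn) (cells_below (face_label a) (cells p) beta)
    (@zero_ideal k) j.+1.

(** The form in which labellings are handled from here on: [cm_criterion] restores
    Cohen-Macaulayness, since no face has homological degree above that of the polytope. *)
Theorem CM_labellingP (k : fieldType) (R : realFieldType) (d n : nat) (p : 'I_n -> 'rV[R]_d)
    (r : nat) (a : 'I_n -> 'X_{1..r}) :
  CM_labelling k p a <->
  [/\ forall i j, i != j -> ~~ (a i <= a j)%MM,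
      min_cover a (hdeg p setT) &
      exists sgn, [/\ incidence_function p sgn, exact_cells k p sgn a &
        forall G F, sgn G F != 0 -> face_label a F <> face_label a G]].
Proof.
split=> [[anti _ /codim_monomial cov [sgn [inc /(free_resolutionP k a inc) res]]]|].
  move=> /(minimal_complexP k a inc) min; split=> //; exists sgn; split=> // beta j.
  by apply: degreewise_exact (res j); apply: sgn_lab_mono inc.
move=> [anti cov [sgn [inc ex min]]].
have res j : exact_mod (label_mx k sgn (face_label a)) (cells p) (@zero_ideal {mpoly k[r]}) j.+1.
  by apply: exact_degreewise => [|beta]; [apply: sgn_lab_mono inc | apply: ex].
split=> //; first last.
- by exists sgn; split=> //; [apply/(free_resolutionP k a inc) | apply/(minimal_complexP k a inc)].
- exact/codim_monomial.
apply: (@cm_criterion k r n (hdeg p setT) a {set 'I_n} (label_mx k sgn (face_label a)) (cells p)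
  (@unit_chain k r n)) => //.
- exact: cell_bd_degree inc.
- exact: cell_bd_bd inc.
- by move=> F [_ dF]; have := hdegS p (subsetT F); rewrite dF ltnn.
- exact: supported_unit_chain.
- by move=> u su; exists (u set0); apply: supported0E su.
- by move=> J hJ f; apply: cell_augmentation.
Qed.

(** * The labelling of the pyramid *)

Lemma lem_antisym r (m m' : 'X_{1..r}) : (m <= m')%MM -> (m' <= m)%MM -> m = m'.
Proof.
by move=> le1 le2; apply/mnmP => j; apply/eqP; rewrite eqn_leq (mnm_lepP le1) (mnm_lepP le2).
Qed.

Lemma face_label_vertex r n (a : 'I_n -> 'X_{1..r}) (F : {set 'I_n}) i :
  i \in F -> (a i <= face_label a F)%MM.
Proof. exact: (proj1 (face_label_le a F _) (lepm_refl _) i). Qed.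

Lemma mnmwiden_lift r (m : 'X_{1..r}) j : mnmwiden m (lift ord_max j) = m j.
Proof.
have -> : lift ord_max j = widen_ord (leqnSn r) j.
  by apply/val_inj; rewrite /= /bump leqNgt ltn_ord.
exact: mnmwiden_widen.
Qed.

Lemma lem_lift r (m m' : 'X_{1..r.+1}) :
  (forall j : 'I_r, (m (lift ord_max j) <= m' (lift ord_max j))%N) ->
  (m ord_max <= m' ord_max)%N -> (m <= m')%MM.
Proof. by move=> H1 H2; apply/mnm_lepP => i; case: (unliftP ord_max i) => [j ->|->]. Qed.

Lemma card_up v b (G : {set 'I_v}) : #|up b G| = (#|G| + b)%N.
Proof.
have E : up false G = lift ord_max @: G.
  apply/setP => i; case: (unliftP ord_max i) => [j ->|->].
    by rewrite in_up_lift mem_imset //; apply: lift_inj.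
  rewrite in_up_max; apply/esym/negbTE/imsetP => -[j _] /eqP.
  by rewrite (negPf (neq_lift _ _)).
have cf : #|up false G| = #|G| by rewrite E card_imset //; apply: lift_inj.
case: b; last by rewrite addn0.
rewrite (cardsD1 ord_max) in_up_max addnC -cf; congr (#|pred_of_set _| + _)%N.
apply/setP => i; case: (unliftP ord_max i) => [j ->|->].
  by rewrite in_setD1 !in_up_lift eq_sym neq_lift.
by rewrite in_setD1 eqxx !in_up_max.
Qed.

Section PyramidLabel.
Variables (r v : nat) (a : 'I_v -> 'X_{1..r}).
Local Notation pa := (pyramid_label a).

Lemma pyramid_label_lift i : pa (lift ord_max i) = mnmwiden (a i).
Proof. by rewrite /pyramid_label liftK. Qed.

Lemma pyramid_label_max : pa ord_max = U_(ord_max)%MM.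
Proof. by rewrite /pyramid_label unlift_none. Qed.

Lemma face_label_up b G :
  face_label pa (up b G) = [multinom oapp (face_label a G) (b : nat) (unlift ord_max l) | l < r.+1].
Proof.
apply: lem_antisym.
  apply/face_label_le => i; case: (unliftP ord_max i) => [j ->|->].
    rewrite in_up_lift pyramid_label_lift => /(face_label_vertex a) jG; apply: lem_lift => [l|].
      by rewrite mnmwiden_lift mnmE liftK; apply: (mnm_lepP jG).
    by rewrite mnmwiden_ordmax.
  rewrite in_up_max pyramid_label_max => ->; apply: lem_lift => [l|].
    by rewrite mnm1E (negPf (neq_lift _ _)).
  by rewrite mnm1E eqxx mnmE unlift_none.
apply: lem_lift => [l|]; rewrite mnmE ?liftK ?unlift_none /=.
  have : (face_label a G <= [multinom face_label pa (up b G) (lift ord_max j) | j < r])%MM.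
    apply/face_label_le => i iG; apply/mnm_lepP => j; rewrite mnmE -mnmwiden_lift -pyramid_label_lift.
    by apply/mnm_lepP/face_label_vertex; rewrite in_up_lift.
  by move/mnm_lepP/(_ l); rewrite mnmE.
case: b => //; have : (pa ord_max <= face_label pa (up true G))%MM.
  by apply: face_label_vertex; rewrite in_up_max.
by move/mnm_lepP/(_ ord_max); rewrite pyramid_label_max mnm1E eqxx.
Qed.

Definition base_degree (beta : 'X_{1..r.+1}) : 'X_{1..r} := [multinom beta (lift ord_max j) | j < r].

Lemma face_label_up_le b G beta :
  (face_label pa (up b G) <= beta)%MM = (face_label a G <= base_degree beta)%MM && (b <= beta ord_max)%N.
Proof.
rewrite face_label_up; apply/idP/andP => [/mnm_lepP H|[/mnm_lepP H1 H2]].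
  split; last by have := H ord_max; rewrite mnmE unlift_none.
  by apply/mnm_lepP => j; rewrite mnmE; have := H (lift ord_max j); rewrite mnmE liftK.
apply: lem_lift => [j|]; rewrite mnmE ?liftK ?unlift_none //=.
by have := H1 j; rewrite mnmE.
Qed.

(** The label of the apex is the single variable [y], absent from the other labels, so every cover
    consists of [y] and a cover for the base. *)
Lemma min_cover_pyramid c : min_cover a c -> min_cover pa c.+1.
Proof.
move=> [[T [cT <-]] H]; split.
  exists (up true T); split; last by rewrite card_up addn1.
  move=> i; case: (unliftP ord_max i) => [j ->|->].
    have [l [lT al]] := cT j; exists (lift ord_max l).
    by rewrite in_up_lift pyramid_label_lift mnmwiden_lift.
  by exists ord_max; rewrite in_up_max pyramid_label_max mnm1E eqxx.
move=> T' cT'; rewrite -(up_base T').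
have -> : ord_max \in T'.
  have [l [lT']] := cT' ord_max; rewrite pyramid_label_max mnm1E.
  by have [->|] := eqVneq ord_max l.
rewrite card_up addn1 ltnS; apply: H => i.
have [l [lT' ]] := cT' (lift ord_max i); rewrite pyramid_label_lift.
case: (unliftP ord_max l) lT' => [j ->|-> _]; last by rewrite mnmwiden_ordmax.
by rewrite mnmwiden_lift => lT'; exists j; rewrite inE.
Qed.

(** The label 1 must be excluded because it would divide [y]; [covers_nonzero] excludes it in a
    labelling. *)
Lemma pyramid_label_antichain : (forall i, a i <> 0%MM) ->
  (forall i j, i != j -> ~~ (a i <= a j)%MM) ->
  forall i j, i != j -> ~~ (pa i <= pa j)%MM.
Proof.
move=> a0 anti i j; case: (unliftP ord_max i) => [i' ->|->]; case: (unliftP ord_max j) => [j' ->|->].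
- rewrite (inj_eq lift_inj) => /anti; apply: contra; rewrite !pyramid_label_lift => /mnm_lepP H.
  by apply/mnm_lepP => l; have := H (lift ord_max l); rewrite !mnmwiden_lift.
- move=> _; rewrite pyramid_label_lift pyramid_label_max; apply/negP => /mnm_lepP H.
  case: (a0 i'); apply/mnmP => l; have := H (lift ord_max l).
  by rewrite mnmwiden_lift mnm1E (negPf (neq_lift _ _)) leqn0 mnm0E => /eqP.
- move=> _; rewrite pyramid_label_lift pyramid_label_max; apply/negP => /mnm_lepP /(_ ord_max).
  by rewrite mnm1E eqxx mnmwiden_ordmax.
- by rewrite eqxx.
Qed.

End PyramidLabel.

Lemma covers_nonzero r n (a : 'I_n -> 'X_{1..r}) T i : covers a T -> a i <> 0%MM.
Proof. by move=> /(_ i)[j [_ aij]] E; apply: aij; rewrite E mnm0E. Qed.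

Section PyramidExact.
Variables (k : fieldType) (R : realFieldType) (d v : nat) (p : 'I_v -> 'rV[R]_d) (t : 'rV[R]_d).
Hypothesis ht : ~ in_aff p t.
Local Notation q := (pyramid p t).
Variables (r : nat) (a : 'I_v -> 'X_{1..r}) (sgn : {set 'I_v} -> {set 'I_v} -> int).
Hypothesis inc : incidence_function p sgn.
Local Notation pa := (pyramid_label a).
Local Notation sg' := (sgn_pyramid p sgn).
Local Notation Mk := (sign_mx k sgn).
Local Notation Mk' := (sign_mx k sg').

Lemma cells_below_up beta j (b : bool) G :
  cells_below (face_label pa) (cells q) beta (j + b) (up b G) <->
  cells_below (face_label a) (cells p) (base_degree beta) j G /\ (b <= beta ord_max)%N.
Proof.
rewrite /cells_below /cells face_label_up_le (hdeg_up ht); have fG := is_face_up ht b G.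
split=> [[[/fG f /addIn dG] /andP[]] //|[[[/fG f <-] l] bb]].
by split; [split | apply/andP].
Qed.

Lemma cells_below_up_false beta j G :
  cells_below (face_label pa) (cells q) beta j (up false G) <->
  cells_below (face_label a) (cells p) (base_degree beta) j G.
Proof. by have := cells_below_up beta j false G; rewrite addn0 => ->; split=> [[]|]. Qed.

Lemma cells_below_up_true beta j G :
  cells_below (face_label pa) (cells q) beta j.+1 (up true G) <->
  cells_below (face_label a) (cells p) (base_degree beta) j G /\ (0 < beta ord_max)%N.
Proof. by have := cells_below_up beta j true G; rewrite addn1. Qed.

Lemma bd_up_false (c : {set 'I_v.+1} -> k) G : bd Mk' c (up false G) =
  bd Mk (fun F => c (up false F)) G +
  (if excluded_middle_informative (is_face p G) then (-1) ^+ hdeg p G * c (up true G) else 0).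
Proof.
rewrite {1}/bd big_up; congr (_ + _).
  by apply: eq_bigr => F _; rewrite /sign_mx sgn_pyramid_same.
rewrite (bigD1 G) //= big1 ?addr0 => [|F /eqP FG]; last first.
  by rewrite /sign_mx sgn_pyramid_up0 ?mulr0 //; left => E; apply: FG.
case: excluded_middle_informative => fG; rewrite /sign_mx; last first.
  by rewrite sgn_pyramid_up0 ?mulr0 //; right.
by rewrite sgn_pyramid_cone // rmorphXn rmorphN1 mulrC.
Qed.

Lemma bd_up_true (c : {set 'I_v.+1} -> k) G : bd Mk' c (up true G) =
  bd Mk (fun F => c (up true F)) G.
Proof.
rewrite {1}/bd big_up big1 ?add0r => [|F _]; last by rewrite /sign_mx sgn_pyramid_down mulr0.
by apply: eq_bigr => F _; rewrite /sign_mx sgn_pyramid_same.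
Qed.

Lemma exact_pyramid : exact_cells k p sgn a -> exact_cells k q sg' pa.
Proof.
move=> ex beta j c sc c0.
(* In a degree free of [y] no face contains the apex, and the complex is that of the base. *)
have [bmax|bmax] := posnP (beta ord_max).
  have cT G : c (up true G) = 0.
    apply/eqP/negPn/negP => /eqP/sc/cells_below_up_true[_].
    by rewrite bmax.
  have [||e [se he]] := ex (base_degree beta) j (fun G => c (up false G)).
  - by move=> G /sc/cells_below_up_false.
  - move=> G; have := c0 (up false G); rewrite bd_up_false cT mulr0.
    by case: excluded_middle_informative => ? /=; rewrite addr0.
  exists (fun F : {set 'I_v.+1} => if ord_max \in F then 0 else e (base F)); split=> [F|F].
    rewrite -(up_base F); case: (_ \in F); rewrite in_up_max // base_up => /se H.
    exact/cells_below_up_false.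
  rewrite -(up_base F); case: (_ \in F).
    rewrite cT bd_up_true /bd big1 ?subrr => [|G _]; last by rewrite in_up_max mul0r.
    by [].
  rewrite bd_up_false in_up_max mulr0; have := he (base F).
  have -> : bd Mk (fun F0 => if ord_max \in up false F0 then 0 else e (base (up false F0))) (base F)
     = bd Mk e (base F) by apply: eq_bigr => G _; rewrite in_up_max base_up.
  by case: excluded_middle_informative => ? /=; rewrite addr0.
(* The contracting homotopy of the cone: each base face goes to the cone over it, with the sign of
   [sgn_pyramid]. *)
exists (fun F : {set 'I_v.+1} => if ord_max \in F then (-1) ^+ hdeg p (base F) * c (up false (base F)) else 0).
split=> [F|F].
  rewrite -(up_base F); case: (_ \in F); rewrite in_up_max // base_up => nz.
  have /sc : c (up false (base F)) <> 0 by move=> E; apply: nz; rewrite E mulr0.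
  by move=> /cells_below_up_false H; apply/cells_below_up_true.
have Es G : bd Mk (fun F => (-1) ^+ hdeg p F * c (up false F)) G =
    - (-1) ^+ hdeg p G * bd Mk (fun F => c (up false F)) G.
  rewrite /bd mulr_sumr; apply: eq_bigr => H _; rewrite /sign_mx.
  have [->|/(incidence_facet inc)[_ _ _ ->]] := eqVneq (sgn G H) 0; first by rewrite !mulr0.
  by rewrite exprS mulN1r mulrA.
rewrite -(up_base F); move: (base F) (_ \in F) => G [].
  rewrite bd_up_true.
  have -> : bd Mk (fun F0 => if ord_max \in up true F0
       then (-1) ^+ hdeg p (base (up true F0)) * c (up false (base (up true F0))) else 0) G
     = - (-1) ^+ hdeg p G * bd Mk (fun F => c (up false F)) G.
    by rewrite -Es; apply: eq_bigr => H _; rewrite in_up_max base_up.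
  have := c0 (up false G); rewrite bd_up_false; case: excluded_middle_informative => fG.
    move/eqP; rewrite addr_eq0 => /eqP->.
    by rewrite mulrNN mulrA -exprMn mulrNN mulr1 expr1n mul1r; exact: subrr.
  rewrite addr0 => ->; rewrite mulr0 subr0; apply/eqP/negPn/negP => /eqP/sc[[/(is_face_up ht) f] _] _.
  exact: fG.
rewrite bd_up_false in_up_max base_up.
rewrite /bd big1 ?add0r => [|H _]; last by rewrite in_up_max mul0r.
case: excluded_middle_informative => fG.
  by rewrite mulrA -exprMn mulrNN mulr1 expr1n mul1r; exact: subrr.
rewrite subr0; apply/eqP/negPn/negP => /eqP/sc[[/(is_face_up ht) f] _] _; exact: fG.
Qed.

End PyramidExact.

Theorem pyramid_CM (k : fieldType) (R : realFieldType) (d v : nat) (p : 'I_v -> 'rV[R]_d)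
    (t : 'rV[R]_d) (ht : ~ in_aff p t) (r : nat) (a : 'I_v -> 'X_{1..r}) :
  CM_labelling k p a -> CM_labelling k (pyramid p t) (pyramid_label a).
Proof.
move=> /CM_labellingP[anti cov [sgn [inc ex min]]]; apply/CM_labellingP; split.
- have [[T [cT _]] _] := cov.
  by apply: pyramid_label_antichain => // i; apply: covers_nonzero cT.
- by rewrite -upT (hdeg_up ht) addn1; apply: min_cover_pyramid.
exists (sgn_pyramid p sgn); split; [exact: incidence_pyramid | exact: exact_pyramid |].
move=> G F; rewrite -(up_base G) -(up_base F).
move: (base G) (base F) (_ \in G) (_ \in F) => {}G {}F b b' nz E.
have EL l : face_label a F l = face_label a G l.
  by have := congr1 (fun m : 'X_{1..r.+1} => m (lift ord_max l)) E; rewrite !face_label_up !mnmE liftK.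
have Eb : b = b'.
  have := congr1 (fun m : 'X_{1..r.+1} => m ord_max) E.
  by rewrite !face_label_up !mnmE unlift_none /=; case: b b' {nz E} => [] [].
move: nz; rewrite Eb sgn_pyramid_same => /min; apply; exact/mnmP.
Qed.

(** * The label of the apex *)

Lemma regular_variables (k : fieldType) r (s : seq 'I_r) : uniq s ->
  regular_list (@zero_ideal {mpoly k[r]}) [seq 'X_j | j <- s].
Proof.
elim/last_ind: s => // s i IH; rewrite rcons_uniq map_rcons => /andP[is_ us].
apply/regular_list_rcons; split; first exact: IH.
pose T := [set j in s]; have [idT _ primeT] := var_ideal_prime k T.
have E : ideal_eq (var_ideal T) (ideal_list (@zero_ideal {mpoly k[r]}) [seq 'X_j | j <- s]).
  have hL := ideal_list_ideal [seq 'X_j | j <- s] (@zero_idealP {mpoly k[r]}).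
  move=> f; split; move: f.
    apply: var_ideal_min => // j; rewrite inE => js.
    by apply: ideal_list_mem (@zero_idealP _) _; apply: map_f.
  apply: ideal_list_min => // [x ->|_ /mapP[j js ->]]; first exact: ideal0.
  by rewrite /var_ideal kill_varsX inE js.
apply: regular_mod_eq E _ => f /primeT[|//].
rewrite /var_ideal kill_varsX inE (negPf is_) => /eqP.
by rewrite -msupp_eq0 msuppX.
Qed.

Lemma exact_mod_eq (A : comNzRingType) (X : finType) (M : X -> X -> A) C C' J j :
  (forall i F, C i F <-> C' i F) -> exact_mod M C J j -> exact_mod M C' J j.
Proof.
move=> E ex c sc c0; have [|e [se he]] := ex c _ c0; first by move=> F /sc/E.
by exists e; split=> // F /se/E.
Qed.

Section ApexCoprime.
Variables (k : fieldType) (R : realFieldType) (d n : nat) (q : 'I_n -> 'rV[R]_d).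
Variables (r : nat) (b : 'I_n -> 'X_{1..r}) (sgn : {set 'I_n} -> {set 'I_n} -> int).
Hypothesis inc : incidence_function q sgn.
Hypothesis ex : exact_cells k q sgn b.
Variable z : 'I_r.
Local Notation S := {mpoly k[r]}.
Local Notation lab := (face_label b).

Definition free_of : {set 'I_n} := [set i | b i z == 0%N].
Local Notation Y := free_of.
Definition cells_free (j : nat) (F : {set 'I_n}) : Prop := cells q j F /\ F \subset Y.

(** Lowering the exponent of [z] in the degree to 0 selects the faces in [Y], whose complex
    therefore inherits exactness. *)
Lemma cells_free_below (beta : 'X_{1..r}) j F :
  cells_below lab (cells q) [multinom if l == z then 0%N else beta l | l < r] j F <->
  cells_below lab cells_free beta j F.
Proof.
have E : (lab F <= [multinom if l == z then 0%N else beta l | l < r])%MM <->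
    (F \subset Y /\ (lab F <= beta)%MM).
  split=> [/face_label_le H|[/subsetP FY /face_label_le H]].
    split; first by apply/subsetP => i /H /mnm_lepP/(_ z); rewrite mnmE eqxx leqn0 inE.
    apply/face_label_le => i /H /mnm_lepP Hi; apply/mnm_lepP => l; have := Hi l.
    by rewrite mnmE; case: eqP => // _ /leq_trans; apply.
  apply/face_label_le => i iF; apply/mnm_lepP => l; rewrite mnmE; case: eqP => [->|_].
    by have := FY i iF; rewrite inE => /eqP->.
  exact: (mnm_lepP (H i iF)).
by split=> [[cF /E[FY Fb]]|[[cF FY] Fb]]; split=> //; apply/E.
Qed.

Lemma exact_free j : exact_mod (label_mx k sgn lab) cells_free (@zero_ideal S) j.+1.
Proof.
apply: exact_degreewise => [|beta]; first exact: sgn_lab_mono inc.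
pose beta0 := [multinom if l == z then 0%N else beta l | l < r].
apply: (@exact_mod_eq _ _ _ (cells_below lab (cells q) beta0)); last exact: ex.
by move=> i F; apply: cells_free_below.
Qed.

Definition covers_free (T : {set 'I_r}) : bool :=
  [forall i in Y, [exists j in T, b i j != 0%N]].

Lemma covers_freeP (T : {set 'I_r}) :
  reflect (forall i, i \in Y -> exists j, j \in T /\ b i j <> 0%N) (covers_free T).
Proof.
apply: (iffP forall_inP) => H i /H; first by case/exists_inP => j jT /eqP bij; exists j.
by case=> j [jT /eqP bij]; apply/exists_inP; exists j.
Qed.

(** [u] represents a socle element, once the variables outside [T] are inverted, of the quotient by
    the labels in [Y]. Minimality of [T] is what makes this quotient have finite length. *)
Lemma socle_monomial (T : {set 'I_r}) : minset covers_free T ->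
  exists u : 'X_{1..r}, (forall i, i \in Y -> ~~ (b i <= u)%MM) /\
    forall j, j \in T -> exists i, i \in Y /\ (b i <= u + U_(j))%MM.
Proof.
move=> /minsetP[/covers_freeP cT minT].
pose N := (\sum_i mdeg (b i))%N.
have bN i l : (b i l <= N)%N.
  by rewrite /N (bigD1 i) //= mdegE (bigD1 l) //= -addnA leq_addr.
(* An exponent [N] dominates all labels, so fixing it outside [T] amounts to inverting those
   variables; the bound makes a choice of maximal degree possible. *)
pose good (u : 'X_{1..r}) := [/\ forall l, (u l <= N)%N, forall l, l \notin T -> u l = N &
  forall i, i \in Y -> ~~ (b i <= u)%MM].
pose P m := if excluded_middle_informative (exists u, good u /\ mdeg u = m) then true else false.
have PP m : reflect (exists u, good u /\ mdeg u = m) (P m).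
  by rewrite /P; case: excluded_middle_informative => H; constructor.
have exP : exists m, P m.
  pose u0 := [multinom if l \in T then 0%N else N | l < r].
  exists (mdeg u0); apply/PP; exists u0; split=> //; split=> [l|l /negPf nl|i iY].
  - by rewrite mnmE; case: ifP.
  - by rewrite mnmE nl.
  - have [j [jT bij]] := cT i iY; apply/negP => /mnm_lepP/(_ j).
    by rewrite mnmE jT leqn0 => /eqP.
have boundP m : P m -> (m <= r * N)%N.
  move=> /PP[u [[uN _ _] <-]]; rewrite mdegE -[r in (r * N)%N]card_ord -sum_nat_const.
  exact: leq_sum.
have [m /PP[u [[uN uT uY] <-]] maxm] := ex_maxnP exP boundP.
exists u; split=> // j jT; apply: NNPP => nij.
have nI i : i \in Y -> ~~ (b i <= u + U_(j))%MM.
  by move=> iY; apply/negP => le; apply: nij; exists i.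
have [ujN|] := ltnP (u j) N.
  have : P (mdeg (u + U_(j))).
    apply/PP; exists (u + U_(j))%MM; split=> //; split=> // l.
      by rewrite mnmDE mnm1E; case: eqP => [<-|_]; rewrite ?addn1 ?addn0.
    move=> lT; rewrite mnmDE mnm1E; case: eqP => [E|_]; last by rewrite addn0 uT.
    by rewrite -E jT in lT.
  by move/maxm; rewrite mdegD mdeg1 addn1 ltnn.
move=> Nuj.
(* Here the bound prevents raising [u] at [j]. Minimality of [T] gives a label that meets [T] in [j]
   alone; as [u] has exponent at least [N] at [j] and outside [T], that label divides [u], a
   contradiction. *)
have [i [iY hi]] : exists i, i \in Y /\ forall l, l \in T -> b i l <> 0%N -> l = j.
  apply: NNPP => ni; have Tj : covers_free (T :\ j).
    apply/covers_freeP => i iY; apply: NNPP => nl; apply: ni; exists i; split=> // l lT bil.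
    by apply/eqP/negPn/negP => lj; apply: nl; exists l; rewrite in_setD1 lj.
  by have := minT _ Tj (subD1set _ _) => E; move: jT; rewrite -E setD11.
case/negP: (uY i iY); apply/mnm_lepP => l; have [lT|/uT->//] := boolP (l \in T).
have [->//|/eqP/(hi l lT)->] := eqVneq (b i l) 0%N.
exact: leq_trans (bN i j) Nuj.
Qed.

(* The length of a resolution is at least the codimension. *)
Lemma free_face_exists (T : {set 'I_r}) : minset covers_free T -> exists F, cells_free #|T| F.
Proof.
move=> minT; apply: NNPP => noF; have [u [uY uT]] := socle_monomial minT.
pose hs : seq S := [seq 'X_j | j <- enum T].
have shs : size hs = #|T| by rewrite size_map -cardE.
pose M := label_mx k sgn lab.
(* The variables of [T] kill the class of [u] in degree 0. Without cells in degree [#|T|] that class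
   would vanish, placing [u] in the ideal of the labels in [Y]. *)
have [||||||||e [se he]] := @acyclicity S {set 'I_n} M cells_free _ _ hs (@zero_ideal S) 0
    (fun G => 'X_[u] * unit_chain k r G).
- move=> j F G [cF FY] nz; have cG := cell_bd_degree inc cF nz; split=> //.
  apply: subset_trans FY; have : sgn G F != 0 by apply/eqP => s0; apply: nz; rewrite /M /label_mx s0 mulr0z.
  by case/(incidence_facet inc).
- exact: cell_bd_bd inc.
- exact: zero_idealP.
- by apply: regular_variables; apply: enum_uniq.
- by rewrite add0n shs => F cF; apply: noF; exists F.
- by case=> // i _; apply: exact_free.
- move=> F; rewrite /unit_chain; case: eqP => [-> _|_]; last by rewrite mulr0.
  by split; [split; [apply: is_face0 | apply: hdeg0] | apply: sub0set].
- move=> _ /mapP[j jT ->]; rewrite mem_enum in jT; have [i [iY le]] := uT j jT.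
  exists (fun F => if F == [set i] then 'X_[(u + U_(j)) - b i] else 0); split=> [F nz|G].
    split; first exact: (supported_vertex inc) nz.
    by move: nz; case: eqP => // -> _; rewrite sub1set.
  rewrite /M (bd_vertex k inc G le) /zero_ideal mpolyXD mulrA [_ * 'X_[u]]mulrC.
  exact: subrr.
have := he set0; rewrite /zero_ideal /unit_chain eqxx mulr1 => /(congr1 (mcoeff u)) /eqP.
rewrite mcoeffB mcoeffX eqxx mcoeff0 subr_eq0 => /eqP E.
have : (bd M e set0)@_u != 0 by rewrite -E oner_eq0.
rewrite /bd raddf_sum /= => /eqP; apply; apply: big1 => F _.
have [->|/eqP/se[[_ dF] /subsetP FY]] := eqVneq (e F) 0; first by rewrite mul0r mcoeff0.
rewrite /M /label_mx face_label0 subm0 mulrzAr raddfMz /= mcoeff_mulX; case: ifP; last by rewrite mul0rz.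
have /set0Pn[i iF] : F != set0 by apply: contra_eq_neq dF => ->; rewrite hdeg0.
move=> Fu; have := uY i (FY i iF).
by rewrite (lepm_trans (face_label_vertex b iF) Fu).
Qed.

End ApexCoprime.

Lemma apex_coprime (k : fieldType) (R : realFieldType) (d v : nat) (p : 'I_v -> 'rV[R]_d)
    (t : 'rV[R]_d) (ht : ~ in_aff p t) (r : nat) (b : 'I_v.+1 -> 'X_{1..r}) z i :
  CM_labelling k (pyramid p t) b -> b ord_max z <> 0%N -> b (lift ord_max i) z = 0%N.
Proof.
move=> /CM_labellingP[_ [[T0 [cT0 _]] cov] [sgn [inc ex _]]] btz.
have [T minT _] : {T | minset (covers_free b z) T & T \subset setT}.
  apply: minset_exists; apply/covers_freeP => j _; have [l [_ bl]] := cT0 j.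
  by exists l.
have [F [[fF dF] FY]] := free_face_exists inc ex minT.
have [/covers_freeP cT _] := minsetP minT.
have Ft : ord_max \notin F.
  by apply: contraT; rewrite negbK => /(subsetP FY); rewrite inE => /eqP.
have EF : F = up false (base F) by rewrite -{1}(up_base F) (negPf Ft).
rewrite EF in fF dF; have {}fF := proj1 (is_face_up ht _ _) fF.
rewrite (hdeg_up ht) addn0 in dF.
(* Adding [z] to [T] covers the remaining labels, and a cover for the pyramid has at least
   [hdeg p setT + 1] elements. *)
have cT' : (hdeg p setT <= #|T|)%N.
  have : (hdeg (pyramid p t) setT <= #|z |: T|)%N.
    apply: cov => j; have [jY|] := boolP (j \in free_of b z).
      by have [l [lT bl]] := cT j jY; exists l; rewrite in_setU1 lT orbT.
    by rewrite inE => /eqP bz; exists z; rewrite setU11.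
  rewrite -upT (hdeg_up ht) addn1 => /leq_trans -/(_ #|T|.+1); rewrite ltnS; apply.
  by rewrite cardsU1; case: (z \in T); rewrite ?add0n ?add1n.
have E : base F = setT.
  apply: (face_hdeg_eq fF (subsetT _)); apply/eqP.
  by rewrite eqn_leq hdegS ?subsetT // dF.
have : lift ord_max i \in F by rewrite EF in_up_lift E inE.
by move/(subsetP FY); rewrite inE => /eqP.
Qed.

(** * The labelling of the base *)

Section SubVariables.
Variables (s : nat) (V : {set 'I_s}).

Definition restr (m : 'X_{1..s}) : 'X_{1..#|V|} := [multinom m (enum_val j) | j < #|V|].
(** Extension by zero: the sum has one term when [z] lies in [V] and none otherwise. *)
Definition emb (m : 'X_{1..#|V|}) : 'X_{1..s} :=
  [multinom (\sum_(j | enum_val j == z) m j)%N | z < s].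

Lemma emb_val m j : emb m (enum_val j) = m j.
Proof. by rewrite mnmE (big_pred1 j) // => l; rewrite (inj_eq enum_val_inj). Qed.

Lemma emb_out m z : z \notin V -> emb m z = 0%N.
Proof. by move=> zV; rewrite mnmE big1 // => j /eqP E; rewrite -E enum_valP in zV. Qed.

Lemma enum_valK_ex z : z \in V -> exists j : 'I_#|V|, enum_val j = z.
Proof. by move=> zV; exists (enum_rank_in zV z); rewrite enum_rankK_in. Qed.

Lemma restrK (m : 'X_{1..s}) : (forall z, z \notin V -> m z = 0%N) -> emb (restr m) = m.
Proof.
move=> H; apply/mnmP => z; have [zV|zV] := boolP (z \in V); last by rewrite emb_out ?H.
by have [j <-] := enum_valK_ex zV; rewrite emb_val mnmE.
Qed.

Lemma emb0 : emb 0%MM = 0%MM.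
Proof. by apply/mnmP => z; rewrite mnmE mnm0E big1 // => j _; rewrite mnm0E. Qed.

Lemma embD m m' : emb (m + m')%MM = (emb m + emb m')%MM.
Proof. by apply/mnmP => z; rewrite mnmDE !mnmE -big_split; apply: eq_bigr => j _; rewrite mnmDE. Qed.

Lemma emb_le m m' : (emb m <= emb m')%MM = (m <= m')%MM.
Proof.
apply/mnm_lepP/mnm_lepP => H j; first by have := H (enum_val j); rewrite !emb_val.
by rewrite !mnmE; apply: leq_sum.
Qed.

End SubVariables.

Section Base.
Variables (k : fieldType) (R : realFieldType) (d v : nat) (p : 'I_v -> 'rV[R]_d) (t : 'rV[R]_d).
Hypothesis ht : ~ in_aff p t.
Local Notation q := (pyramid p t).
Variables (s : nat) (b : 'I_v.+1 -> 'X_{1..s}).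
Hypothesis CMb : CM_labelling k q b.

(** Keeping only variables that occur in labels of the base makes every monomial in them divide a
    power of the product of these labels, which controls morphisms later on. *)
Definition base_vars : {set 'I_s} := [set z | [exists i : 'I_v, b (lift ord_max i) z != 0%N]].
Local Notation V := base_vars.
Definition base_label (i : 'I_v) : 'X_{1..#|V|} := restr V (b (lift ord_max i)).

Lemma emb_base_label i : emb (base_label i) = b (lift ord_max i).
Proof.
apply: restrK => z; rewrite inE => /existsPn/(_ i); rewrite negbK => /eqP.
by [].
Qed.

Lemma apex_out z : z \in V -> b ord_max z = 0%N.
Proof.
rewrite inE => /existsP[i biz]; apply/eqP/negPn/negP => /eqP bz.
by move/eqP: biz; apply; apply: (apex_coprime ht i CMb bz).
Qed.

Lemma apex_var : exists z, z \notin V /\ b ord_max z <> 0%N.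
Proof.
have [_ [[T [cT _]] _] _] := proj1 (CM_labellingP _ _ _) CMb.
have [z [_ bz]] := cT ord_max; exists z; split=> //.
by apply/negP => /apex_out.
Qed.

Lemma face_label_emb_le G (m : 'X_{1..#|V|}) :
  (face_label b (up false G) <= emb m)%MM <-> (face_label base_label G <= m)%MM.
Proof.
split=> /face_label_le H; apply/face_label_le => i.
  move=> iG; have := H (lift ord_max i); rewrite in_up_lift => /(_ iG).
  by rewrite -emb_base_label emb_le.
case: (unliftP ord_max i) => [j ->|->]; last by rewrite in_up_max.
by rewrite in_up_lift -emb_base_label emb_le => /H.
Qed.

Lemma face_label_apex G (m : 'X_{1..#|V|}) : ~ (face_label b (up true G) <= emb m)%MM.
Proof.
move=> /face_label_le /(_ ord_max); rewrite in_up_max => /(_ isT) /mnm_lepP H.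
have [z [zV bz]] := apex_var; have := H z; rewrite (emb_out m zV) leqn0 => /eqP.
exact: bz.
Qed.

Lemma face_label_emb G : face_label b (up false G) = emb (face_label base_label G).
Proof.
apply: lem_antisym; first by apply/face_label_emb_le; apply: lepm_refl.
rewrite -[X in (_ <= X)%MM](@restrK _ V); last first.
  move=> z zV; apply/eqP; rewrite -leqn0.
  have : (face_label b (up false G) <= emb (face_label base_label G))%MM.
    by apply/face_label_emb_le; apply: lepm_refl.
  by move/mnm_lepP/(_ z); rewrite emb_out.
rewrite emb_le; apply/face_label_le => i iG; apply/mnm_lepP => j; rewrite !mnmE.
by apply: (mnm_lepP (face_label_vertex b _)); rewrite in_up_lift.
Qed.

(** The apex label is nontrivial and uses only variables outside [V]: one of them completes any
    cover of the base, and every cover of the pyramid contains one. *)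
Lemma base_min_cover c : min_cover b c.+1 -> min_cover base_label c.
Proof.
move=> [[T0 [cT0 cardT0]] H].
have [zt [ztV bzt]] := apex_var.
have lower T : covers base_label T -> (c <= #|T|)%N.
  move=> cT; rewrite -ltnS; apply: (@leq_trans #|zt |: enum_val @: T|).
    apply: H => i; case: (unliftP ord_max i) => [j ->|->]; last by exists zt; rewrite setU11.
    have [l [lT bl]] := cT j; exists (enum_val l); split; last by move: bl; rewrite mnmE.
    by rewrite in_setU1 imset_f ?orbT.
  rewrite cardsU1 card_imset; last exact: enum_val_inj.
  by rewrite -add1n leq_add2r leq_b1.
split=> //; pose T := [set j : 'I_#|V| | enum_val j \in T0].
have cT : covers base_label T.
  move=> i; have [l [lT0 bl]] := cT0 (lift ord_max i).
  have lV : l \in V by rewrite inE; apply/existsP; exists i; apply/eqP.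
  by have [j E] := enum_valK_ex lV; exists j; rewrite inE mnmE E.
exists T; split=> //; apply/eqP; rewrite eqn_leq lower // andbT.
have [z [zT0 bz]] := cT0 ord_max.
have : #|T0 :\ z| = c by move: cardT0; rewrite (cardsD1 z) zT0 => -[].
move=> <-; rewrite -(card_imset T enum_val_inj); apply: subset_leq_card.
apply/subsetP => _ /imsetP[j + ->]; rewrite !inE => ->; rewrite andbT.
apply/eqP => E; apply: bz; rewrite -E; apply: apex_out; exact: enum_valP.
Qed.

(** In a degree supported on [V] no face containing the apex occurs, so the complexes of the pyramid
    and of the base coincide there. *)
Lemma base_exact sgn : incidence_function q sgn -> exact_cells k q sgn b ->
  exact_cells k p (fun G F => sgn (up false G) (up false F)) base_label.
Proof.
move=> inc ex beta j c sc c0.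
pose Mp := sign_mx k (fun G F : {set 'I_v} => sgn (up false G) (up false F)).
have below i G : cells_below (face_label b) (cells q) (emb beta) i (up false G) <->
    cells_below (face_label base_label) (cells p) beta i G.
  rewrite /cells_below /cells (hdeg_up ht) addn0; have fG := is_face_up ht false G.
  have lG := face_label_emb_le G beta.
  by split=> [[[/fG ? ?] /lG]|[[/fG ? ?] /lG]].
have bd_false (e : {set 'I_v.+1} -> k) G : (forall H, e (up true H) = 0) ->
    bd (sign_mx k sgn) e (up false G) = bd Mp (fun H => e (up false H)) G.
  by move=> e0; rewrite /bd big_up [X in _ + X]big1 ?addr0 // => H _; rewrite e0 mul0r.
pose c' (F : {set 'I_v.+1}) := if ord_max \in F then 0 else c (base F).
have c'f G : c' (up false G) = c G by rewrite /c' in_up_max base_up.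
have c't G : c' (up true G) = 0 by rewrite /c' in_up_max.
have [F|F|e [se he]] := ex (emb beta) j c'.
- rewrite -(up_base F); case: (_ \in F); first by rewrite c't.
  by rewrite c'f => /sc/below.
- rewrite -(up_base F); case: (_ \in F); last first.
    rewrite bd_false //; have := c0 (base F); rewrite /zero_ideal => <-.
    by apply: eq_bigr => H _; rewrite c'f.
  rewrite /zero_ideal /bd big_up [X in _ + X]big1 ?addr0 => [|H _]; last by rewrite c't mul0r.
  apply: big1 => H _; rewrite /sign_mx; have [->|] := eqVneq (sgn (up true (base F)) (up false H)) 0.
    by rewrite mulr0.
  by move/(incidence_facet inc) => [_ _]; rewrite up_sub.
have et G : e (up true G) = 0.
  by apply/eqP/negPn/negP => /eqP/se[_ /face_label_apex].
exists (fun G => e (up false G)); split=> [G /se/below //|G].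
by have := he (up false G); rewrite c'f bd_false.
Qed.

Theorem base_CM : CM_labelling k p base_label.
Proof.
have /CM_labellingP[anti cov [sgn [inc ex min]]] := CMb; apply/CM_labellingP; split.
- move=> i j ij; have := anti (lift ord_max i) (lift ord_max j).
  by rewrite (inj_eq lift_inj) -!emb_base_label emb_le; apply.
- by apply: base_min_cover; move: cov; rewrite -upT (hdeg_up ht) addn1.
exists (fun G F => sgn (up false G) (up false F)); split.
- exact: (incidence_base ht inc).
- exact: base_exact.
by move=> G F /min E1 E2; apply: E1; rewrite !face_label_emb E2.
Qed.

End Base.

(** * Maximal labellings *)

Lemma base_degree0 r : base_degree (0%MM : 'X_{1..r.+1}) = 0%MM.
Proof. by apply/mnmP => j; rewrite mnmE !mnm0E. Qed.

Lemma base_degreeD r (m m' : 'X_{1..r.+1}) :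
  base_degree (m + m')%MM = (base_degree m + base_degree m')%MM.
Proof. by apply/mnmP => j; rewrite mnmDE !mnmE. Qed.

Lemma base_degree_widen r (m : 'X_{1..r}) : base_degree (mnmwiden m) = m.
Proof. by apply/mnmP => j; rewrite mnmE mnmwiden_lift. Qed.

Lemma base_degree_max r : base_degree (U_(ord_max) : 'X_{1..r.+1})%MM = 0%MM.
Proof. by apply/mnmP => j; rewrite mnmE mnm1E mnm0E (negPf (neq_lift _ _)). Qed.

Lemma mnm_split r (m : 'X_{1..r.+1}) :
  (mnmwiden (base_degree m) + U_(ord_max) *+ m ord_max)%MM = m.
Proof.
apply/mnmP => i; rewrite mnmDE mulmnE mnm1E; case: (unliftP ord_max i) => [j ->|->].
  by rewrite mnmwiden_lift mnmE (negPf (neq_lift _ _)) mul0n addn0.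
by rewrite mnmwiden_ordmax eqxx mul1n.
Qed.

Section Morphisms.
Variables (r s : nat) (phi : 'X_{1..s} -> 'X_{1..r}).
Hypotheses (phi0 : phi 0%MM = 0%MM) (phiD : {morph phi : x y / (x + y)%MM}).

Lemma mnm_morphMn m i : phi (m *+ i)%MM = (phi m *+ i)%MM.
Proof. by elim: i => [|i IH]; rewrite ?mulm0n // !mulmS phiD IH. Qed.

Lemma mnm_morph_le m m' : (m <= m')%MM -> (phi m <= phi m')%MM.
Proof. by move=> le; rewrite -(submK le) phiD lem_addl. Qed.

End Morphisms.

Section Lifting.
Variables (v r s : nat) (a : 'I_v -> 'X_{1..r}).

Definition pyramid_lift_morphism (phi : 'X_{1..r} -> 'X_{1..s}) (y : 'X_{1..s})
    (m : 'X_{1..r.+1}) : 'X_{1..s} := (phi (base_degree m) + y *+ m ord_max)%MM.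

Lemma pyramid_lift_morphismP (b : 'I_v.+1 -> 'X_{1..s}) phi :
  CM_morphism a (fun i => b (lift ord_max i)) phi ->
  CM_morphism (pyramid_label a) b (pyramid_lift_morphism phi (b ord_max)).
Proof.
rewrite /pyramid_lift_morphism => -[phi0 phiD phia]; split.
- by rewrite base_degree0 phi0 mnm0E mulm0n addm0.
- move=> x y; rewrite base_degreeD phiD mnmDE; apply/mnmP => j.
  by rewrite !mnmDE !mulmnE; lia.
move=> i; case: (unliftP ord_max i) => [j ->|->].
  by rewrite pyramid_label_lift base_degree_widen phia mnmwiden_ordmax mulm0n addm0.
by rewrite pyramid_label_max base_degree_max phi0 mnm1E eqxx mulm1n add0m.
Qed.

End Lifting.

Section PyramidMaximal.
Variables (k : fieldType) (R : realFieldType) (d v : nat) (p : 'I_v -> 'rV[R]_d) (t : 'rV[R]_d).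
Hypothesis ht : ~ in_aff p t.
Local Notation q := (pyramid p t).

(** A morphism to [a] extends to the pyramids by fixing [y]; forgetting the exponent of [y] carries
    surjectivity and splitting back. *)
Lemma maximal_base r (a : 'I_v -> 'X_{1..r}) : CM_labelling k p a ->
  CM_maximal k q (pyramid_label a) -> CM_maximal k p a.
Proof.
move=> CMa [_ maxpa]; split=> // s b phi CMb [phi0 phiD phib].
pose phi' := pyramid_lift_morphism (fun m => mnmwiden (phi m)) U_(ord_max)%MM.
have [||surj [psi [[psi0 psiD psia] psiK]]] := maxpa s.+1 (pyramid_label b) phi'.
- exact: pyramid_CM.
- rewrite /phi' -(pyramid_label_max a); apply: pyramid_lift_morphismP; split=> [|x y|i].
  + by rewrite phi0 mnmwiden0.
  + by rewrite phiD mnmwidenD.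
  + by rewrite phib pyramid_label_lift.
have base_phi' m : base_degree (phi' m) = phi (base_degree m).
  rewrite /phi' /pyramid_lift_morphism base_degreeD base_degree_widen; apply/mnmP => j.
  by rewrite mnmDE [X in (_ + X)%N]mnmE mulmnE mnm1E (negPf (neq_lift _ _)) mul0n addn0.
split=> [y|].
  have [x E] := surj (mnmwiden y); exists (base_degree x).
  by rewrite -base_phi' E base_degree_widen.
exists (fun m => base_degree (psi (mnmwiden m))); split=> [|m].
  split=> [|x y|i].
  - by rewrite mnmwiden0 psi0 base_degree0.
  - by rewrite mnmwidenD psiD base_degreeD.
  - by rewrite -pyramid_label_lift psia pyramid_label_lift base_degree_widen.
by rewrite -base_phi' psiK base_degree_widen.
Qed.

Lemma maximal_pyramid r (a : 'I_v -> 'X_{1..r}) :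
  CM_maximal k p a -> CM_maximal k q (pyramid_label a).
Proof.
move=> [CMa maxa]; split=> [|s b phi CMb [phi0 phiD phib]]; first exact: pyramid_CM.
(* [N] is the product of the base labels. Its image is free of [y], and so is the image of every
   divisor of a power of [N], in particular of every monomial in [V]. *)
pose V := base_vars b; pose N := (\sum_(i < v) b (lift ord_max i))%MM.
have phiN : phi N ord_max = 0%N.
  rewrite /N; elim/big_ind: _ => [|x y Hx Hy|i _]; first by rewrite phi0 mnm0E.
    by rewrite phiD mnmDE Hx Hy.
  by rewrite phib pyramid_label_lift mnmwiden_ordmax.
have phi_emb (m : 'X_{1..#|V|}) : phi (emb m) ord_max = 0%N.
  have le : (emb m <= N *+ mdeg m)%MM.
    apply/mnm_lepP => z; have [zV|zV] := boolP (z \in V); last by rewrite emb_out.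
    have [j Ej] := enum_valK_ex zV; rewrite -{1}Ej emb_val.
    apply: (@leq_trans (mdeg m)); first by rewrite mdegE (bigD1 j) //= leq_addr.
    rewrite mulmnE leq_pmull //; move: zV; rewrite inE => /existsP[i bz].
    by rewrite /N mnm_sumE (bigD1 i) //= ltn_addr // lt0n.
  apply/eqP; rewrite -leqn0; have /mnm_lepP/(_ ord_max) := mnm_morph_le phiD le.
  by rewrite (mnm_morphMn phi0 phiD) mulmnE phiN mul0n.
pose phi1 (m : 'X_{1..#|V|}) := base_degree (phi (emb m)).
have phi1E m : phi (emb m) = mnmwiden (phi1 m).
  by rewrite -{1}[phi (emb m)]mnm_split phi_emb mulm0n addm0.
have [||_ [psi [[psi0 psiD psia] psiK]]] := maxa #|V| (base_label b) phi1.
- exact: base_CM ht _ _ CMb.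
- split=> [|x y|i]; rewrite /phi1.
  + by rewrite emb0 phi0 base_degree0.
  + by rewrite embD phiD base_degreeD.
  + by rewrite emb_base_label phib pyramid_label_lift base_degree_widen.
(* The splitting over the base is extended by sending [y] to the apex label, which [phi] maps back
   to [y]. *)
pose Psi := pyramid_lift_morphism (fun m => emb (psi m)) (b ord_max).
have PsiK : cancel Psi phi.
  move=> m; rewrite /Psi /pyramid_lift_morphism phiD phi1E psiK (mnm_morphMn phi0 phiD).
  by rewrite phib pyramid_label_max mnm_split.
split=> [y|]; first by exists (Psi y); apply: PsiK.
exists Psi; split=> //; apply: pyramid_lift_morphismP; split=> [|x y|i].
- by rewrite psi0 emb0.
- by rewrite psiD embD.
- by rewrite psia emb_base_label.
Qed.

(** Maximality splits the morphism sending [y] to the apex label. That morphism is also injective: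
    the exponents over [V] are visible directly, and that of [y] at a variable of the apex label
    outside [V]. *)
Lemma maximal_pyramid_form s (b : 'I_v.+1 -> 'X_{1..s}) : CM_maximal k q b ->
  exists (r : nat) (a : 'I_v -> 'X_{1..r}),
    CM_labelling k p a /\ CM_isomorphic b (pyramid_label a).
Proof.
move=> [CMb maxb]; pose V := base_vars b.
have CMa := base_CM ht CMb.
exists #|V|, (base_label b); split=> //.
pose phi := pyramid_lift_morphism (@emb s V) (b ord_max).
have morph_phi : CM_morphism (pyramid_label (base_label b)) b phi.
  apply: pyramid_lift_morphismP; split; [exact: emb0 | exact: embD | exact: emb_base_label].
have [_ [psi [morph_psi psiK]]] := maxb _ _ _ (pyramid_CM ht CMa) morph_phi.
have inj_phi : injective phi.
  move=> m m' /mnmP E; rewrite -[m]mnm_split -[m']mnm_split; congr (mnmwiden _ + _ *+ _)%MM.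
    apply/mnmP => j; have := E (enum_val j).
    by rewrite !mnmDE !emb_val !mulmnE (apex_out ht CMb) ?enum_valP // !mul0n !addn0.
  have [z [zV bz]] := apex_var ht CMb.
  have := E z; rewrite !mnmDE !emb_out // !mulmnE !add0n => /eqP.
  by rewrite eqn_pmul2l ?lt0n; [move/eqP | apply/eqP].
by exists psi, phi; split=> // x; apply: inj_phi; rewrite psiK.
Qed.

End PyramidMaximal.

Theorem theorem4p4 (k : fieldType) (R : realFieldType) (d v : nat)
    (p : 'I_v -> 'rV[R]_d) (hp : polytope_vertices p)
    (t : 'rV[R]_d) (ht : ~ in_aff p t) :
  (forall (r : nat) (a : 'I_v -> 'X_{1..r}),
     CM_labelling k p a ->
     CM_labelling k (pyramid p t) (pyramid_label a) /\
     (CM_maximal k p a <-> CM_maximal k (pyramid p t) (pyramid_label a))) /\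
  (forall (s : nat) (b : 'I_v.+1 -> 'X_{1..s}),
     CM_maximal k (pyramid p t) b ->
     exists (r : nat) (a : 'I_v -> 'X_{1..r}),
       CM_labelling k p a /\ CM_isomorphic b (pyramid_label a)).
Proof.
split=> [r a CMa|s b]; last exact: maximal_pyramid_form.
split; first exact: pyramid_CM.
by split; [apply: maximal_pyramid | apply: maximal_base].
Qed.
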